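(* Let $L$ be an integral Euclidean lattice of rank $l$. For all $\mu_1,\mu_2,\mu_3\in L$, $\alpha_1,\alpha_2,\alpha_3\in\mathbb{C}^l$ and $u,v,w\in M^l$, the vertex operators $Y_\alpha(u\otimes e^{\mu+\alpha},z)$ satisfy the generalized Jacobi identity $$z_0^{-1}\left(\frac{z_1-z_2}{z_0}\right)^{\eta_{12}}\delta\left(\frac{z_1-z_2}{z_0}\right)Y_{\alpha_1}(u\otimes e^{\mu_1+\alpha_1},z_1)\,Y_{\alpha_2}(v\otimes e^{\mu_2+\alpha_2},z_2)\,(w\otimes e^{\mu_3+\alpha_3})$$ $$-\,C_{12}\,z_0^{-1}\left(\frac{z_2-z_1}{z_0}\right)^{\eta_{12}}\delta\left(\frac{z_2-z_1}{-z_0}\right)Y_{\alpha_2}(v\otimes e^{\mu_2+\alpha_2},z_2)\,Y_{\alpha_1}(u\otimes e^{\mu_1+\alpha_1},z_1)\,(w\otimes e^{\mu_3+\alpha_3})$$ $$=z_2^{-1}\left(\frac{z_1-z_0}{z_2}\right)^{-\eta_{13}}\delta\left(\frac{z_1-z_0}{z_2}\right)Y_{\alpha_1+\alpha_2}\big(Y_{\alpha_1}(u\otimes e^{\mu_1+\alpha_1},z_0)(v\otimes e^{\mu_2+\alpha_2}),z_2\big)(w\otimes e^{\mu_3+\alpha_3}),$$ where $$\eta_{12}=-\alpha_1\cdot\alpha_2-\mu_1\cdot\alpha_2-\mu_2\cdot\alpha_1,\qquad \eta_{13}=-\alpha_1\cdot\alpha_3-\mu_1\cdot\alpha_3-\mu_3\cdot\alpha_1,$$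 and $$C_{12}=e^{i\pi N(\alpha_1\cdot\mu_2-\alpha_2\cdot\mu_1)}(-1)^{\mu_1^2\mu_2^2}.$$
   Context: For $\alpha,\beta\in\mathbb{C}^l$ write $\alpha\cdot\beta=\sum_{i=1}^l\alpha^i\beta^i$ (complex bilinear), $\alpha^2=\alpha\cdot\alpha$; $L\subset\mathbb{R}^l\subset\mathbb{C}^l$ with $\mu\cdot\nu\in\mathbb{Z}$ for $\mu,\nu\in L$. $M^l$ is the rank $l$ Heisenberg vertex operator algebra, generated by weight one vectors $a^1,\dots,a^l$ whose modes satisfy $[a^i(n),a^j(m)]=n\,\delta_{n,-m}\delta_{i,j}$; it is spanned by the vectors $a^{i_1}(-k_1)\cdots a^{i_r}(-k_r)\mathbf{1}$, $k_j>0$, with Virasoro vector $\omega=\frac12\sum_i a^i(-1)^2\mathbf{1}$. For $\alpha\in\mathbb{C}^l$, $M_\alpha=M^l\otimes e^\alpha$ is the irreducible $M^l$-module with $a^i(0)(u\otimes e^\alpha)=\alpha^i(u\otimes e^\alpha)$ and $a^i(n)(u\otimes e^\alpha)=(a^i(n)u)\otimes e^\alpha$ for $n\ne0$. For $u\in M^l$, $Y(u,z)$ denotes the (module) vertex operator on every $M_\alpha$. Put $\alpha(n)=\sum_i\alpha^ia^i(n)$, $Y_\pm(\alpha,z)=\exp\big(\mp\sum_{n>0}\frac{\alpha(\pm n)}{n}z^{\mp n}\big)$, $\mathcal{M}=\bigoplus_{\beta\in\mathbb{C}^l}M_\beta$. The operator $e^{\alpha\cdot q}$ on $\mathcal{M}$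 is $u\otimes e^\beta\mapsto u\otimes e^{\alpha+\beta}$; put $\psi_\alpha=e^{-\alpha\cdot q}$. Cocycle structure: $\epsilon:\mathbb{C}^l\times\mathbb{C}^l\to\mathbb{C}^\times$ with $\epsilon(\alpha,0)=\epsilon(0,\alpha)=1$; $c_\alpha(u\otimes e^\beta)=\epsilon(\alpha,\beta)u\otimes e^\beta$ and $e^\alpha=e^{\alpha\cdot q}c_\alpha$ as an operator on $\mathcal{M}$; it is assumed that $e^\alpha e^\beta=\epsilon(\alpha,\beta)e^{\alpha+\beta}$, $e^0=1$, and that $C(\alpha,\beta)=\epsilon(\alpha,\beta)/\epsilon(\beta,\alpha)$ satisfies $C(\mu_1,\mu_2)=(-1)^{\mu_1\cdot\mu_2+\mu_1^2\mu_2^2}$ for $\mu_1,\mu_2\in L$. The vertex operators on $\mathcal{M}$ are $\mathcal{Y}(u\otimes e^\alpha,z)=e^\alpha Y_-(\alpha,z)Y(u,z)Y_+(\alpha,z)z^{\alpha(0)}$, with $z^{\alpha(0)}$ acting on $M_\gamma$ as $z^{\alpha\cdot\gamma}$, extended linearly in the first argument. $V_{L+\alpha}=\bigoplus_{\mu\in L}M_{\mu+\alpha}$. Put $\Delta(\alpha,z)=z^{\alpha(0)}Y_+(\alpha,-z)$. $N$ is a fixed odd integer and $(-z)^\kappa=e^{i\pi N\kappa}z^\kappa$, so that $\Delta(\alpha,-z)=(-z)^{\alpha(0)}Y_+(\alpha,z)$. For $\alpha,\beta\in\mathbb{C}^l$, $\mu_1,\mu_2\in L$, $u,v\in M^l$,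 the operator $Y_\alpha$ is defined on $V_{L+\beta}$ by $$Y_\alpha(u\otimes e^{\mu_1+\alpha},z)(v\otimes e^{\mu_2+\beta})=\psi_{-\alpha-\beta}\,Y_-(\alpha,z)\,\mathcal{Y}\big(\psi_\alpha\Delta(\beta,z)(u\otimes e^{\mu_1+\alpha}),z\big)\,\Delta(\alpha,-z)\,\psi_\beta(v\otimes e^{\mu_2+\beta}),$$ where each sector $V_{L+\alpha}$ is taken with its label $\alpha$ (the definition depends on the decompositions $\mu_1+\alpha$ and $\mu_2+\beta$); the result lies in the sector $V_{L+\alpha+\beta}$ with label $\alpha+\beta$ (lattice part $\mu_1+\mu_2$). Formal conventions: $\delta(x/y)=\sum_{n\in\mathbb{Z}}x^ny^{-n}$, $(x+y)^\kappa=\sum_{m\ge0}\binom{\kappa}{m}x^{\kappa-m}y^m$ for $\kappa\in\mathbb{C}$, $\left(\frac{x+y}{z}\right)^\kappa=(x+y)^\kappa z^{-\kappa}$. *)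

(* Defs.v *)
From HB Require Import structures.
From mathcomp Require Import all_boot all_order all_algebra.
From mathcomp Require Import finmap multiset.
From mathcomp Require Import complex.
From mathcomp Require Import boolp classical_sets fsbigop.
From mathcomp Require Import reals sequences exp trigo.
From mathcomp Require Import monalg.

Set Implicit Arguments.
Unset Strict Implicit.
Unset Printing Implicit Defensive.

Import Order.TTheory GRing.Theory Num.Theory.

Local Open Scope ring_scope.
Local Open Scope classical_set_scope.
Local Open Scope complex_scope.
Local Open Scope mset_scope.
Local Open Scope ring_scope.

(* Every infinite sum of formal calculus is written with the finite-support
   big operator of fsbigop: the coefficients of all the products below are sums
   with finitely many nonzero terms. *)

Section Scalars.
Variable R : realType.
Local Notation C := R[i].

Definition dot (F : comNzRingType) (l : nat) (a b : 'rV[F]_l) : F :=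
  \sum_(i < l) a 0 i * b 0 i.

Definition toC (l : nat) (x : 'rV[R]_l) : 'rV[C]_l := map_mx (real_complex R) x.

Definition cexp (z : C) : C :=
  (expR (complex.Re z))%:C * (cos (complex.Im z) +i* sin (complex.Im z)).

(* e^{i pi N k} = (-1)^k for the branch fixed by the odd integer N *)
Definition phase (N : int) (k : C) : C := cexp ((0 +i* (pi * N%:~R)) * k).

(* (-1)^x, for a real number x that is an integer *)
Definition sgnpow (x : R) : C := (-1) ^ (Num.floor x).

Definition cbinom (x : C) (m : nat) : C :=
  (\prod_(j < m) (x - j%:R)) / (m`!)%:R.

Definition integral_lattice (l : nat) (L : set 'rV[R]_l) : Prop :=
  (exists2 B : 'M[R]_l, B \in unitmx &
     forall x, L x <-> exists c : 'rV[int]_l, x = map_mx intr c *m B)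
  /\ (forall x y, L x -> L y -> dot x y \is a Num.int).

End Scalars.

Section FormalSeries3.
Variable R : realType.
Local Notation C := R[i].

(* A formal series in z_0, z_1, z_2 with complex exponents is its coefficient
   function on exponent vectors. *)
Local Notation expo := 'rV[C]_3.

Definition z0 : 'I_3 := @Ordinal 3 0 isT.
Definition z1 : 'I_3 := @Ordinal 3 1 isT.
Definition z2 : 'I_3 := @Ordinal 3 2 isT.

Definition mono3 (j : 'I_3) (k : C) : expo -> C :=
  fun e => (e == k *: delta_mx 0 j)%:R.

Definition mul3 (V : lmodType C) (A : expo -> C) (S : expo -> V) : expo -> V :=
  fun e => \sum_(d \in [set: expo]) A d *: S (e - d).

Definition smul3 (A B : expo -> C) : expo -> C := mul3 (V := C^o) A B.

(* (z_x - z_y)^k, expanded in nonnegative powers of z_y *)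
Definition subpow (x y : 'I_3) (k : C) : expo -> C :=
  fun e => \sum_(m \in [set: nat])
    cbinom k m * (-1) ^+ m
    * (smul3 (mono3 x (k - m%:R)) (mono3 y m%:R)) e.

(* ((z_x - z_y) / z_w)^k *)
Definition ratpow (x y w : 'I_3) (k : C) : expo -> C :=
  smul3 (subpow x y k) (mono3 w (- k)).

(* delta((z_x - z_y) / (s z_w)), with s = 1 or s = -1 *)
Definition delta3 (x y w : 'I_3) (s : C) : expo -> C :=
  fun e => \sum_(n \in [set: int])
    (smul3 (subpow x y n%:~R)
           (fun d => s ^ (- n) * mono3 w (- n%:~R) d)) e.

(* z_w^{-1} ((z_x - z_y) / z_w)^k delta((z_x - z_y) / (s z_w)) *)
Definition jacobi_kernel (x y w : 'I_3) (s k : C) : expo -> C :=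
  smul3 (mono3 w (-1)) (smul3 (ratpow x y w k) (delta3 x y w s)).

End FormalSeries3.

(* The multiset {(i_1, k_1), ..., (i_r, k_r)} encodes the vector
   a^{i_1}(-k_1 - 1) ... a^{i_r}(-k_r - 1) 1; the shift makes the mode indices
   positive. *)
Notation fockb l := ({mset ('I_l * nat)%type}%mset).

(* M^l *)
Notation fock R l := ({malg R[i][fockb l]}).

(* The direct sum of all the M_b; the basis vector (m, b) is m (x) e^b. *)
Notation bigM R l := ({malg R[i][(fockb l * 'rV[R[i]]_l)%type]}).

(* The two operations below are locked because unification up to conversion
   does not terminate in practice on malg over a concrete index type. *)
HB.lock Definition ket (R : realType) (K : choiceType) (b : K) : {malg R[i][K]} :=
  << b >>.

(* Linear extension of a map defined on the basis *)
HB.lock Definition extend (R : realType) (K : choiceType) (V : lmodType R[i])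
  (f : K -> V) (x : {malg R[i][K]}) : V := \sum_(k <- msupp x) x@_k *: f k.

Section Heisenberg.
Variables (R : realType) (l : nat).
Local Notation C := R[i].
Local Notation fockb := (fockb l).
Local Notation fock := (fock R l).
Local Notation bigM := (bigM R l).

(* u (x) e^a *)
Definition tens (u : fock) (a : 'rV[C]_l) : bigM :=
  extend (fun m : fockb => ket R (m, a)) u.

(* a^i(n): n = k + 1 acts as n times the partial derivative with respect to the
   generator a^i(-n), and n = - (k + 1) as multiplication by it. *)
Definition heis (i : 'I_l) (n : int) : bigM -> bigM :=
  extend (fun b : fockb * 'rV[C]_l =>
    match n with
    | Posz 0 => b.2 0 i *: ket R b
    | Posz k.+1 => (k.+1 * b.1 (i, k))%N%:R
                   *: ket R (b.1 `\ (i, k), b.2)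
    | Negz k => ket R ((i, k) +` b.1, b.2)
    end).

(* a(n) = sum_i a^i a^i(n) *)
Definition amode (a : 'rV[C]_l) (n : int) (v : bigM) : bigM :=
  \sum_(i < l) a 0 i *: heis i n v.

(* Operator-valued formal series in one variable with complex exponents:
   F k is the coefficient of z^k. *)
Definition opser := C -> bigM -> bigM.

Definition opconst (T : bigM -> bigM) : opser := fun k v => T v *+ (k == 0).

Definition opadd (F G : opser) : opser := fun k v => F k v + G k v.

Definition opcomp (F G : opser) : opser :=
  fun k v => \sum_(t \in [set: C]) F t (G (k - t) v).

(* sum_(j in A) T_j z^{d_j} *)
Definition opsum (J : choiceType) (A : set J) (d : J -> C)
  (T : J -> bigM -> bigM) : opser :=
  fun k v => \sum_(j \in A) T j v *+ (k == d j).

Definition opexp (F : opser) : opser :=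
  fun k v => \sum_(r \in [set: nat])
    (r`!)%:R^-1 *: iter r (opcomp F) (opconst id) k v.

(* F(-z), with (-z)^k = e^{i pi N k} z^k *)
Definition opneg (N : int) (F : opser) : opser := fun k v => phase N k *: F k v.

(* The part of (1/k!) (d/dz)^k a^i(z) with modes in A, where
   a^i(z) = sum_n a^i(n) z^{-n-1} *)
Definition dcurrent (A : set int) (i : 'I_l) (k : nat) : opser :=
  opsum A (fun n => - n%:~R - 1 - k%:R)
    (fun n v => cbinom (- n%:~R - 1 : C) k *: heis i n v).

(* The normally ordered product of the fields (1/k!) (d/dz)^k a^i(z); it does
   not depend on the order of the list s. *)
Fixpoint normal_product (s : seq ('I_l * nat)) : opser :=
  if s is (i, k) :: s' then
    opadd (opcomp (dcurrent [set n : int | n < 0] i k) (normal_product s'))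
          (opcomp (normal_product s') (dcurrent [set n : int | 0 <= n] i k))
  else opconst id.

(* Y(u, z) on every M_b *)
Definition Yfock (u : fock) : opser :=
  fun k v => extend (fun m : fockb => normal_product (enum_mset m) k v) u.

(* Y_+(a, z) and Y_-(a, z) *)
Definition Yplus (a : 'rV[C]_l) : opser :=
  opexp (opsum [set n : nat | (0 < n)%N] (fun n => - n%:R)
    (fun n v => - (n%:R^-1 *: amode a n%:Z v))).

Definition Yminus (a : 'rV[C]_l) : opser :=
  opexp (opsum [set n : nat | (0 < n)%N] (fun n => n%:R)
    (fun n v => n%:R^-1 *: amode a (- n%:Z) v)).

(* e^{a.q} *)
Definition expq (a : 'rV[C]_l) : bigM -> bigM :=
  extend (fun b : fockb * 'rV[C]_l => ket R (b.1, a + b.2)).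

Definition psi (a : 'rV[C]_l) : bigM -> bigM := expq (- a).

(* z^{a(0)} *)
Definition zpow (a : 'rV[C]_l) : opser :=
  fun k => extend (fun b : fockb * 'rV[C]_l => ket R b *+ (k == dot a b.2)).

(* Delta(a, z) = z^{a(0)} Y_+(a, -z) *)
Definition Delta (N : int) (a : 'rV[C]_l) : opser :=
  opcomp (zpow a) (opneg N (Yplus a)).

Section Cocycle.
Variable eps : 'rV[C]_l -> 'rV[C]_l -> C.

(* e^a = e^{a.q} c_a *)
Definition cocyc (a : 'rV[C]_l) : bigM -> bigM :=
  extend (fun b : fockb * 'rV[C]_l => eps a b.2 *: ket R b).

Definition eop (a : 'rV[C]_l) (v : bigM) : bigM := expq a (cocyc a v).

Definition cocycle_structure (L : set 'rV[R]_l) : Prop :=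
  [/\ forall a b, eps a b != 0,
      forall a, eps a 0 = 1 /\ eps 0 a = 1,
      forall a b v, eop a (eop b v) = eps a b *: eop (a + b) v,
      forall v, eop 0 v = v
    & forall x y, L x -> L y ->
        eps (toC x) (toC y) / eps (toC y) (toC x)
        = sgnpow (dot x y + dot x x * dot y y)].

(* The vertex operators on the direct sum of the M_b, extended linearly in U *)
Definition calY (U : bigM) : opser :=
  fun k v => extend (fun b : fockb * 'rV[C]_l =>
    opcomp (opconst (eop b.2))
      (opcomp (Yminus b.2)
        (opcomp (Yfock (ket R b.1))
          (opcomp (Yplus b.2) (zpow b.2)))) k v) U.

(* The same for a formal series U(z) = sum_t U_t z^t in the first argument *)
Definition calYser (U : C -> bigM) : opser :=
  fun k v => \sum_(t \in [set: C]) calY (U t) (k - t) v.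

(* Y_a(U, z) on the sector V_{L+b}, for U in the sector V_{L+a}; the labels a
   and b are data, since they are not determined by the cosets. *)
Definition Yab (N : int) (a b : 'rV[C]_l) (U : bigM) : opser :=
  opcomp (opconst (psi (- a - b)))
    (opcomp (Yminus a)
      (opcomp (calYser (fun t => opcomp (opconst (psi a)) (Delta N b) t U))
        (opcomp (opneg N (Delta N a)) (opconst (psi b))))).

(* Y_{a1}(U1, z_{x1}) Y_{a2}(U2, z_{x2}) W, for W in the sector with label a3 *)
Definition Yproduct (N : int) (x1 x2 : 'I_3) (a1 a2 a3 : 'rV[C]_l)
  (U1 U2 W : bigM) : 'rV[C]_3 -> bigM :=
  fun e => Yab N a1 (a2 + a3) U1 (e 0 x1) (Yab N a2 a3 U2 (e 0 x2) W)
           *+ (e 0 z0 == 0).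

(* Y_{a1+a2}(Y_{a1}(U1, z_0) U2, z_2) W *)
Definition Yiterate (N : int) (a1 a2 a3 : 'rV[C]_l) (U1 U2 W : bigM) :
  'rV[C]_3 -> bigM :=
  fun e => Yab N (a1 + a2) a3 (Yab N a1 a2 U1 (e 0 z0) U2) (e 0 z2) W
           *+ (e 0 z1 == 0).

End Cocycle.
End Heisenberg.

(* Main.v *)
Require Import Defs.
From HB Require Import structures.
From mathcomp Require Import all_boot all_order all_algebra.
From mathcomp Require Import finmap multiset monalg complex.
From mathcomp Require Import boolp classical_sets functions fsbigop.
From mathcomp Require Import reals sequences exp trigo.
From mathcomp Require Import zify ring.

(** After the Fock spaces of all charges are identified, every operator series of
    the statement has its exponents in one coset of the integers, and becomes a
    family of operators on the Heisenberg algebra module indexed by integers. The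
    operator [Y_-(b,z) Y(u,z) Y_+(b,z)] on the sector of charge [c] becomes
    [vop u b c]; the predicate [acts] relates the formal series to the modes.

    Two facts explain the correction factors in the definition of [Y_a]. Applying
    [Y_+(d,-z)] to the state moves the zero modes of the sector from [c] to [c + d]
    ([vop_shift], an observation of Li), and multiplying by [Y_-(d,z)] on the left
    and [Y_+(d,z)] on the right adds [d] to the charge of the operator ([vop_add]).
    Consequently [Y_a(u (x) e^(mu+a), z)] on [e^(nu+b)] is, up to the constant
    [e^(i pi N a.nu) eps(mu, nu)], the vertex operator of the full charge [mu + a]
    on the full charge [nu + b] ([Yab_acts]). The labels [a] and [b] have disappeared
    from the operators, and the identity splits in two.

    The first part is the Jacobi identity for vertex operators of arbitrary complex
    charges [bu], [bv], [bw], whose exponents are their mutual products ([jacobi]).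
    It is proved by removing the creation operators from the three states. By the
    commutator formula [vop_comm], a creation operator in the first state gives, in
    each of the three terms, a sum over creation operators in front, a sum over modes
    acting on [w] and a sum over modes acting on [v], with powers of [z1 - z2] or
    [z2 + z0] as coefficients ([prod12_u], [prod21_u], [iterate_u]). Such powers only
    shift an exponent in the identity, by Vandermonde's identity ([Theta_binmul]), so
    the three recursions match term by term. When all states are the vacuum, the
    products are [(z1 - z2)^(bu.bv) Y_-(bu,z1) Y_-(bv,z2) 1] in two expansions, the
    iterate is the corresponding expression at [z1 = z2 + z0] ([iterate_base]), and
    the identity is the classical one for the expansions of powers of [z1 - z2]
    ([delta_coef]).

    The second part concerns constants. The exponents [eta12] and [eta13] differ from
    the products of the full charges by integers, because the lattice is integral;
    the kernels being series in [(z_x - z_y)/z_w] times a delta function, such an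
    integer only produces a sign. The constants of the three terms then agree by the
    cocycle identity of [eps], the additivity of the phase, and the given commutator
    [C(mu1, mu2)] ([Yab_const_assoc], [Yab_const_swap]). The transition between the
    kernels and their coefficients is [product_term] and [iterate_term]. *)

Set Implicit Arguments.
Unset Strict Implicit.
Unset Printing Implicit Defensive.
Import Order.TTheory GRing.Theory Num.Theory.
Local Open Scope ring_scope.

(** * Finitely supported sums over the natural numbers *)

Section FiniteSums.

(** Coefficients of formal products are sums over a whole index set, with no
    range known in advance; the value is meaningful only for [f] with [fin f]. *)
Definition nsum (V : nmodType) (f : nat -> V) : V :=
  \sum_(m \in [set: nat]%classic) f m.

Definition fin (V : nmodType) (f : nat -> V) : Prop :=
  exists N, forall m, (N <= m)%N -> f m = 0.

(** The two-index form of [fin]: it bounds both indices at once, which is what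
    the exchange of two summations needs. *)
Definition boxed (V : nmodType) (f : nat -> nat -> V) : Prop :=
  exists N, forall m t, (N <= m)%N || (N <= t)%N -> f m t = 0.

Lemma nsumE (V : nmodType) (f : nat -> V) N :
  (forall m, (N <= m)%N -> f m = 0) -> nsum f = \sum_(m < N) f m.
Proof.
move=> fN; rewrite /nsum (fsbigTE [fset m | m in iota 0 N]%fset).
  rewrite -(big_mkord xpredT) /index_iota subn0; apply: perm_big.
  apply: uniq_perm; rewrite ?fset_uniq ?iota_uniq // => m.
  by apply/imfsetP/idP => [[x /= xi ->] //|mi]; exists m.
move=> m; apply: contraNeq => fm; apply/imfsetP; exists m => //=.
rewrite mem_iota /= add0n ltnNge.
by apply: contra fm => /fN ->.
Qed.

Lemma eq_nsum (V : nmodType) (f g : nat -> V) : f =1 g -> nsum f = nsum g.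
Proof. by move=> fg; congr nsum; apply: funext. Qed.

Lemma nsum_eq0 (V : nmodType) (f : nat -> V) : (forall m, f m = 0) -> nsum f = 0.
Proof. by move=> f0; rewrite (@nsumE _ _ 0) ?big_ord0. Qed.

Lemma nsum_one (V : nmodType) (f : nat -> V) k :
  (forall m, m != k -> f m = 0) -> nsum f = f k.
Proof.
move=> f0; rewrite (@nsumE _ _ k.+1) => [|m km].
  rewrite big_ord_recr /= big1 ?add0r // => i _.
  by apply: f0; rewrite ltn_eqF.
by apply: f0; rewrite gtn_eqF.
Qed.

Lemma eq_fin (V : nmodType) (f g : nat -> V) : f =1 g -> fin f -> fin g.
Proof. by move=> fg [N fN]; exists N => m /fN <-. Qed.

Lemma nsumD (V : nmodType) (f g : nat -> V) : fin f -> fin g ->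
  nsum (fun m => f m + g m) = nsum f + nsum g.
Proof.
move=> [M fM] [N gN]; rewrite !(@nsumE _ _ (M + N)) ?big_split // => m h;
  rewrite ?fM ?gN ?addr0 //; lia.
Qed.

Lemma finD (V : nmodType) (f g : nat -> V) : fin f -> fin g ->
  fin (fun m => f m + g m).
Proof.
move=> [M fM] [N gN]; exists (M + N)%N => m h; rewrite fM ?gN ?addr0 //; lia.
Qed.

Lemma nsum_shift (V : nmodType) (f : nat -> V) k :
  (forall m, (m < k)%N -> f m = 0) -> fin f -> nsum f = nsum (fun m => f (k + m)%N).
Proof.
move=> f0 [N fN]; rewrite (@nsumE _ _ (k + N)) => [|m h]; last by apply: fN; lia.
rewrite (@nsumE _ _ N) => [|m h]; last by apply: fN; lia.
rewrite big_split_ord /= big1 ?add0r // => i _; exact: f0.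
Qed.

(** A product of series with complex exponents is summed over all exponents,
    but the exponents that contribute form a family indexed by [nat]. *)
Lemma fsum_image (V : nmodType) (J : choiceType) (h : nat -> J) (F : J -> V) :
  injective h -> (forall j, (forall n, j <> h n) -> F j = 0) ->
  \sum_(j \in [set: J]%classic) F j = nsum (F \o h).
Proof.
move=> hI F0; rewrite /nsum -[LHS](fsbig_widen (range h)) //.
  by rewrite fsbig_image // => x y _ _ /hI.
move=> j [_ nj]; apply: F0 => n jn; apply: nj; by exists n.
Qed.

Lemma boxed_finr (V : nmodType) (f : nat -> nat -> V) t :
  boxed f -> fin (f^~ t).
Proof. by move=> [N fN]; exists N => m h; rewrite fN ?h. Qed.

Lemma boxed_nsum (V : nmodType) (f : nat -> nat -> V) :
  boxed f -> fin (fun m => nsum (f m)).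
Proof.
by move=> [N fN]; exists N => m h; apply: nsum_eq0 => t; rewrite fN ?h.
Qed.

Lemma boxedC (V : nmodType) (f : nat -> nat -> V) :
  boxed f -> boxed (fun m t => f t m).
Proof. by move=> [N fN]; exists N => m t; rewrite orbC; apply: fN. Qed.

Lemma nsum_exchange (V : nmodType) (f : nat -> nat -> V) : boxed f ->
  nsum (fun m => nsum (f m)) = nsum (fun t => nsum (f^~ t)).
Proof.
move=> [N fN]; rewrite !(@nsumE _ _ N); last 2 first.
- by move=> m h; apply: nsum_eq0 => t; rewrite fN // h orbT.
- by move=> m h; apply: nsum_eq0 => t; rewrite fN // h.
transitivity (\sum_(m < N) \sum_(t < N) f m t).
  by apply: eq_bigr => m _; apply: nsumE => t h; rewrite fN // h orbT.
rewrite exchange_big /=; apply: eq_bigr => t _.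
by apply/esym/nsumE => m h; rewrite fN // h.
Qed.

(** Products of two series in the same variable are collected by total degree
    in this way. *)
Lemma nsum_diagonal (V : nmodType) (f : nat -> nat -> V) : boxed f ->
  nsum (fun m => nsum (f m)) = nsum (fun k => \sum_(t < k.+1) f (k - t)%N t).
Proof.
move=> [N fN]; pose M := (N + N)%N.
rewrite (@nsumE _ _ N) => [|m h]; last by apply: nsum_eq0 => t; rewrite fN // h.
rewrite (@nsumE _ (fun k => \sum_(t < k.+1) _) M) => [|k h]; last first.
  by apply: big1 => t _; apply: fN; move: h; rewrite /M; lia.
have -> : \sum_(k < M) \sum_(t < k.+1) f (k - t)%N t =
   \sum_(k < M) \sum_(t < M) (if (t <= k)%N then f (k - t)%N t else 0).
  apply: eq_bigr => k _; rewrite -big_mkcond /=.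
  rewrite (big_ord_widen M (fun t => f (k - t)%N t)) ?ltn_ord //.
rewrite exchange_big /=.
have -> : \sum_(m < N) nsum (f m) = \sum_(m < N) \sum_(t < M) f m t.
  apply: eq_bigr => m _; apply: nsumE => t h; apply: fN; move: h; rewrite /M; lia.
rewrite exchange_big /=; apply: eq_bigr => t _.
case: (ltnP t N) => tN; last first.
  rewrite !big1 // => m _; last by rewrite fN // tN orbT.
  by case: ifP => // _; rewrite fN // tN orbT.
rewrite -(big_mkord xpredT (f^~ t)).
rewrite -(big_mkord xpredT (fun k => if (t <= k)%N then f (k - t)%N t else 0)).
rewrite (big_cat_nat (n := t) (leq0n _) (ltnW (ltn_ord t))) /=.
rewrite [X in _ = X + _]big_nat [X in _ = X + _]big1 ?add0r; last first.
  by move=> i /andP[_ it]; rewrite leqNgt it.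
rewrite -[X in _ = \sum_(X <= i < _) _]add0n big_addn.
have NMt : (N <= M - t)%N by rewrite -(leq_add2r t) subnK ?leq_add2l 1?ltnW ?ltn_ord.
rewrite [in RHS](big_cat_nat (n := N) (leq0n _) NMt) /=.
rewrite [X in _ = _ + X]big_nat [X in _ = _ + X]big1 ?addr0; last first.
  by move=> i /andP[iN _]; case: ifP => // _; apply: fN; rewrite addnK iN.
by apply: eq_bigr => i _; rewrite leq_addl addnK.
Qed.

End FiniteSums.

(** * Linear maps and sums *)

Section FiniteSumsLmod.
Variables (F : nzRingType) (U V : lmodType F).
Implicit Types (g : U -> V) (f : nat -> U).

(** Linearity is carried as a hypothesis on a plain function, because the maps
    below are coefficients of series and not instances of a structure. *)
Lemma lin0 g (gl : linear g) : g 0 = 0.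
Proof. by have := gl (-1) 0 0; rewrite scaler0 addr0 scaleN1r addNr. Qed.

Lemma linD g (gl : linear g) x y : g (x + y) = g x + g y.
Proof. by have := gl 1 x y; rewrite !scale1r. Qed.

Lemma linZ g (gl : linear g) k x : g (k *: x) = k *: g x.
Proof. by have := gl k x 0; rewrite (lin0 gl) !addr0. Qed.

Lemma linN g (gl : linear g) x : g (- x) = - g x.
Proof. by rewrite -scaleN1r (linZ gl) scaleN1r. Qed.

Lemma linB g (gl : linear g) x y : g (x - y) = g x - g y.
Proof. by rewrite (linD gl) (linN gl). Qed.

Lemma lin_sum g (gl : linear g) (I : Type) (r : seq I) (P : pred I) (E : I -> U) :
  g (\sum_(i <- r | P i) E i) = \sum_(i <- r | P i) g (E i).
Proof.
elim/big_rec2: _ => [|i y x _ <-]; first exact: lin0.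
exact: linD.
Qed.

Lemma lin_nsum g (gl : linear g) f : fin f -> g (nsum f) = nsum (g \o f).
Proof.
move=> [N fN]; rewrite (nsumE fN) (lin_sum gl) (@nsumE _ _ N) // => m /fN /= ->.
exact: lin0.
Qed.

Lemma lin_fin g f : linear g -> fin f -> fin (fun m => g (f m)).
Proof. by move=> gl [N fN]; exists N => m /fN ->; apply: lin0. Qed.

End FiniteSumsLmod.

Section FsScale.
Variables (F : nzRingType) (U : lmodType F).
Implicit Types (f : nat -> U).

Lemma scaler_linear (K : comNzRingType) (W : lmodType K) (k : K) :
  linear (fun x : W => k *: x).
Proof. by move=> a x y; rewrite scalerDr !scalerA mulrC. Qed.

Lemma fin_scale f (c : nat -> F) : fin f -> fin (fun m => c m *: f m).
Proof. by move=> [N fN]; exists N => m /fN ->; rewrite scaler0. Qed.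

Lemma finZ (k : F) f : fin f -> fin (fun m => k *: f m).
Proof. exact: (@fin_scale f (fun=> k)). Qed.

Lemma nsumZ f (k : F) : fin f -> k *: nsum f = nsum (fun m => k *: f m).
Proof.
move=> [N fN]; rewrite (nsumE fN) scaler_sumr (@nsumE _ _ N) // => m /fN ->.
by rewrite scaler0.
Qed.

Lemma nsumN f : fin f -> - nsum f = nsum (fun m => - f m).
Proof.
move=> [N fN]; rewrite (nsumE fN) -sumrN (@nsumE _ _ N) // => m /fN ->.
by rewrite oppr0.
Qed.

Lemma fin_opp f : fin f -> fin (fun m => - f m).
Proof. by move=> [N fN]; exists N => m /fN ->; rewrite oppr0. Qed.

Lemma nsum_sum (n : nat) (E : 'I_n -> nat -> U) : (forall i, fin (E i)) ->
  nsum (fun m => \sum_(i < n) E i m) = \sum_(i < n) nsum (E i).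
Proof.
elim: n E => [|n IH] E Ef.
  by rewrite big_ord0; apply: nsum_eq0 => m; rewrite big_ord0.
rewrite big_ord_recr /= -IH // -nsumD //; last first.
  elim: n {IH} E Ef => [|n IH] E Ef.
    by exists 0%N => m _; rewrite big_ord0.
  apply: (@eq_fin _ (fun m => \sum_(i < n) E (widen_ord (leqnSn n.+1) (widen_ord (leqnSn n) i)) m + E (widen_ord (leqnSn n.+1) ord_max) m)).
    by move=> m; rewrite big_ord_recr.
  by apply: finD => //; exact: (IH (fun i => E (widen_ord (leqnSn n.+1) i))).
by apply: eq_nsum => m; rewrite big_ord_recr.
Qed.

End FsScale.

(** * Binomial coefficients with a complex upper entry *)

Section Binomials.
Variable R : realType.
Local Notation C := R[i].
Implicit Types (x y : C) (k m n : nat).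

Lemma cbinom0 x : cbinom x 0 = 1.
Proof. by rewrite /cbinom big_ord0 fact0 divr1. Qed.

Lemma cbinomSr x m : m.+1%:R * cbinom x m.+1 = (x - m%:R) * cbinom x m.
Proof.
rewrite /cbinom big_ord_recr /= factS natrM.
have h1 : (m.+1%:R : C) != 0 by rewrite pnatr_eq0.
have h2 : ((m`!)%:R : C) != 0 by rewrite pnatr_eq0 -lt0n fact_gt0.
by move: (m.+1%:R) h1 => a h1; field; rewrite h1 h2.
Qed.

Lemma cbinomSl x m : m.+1%:R * cbinom x m.+1 = x * cbinom (x - 1) m.
Proof.
rewrite /cbinom big_ord_recl /= factS natrM subr0.
have h1 : (m.+1%:R : C) != 0 by rewrite pnatr_eq0.
have h2 : ((m`!)%:R : C) != 0 by rewrite pnatr_eq0 -lt0n fact_gt0.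
rewrite (eq_bigr (fun j : 'I_m => x - 1 - j%:R)); last first.
  by move=> j _; rewrite /bump /= add1n -natr1; ring.
by move: (m.+1%:R) h1 => a h1; field; rewrite h1 h2.
Qed.

(** Recursions below determine [m.+1] times a coefficient; characteristic zero
    recovers the coefficient itself. *)
Lemma natS_inj (V : lmodType C) m (x y : V) :
  m.+1%:R *: x = m.+1%:R *: y -> x = y.
Proof.
have h : (m.+1%:R : C) != 0 by rewrite pnatr_eq0.
by move=> e; rewrite -[x]scale1r -[y]scale1r -(mulVf h) -!scalerA e.
Qed.

(** Both sides obey the recursion [cbinomSr] in [k]: in each term write [k.+1]
    as the sum of the two lower entries. *)
Lemma cbinom_Vandermonde x y k :
  \sum_(i < k.+1) cbinom x (k - i) * cbinom y i = cbinom (x + y) k.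
Proof.
elim: k => [|k IH]; first by rewrite big_ord_recl big_ord0 /= !cbinom0 addr0 mulr1.
apply: (@natS_inj C^o k); rewrite /GRing.scale /= cbinomSr -IH.
have -> : k.+1%:R * (\sum_(i < k.+2) cbinom x (k.+1 - i) * cbinom y i) =
  \sum_(i < k.+2) ((k.+1 - i)%N%:R * cbinom x (k.+1 - i)) * cbinom y i +
  \sum_(i < k.+2) cbinom x (k.+1 - i) * (i%:R * cbinom y i).
  rewrite mulr_sumr -big_split /=; apply: eq_bigr => i _.
  have -> : k.+1%:R = (k.+1 - i)%N%:R + i%:R :> C.
    by rewrite -natrD subnK // -ltnS.
  ring.
rewrite big_ord_recr /= subnn mul0r mul0r addr0.
rewrite [X in _ + X]big_ord_recl /= mul0r mulr0 add0r mulr_sumr -big_split /=.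
apply: eq_bigr => i _; have ik : (i <= k)%N by rewrite -ltnS.
rewrite /bump /= add1n subSS subSn // !cbinomSr natrB //; ring.
Qed.

Lemma cbinom_nat n m : cbinom (n%:R : C) m = 'C(n, m)%:R.
Proof.
elim: m n => [|m IH] n; first by rewrite cbinom0 bin0.
apply: (@natS_inj C^o m); rewrite /GRing.scale /= cbinomSl -natrM.
case: n => [|n]; first by rewrite mul0r bin0n muln0.
by rewrite -[in X in cbinom X _]natr1 addrK IH -natrM mul_bin_diag.
Qed.

Lemma cbinom_neg x m : cbinom (- x - 1) m = (-1) ^+ m * cbinom (x + m%:R) m.
Proof.
elim: m x => [|m IH] x; first by rewrite !cbinom0 mul1r.
apply: (@natS_inj C^o m); rewrite /GRing.scale /=.
rewrite cbinomSr IH [in RHS]mulrCA cbinomSl -natr1 exprS.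
have -> : x + (m%:R + 1) - 1 = x + m%:R by ring.
ring.
Qed.

(** The trinomial revision, by induction on [t]; it redistributes the
    derivatives of a current between two operators. *)
Lemma cbinomM x t k :
  cbinom x (t + k) * cbinom (t + k)%N%:R k = cbinom x k * cbinom (x - k%:R) t.
Proof.
elim: t => [|t IH]; first by rewrite add0n cbinom0 mulr1 cbinom_nat binn mulr1.
apply: (@natS_inj C^o t); rewrite /GRing.scale /= mulrCA [in RHS]mulrCA cbinomSr.
rewrite [in RHS]mulrCA -IH !cbinom_nat addSn.
have h : (t.+1%:R : C) * 'C((t + k).+1, k)%:R = (t + k).+1%:R * 'C(t + k, k)%:R.
  have -> : t.+1 = ((t + k).+1 - k)%N by rewrite -addSn addnK.
  by rewrite -!natrM mul_bin_down.
rewrite h mulrA [X in X * _]mulrC cbinomSr natrD; ring.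
Qed.

Lemma cbinom_nat0 n m : (n < m)%N -> cbinom (n%:R : C) m = 0.
Proof. by move=> nm; rewrite cbinom_nat bin_small. Qed.

Lemma cbinom_sym (t k : nat) :
  cbinom ((t + k)%N%:R : C) k = (-1) ^+ t * cbinom (- k%:R - 1) t.
Proof.
rewrite cbinom_neg mulrA -exprMn mulrNN mulr1 expr1n mul1r -natrD !cbinom_nat.
by rewrite -[in RHS](bin_sub (leq_addl k t)) addnK addnC.
Qed.

Lemma cbinom_alt x n :
  \sum_(i < n.+1) (-1) ^+ i * cbinom x i = (-1) ^+ n * cbinom (x - 1) n.
Proof.
elim: n => [|n IH]; first by rewrite big_ord_recl big_ord0 /= !cbinom0 addr0.
rewrite big_ord_recr /= IH exprS.
apply: (@natS_inj C^o n); rewrite /GRing.scale /= mulrDr [in LHS]mulrCA.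
rewrite [in X in _ + X]mulrCA cbinomSl [in RHS]mulrCA cbinomSr -[n.+1%:R]natr1; ring.
Qed.

End Binomials.

(** * Exponentials of series of operators *)

Section TriangularSums.
Variable V : nmodType.

Lemma exchange_tri (q : nat) (G : nat -> nat -> V) :
  \sum_(t < q.+1) \sum_(j < q - t) G t j =
  \sum_(j < q) \sum_(t < (q - j.+1).+1) G t j.
Proof.
transitivity (\sum_(t < q.+1) \sum_(j < q | (t + j < q)%N) G t j).
  apply: eq_bigr => t _; rewrite (big_ord_widen_cond q xpredT) ?leq_subr //=.
  by apply: eq_bigl => j; apply/idP/idP; lia.
rewrite (exchange_big_dep xpredT) //=; apply: eq_bigr => j _.
rewrite (big_ord_widen_cond q.+1 xpredT (G^~ j)) /=; last by lia.
by apply: eq_bigl => t; apply/idP/idP; have := ltn_ord j; lia.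
Qed.

Lemma rev_sum (q : nat) (G : nat -> V) :
  \sum_(t < q.+1) G t = \sum_(t < q.+1) G (q - t)%N.
Proof.
rewrite (reindex_inj rev_ord_inj) /=; apply: eq_bigr => t _.
by rewrite subSS.
Qed.

Lemma exchange_tri2 (q : nat) (G : nat -> nat -> V) :
  \sum_(t < q.+1) \sum_(j < t) G t j =
  \sum_(j < q) \sum_(t < (q - j.+1).+1) G (t + j.+1)%N j.
Proof.
rewrite (rev_sum q (fun t => \sum_(j < t) G t j)).
rewrite (exchange_tri q (fun t j => G (q - t)%N j)); apply: eq_bigr => j _.
rewrite (rev_sum _ (fun t => G (q - t)%N j)); apply: eq_bigr => t _.
congr G; have := ltn_ord j; have := ltn_ord t; lia.
Qed.

Lemma exchange_tri0 (q : nat) (G : nat -> nat -> V) :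
  \sum_(j < q) \sum_(i < q - j.+1) G j i =
  \sum_(i < q) \sum_(j < q - i.+1) G j i.
Proof.
case: q => [|q]; first by rewrite !big_ord0.
under eq_bigr do rewrite subSS.
rewrite exchange_tri [RHS]big_ord_recr /= subnn big_ord0 addr0.
by apply: eq_bigr => i _; rewrite subSS -subSn.
Qed.

End TriangularSums.

Section ExpSeries.
Variables (R : realType) (S : lmodType R[i]).
Implicit Types (f g : nat -> S -> S) (x : S).

(** The coefficient of [z^q] in the r-th power of [sum_j f_j z^(j+1)]. The
    series has no constant term, so this is a finite sum. *)
Fixpoint exp_term f (r q : nat) x : S :=
  if r is r'.+1 then \sum_(j < q) f j (exp_term f r' (q - j.+1) x)
  else x *+ (q == 0%N).

Definition exp_coef f (q : nat) x : S :=
  \sum_(r < q.+1) (r`!)%:R^-1 *: exp_term f r q x.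

Lemma sum_linear (I : Type) (r : seq I) (P : pred I) (F : I -> S -> S) :
  (forall i, linear (F i)) -> linear (fun x => \sum_(i <- r | P i) F i x).
Proof.
move=> Fl k x y; rewrite scaler_sumr -big_split /=.
by apply: eq_bigr => i _; apply: Fl.
Qed.

Lemma comp_linear (U V W : lmodType R[i]) (g : V -> W) (h : U -> V) :
  linear g -> linear h -> linear (g \o h).
Proof. by move=> gl hl k x y /=; rewrite hl gl. Qed.

Lemma scale_linear k (g : S -> S) : linear g -> linear (fun x => k *: g x).
Proof. by move=> gl; apply: (comp_linear (@scaler_linear _ _ k) gl). Qed.

Lemma add_linear (g h : S -> S) :
  linear g -> linear h -> linear (fun x => g x + h x).
Proof. by move=> gl hl k x y; rewrite gl hl scalerDr addrACA. Qed.

Section OneSeries.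
Variable f : nat -> S -> S.
Hypothesis f_lin : forall j, linear (f j).

Lemma exp_term_linear r q : linear (exp_term f r q).
Proof.
elim: r q => [|r IH] q /=; first by move=> k x y; rewrite mulrnDl scalerMnr.
by apply: sum_linear => j; apply: comp_linear.
Qed.

Lemma exp_coef_linear q : linear (exp_coef f q).
Proof. by apply: sum_linear => r; apply/scale_linear/exp_term_linear. Qed.

Lemma exp_term_gt r q x : (q < r)%N -> exp_term f r q x = 0.
Proof.
elim: r q => [|r IH] q //= qr; apply: big1 => j _.
by rewrite IH ?lin0 //; have := ltn_ord j; lia.
Qed.

Lemma exp_coef0 x : exp_coef f 0 x = x.
Proof. by rewrite /exp_coef big_ord_recl big_ord0 /= addr0 fact0 invr1 scale1r. Qed.

Hypothesis fC : forall i j x, f i (f j x) = f j (f i x).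

(** The derivative of a power, coefficientwise: [z d/dz F^(r+1)] is [(r+1) (z
    d/dz F) F^r] because the [f_j] commute. *)
Lemma exp_term_rec r q x :
  q%:R *: exp_term f r.+1 q x =
  r.+1%:R *: \sum_(j < q) j.+1%:R *: f j (exp_term f r (q - j.+1) x).
Proof.
elim: r q => [|r IH] q.
  rewrite scale1r /= scaler_sumr; apply: eq_bigr => j _.
  case: eqP => [e|_]; last by rewrite lin0 // !scaler0.
  by congr (_%:R *: _); have := ltn_ord j; lia.
have -> : q%:R *: exp_term f r.+2 q x =
   \sum_(j < q) j.+1%:R *: f j (exp_term f r.+1 (q - j.+1) x) +
   \sum_(j < q) f j ((q - j.+1)%:R *: exp_term f r.+1 (q - j.+1) x).
  have -> : exp_term f r.+2 q x =
    \sum_(j < q) f j (exp_term f r.+1 (q - j.+1) x) by [].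
  rewrite scaler_sumr -big_split /=; apply: eq_bigr => j _.
  rewrite (linZ (f_lin j)) -scalerDl -natrD; congr (_%:R *: _).
  by have := ltn_ord j; lia.
under [X in _ + X]eq_bigr do rewrite IH (linZ (f_lin _)) (lin_sum (f_lin _)) scaler_sumr.
rewrite (exchange_tri0 q (fun j i =>
  r.+1%:R *: f j (i.+1%:R *: f i (exp_term f r (q - j.+1 - i.+1) x)))).
have -> : (r.+2%:R : R[i]) = r.+1%:R + 1 by rewrite natr1.
rewrite scalerDl scale1r addrC; congr (_ + _).
rewrite scaler_sumr; apply: eq_bigr => i _ /=.
rewrite (lin_sum (f_lin i)) !scaler_sumr; apply: eq_bigr => j _.
by rewrite (linZ (f_lin j)) fC subnAC.
Qed.

(** The differential equation of the exponential, [z d/dz e^F = (z d/dz F)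
    e^F]. Together with [rec_uniq] it replaces every manipulation of
    exponential sums. *)
Lemma exp_coef_rec q x :
  q%:R *: exp_coef f q x =
  \sum_(j < q) j.+1%:R *: f j (exp_coef f (q - j.+1) x).
Proof.
rewrite /exp_coef scaler_sumr big_ord_recl /=.
have -> : q%:R *: ((0`!)%:R^-1 *: (x *+ (q == 0%N))) = 0.
  by case: q => [|q]; rewrite ?scale0r //= !scaler0.
rewrite add0r.
transitivity (\sum_(r < q) \sum_(j < q)
   (r`!)%:R^-1 *: (j.+1%:R *: f j (exp_term f r (q - j.+1) x))).
  apply: eq_bigr => r _; rewrite /bump /= add1n.
  rewrite scalerA mulrC -scalerA exp_term_rec scalerA factS natrM invfM.
  rewrite mulrAC mulVf ?pnatr_eq0 // mul1r scaler_sumr.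
  by apply: eq_bigr.
rewrite exchange_big /=; apply: eq_bigr => j _.
rewrite (lin_sum (f_lin j)) scaler_sumr.
rewrite (big_ord_widen q (fun r =>
  j.+1%:R *: f j ((r`!)%:R^-1 *: exp_term f r (q - j.+1) x))); last first.
  by have := ltn_ord j; lia.
rewrite [RHS]big_mkcond /=; apply: eq_bigr => r _; case: ifP => h.
  by rewrite (linZ (f_lin j)) !scalerA mulrC.
by rewrite exp_term_gt ?(lin0 (f_lin j)) ?scaler0 //; move/negbT: h; lia.
Qed.

Lemma rec_uniq (G H : nat -> S) :
  (forall q, q%:R *: G q = \sum_(j < q) j.+1%:R *: f j (G (q - j.+1)%N)) ->
  (forall q, q%:R *: H q = \sum_(j < q) j.+1%:R *: f j (H (q - j.+1)%N)) ->
  G 0%N = H 0%N -> forall q, G q = H q.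
Proof.
move=> Gr Hr GH; elim/ltn_ind => [[|q] IH] //.
apply: (@natS_inj R _ q); rewrite Gr Hr; apply: eq_bigr => j _.
by rewrite IH // subSS ltnS leq_subr.
Qed.

Lemma exp_coef_comm (g : S -> S) q x : linear g ->
  (forall j y, g (f j y) = f j (g y)) -> g (exp_coef f q x) = exp_coef f q (g x).
Proof.
move=> gl gf; move: q; apply: rec_uniq => [q|q|]; last by rewrite !exp_coef0.
  rewrite -(linZ gl) exp_coef_rec (lin_sum gl).
  by apply: eq_bigr => j _; rewrite (linZ gl) gf.
by rewrite exp_coef_rec.
Qed.

(** If [g] has a scalar commutator [k z^(m+1)] with the exponent, then its
    commutator with the exponential is [k z^(m+1)] times the exponential. *)
Lemma exp_coef_commutator (g : S -> S) (m : nat) (k : R[i]) q x : linear g ->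
  (forall j y, g (f j y) = f j (g y) + (if j == m then k *: y else 0)) ->
  g (exp_coef f q x) = exp_coef f q (g x) +
    (if (m < q)%N then k *: exp_coef f (q - m.+1) x else 0).
Proof.
move=> gl gf; elim/ltn_ind: q => [[|q] IH].
  by rewrite !exp_coef0 addr0.
apply: (@natS_inj R _ q); rewrite -(linZ gl) exp_coef_rec (lin_sum gl).
have -> : \sum_(j < q.+1) g (j.+1%:R *: f j (exp_coef f (q.+1 - j.+1) x)) =
  \sum_(j < q.+1) j.+1%:R *: f j (exp_coef f (q.+1 - j.+1) (g x)) +
  \sum_(j < q.+1) j.+1%:R *: f j
     (if (m < q - j)%N then k *: exp_coef f (q - j - m.+1) x else 0) +
  \sum_(j < q.+1) j.+1%:R *:
     (if j == m :> nat then k *: exp_coef f (q - j) x else 0).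
  rewrite -!big_split /=; apply: eq_bigr => j _; have := ltn_ord j => jq.
  by rewrite (linZ gl) gf IH ?subSS 1?ltnS ?leq_subr // (linD (f_lin j)) !scalerDr.
rewrite -exp_coef_rec scalerDr -addrA; congr (_ + _).
case: ltnP => mq; last first.
  rewrite scaler0 !big1 ?addr0 // => j _.
    by case: eqP => [jm|_]; rewrite ?scaler0 //; have := ltn_ord j; lia.
  case: ifP => h; last by rewrite lin0 ?scaler0.
  by have := ltn_ord j; lia.
rewrite [X in _ + X](bigD1 (Ordinal mq)) //= eqxx [X in _ + (_ + X)]big1 ?addr0; last first.
  by move=> j jm; rewrite -val_eqE /= in jm; rewrite (negbTE jm) scaler0.
have -> : \sum_(j < q.+1) j.+1%:R *: f j
     (if (m < q - j)%N then k *: exp_coef f (q - j - m.+1) x else 0) =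
   k *: ((q - m)%:R *: exp_coef f (q - m) x).
  rewrite exp_coef_rec scaler_sumr.
  rewrite (big_ord_widen q.+1 (fun j =>
     k *: (j.+1%:R *: f j (exp_coef f (q - m - j.+1) x)))); last by lia.
  rewrite [RHS]big_mkcond /=; apply: eq_bigr => j _.
  have -> : (m < q - j)%N = (j < q - m)%N by lia.
  case: ifP => h; last by rewrite lin0 ?scaler0.
  rewrite (linZ (f_lin j)) !scalerA mulrC; congr (_ *: f j (exp_coef f _ _)); lia.
rewrite subSS !scalerA -scalerDl; congr (_ *: _).
have -> : q.+1%:R = (q - m)%:R + m.+1%:R :> R[i].
  by rewrite -natrD; congr (_%:R); lia.
ring.
Qed.

End OneSeries.

Lemma eq_exp_coef f g q x :
  (forall j y, f j y = g j y) -> exp_coef f q x = exp_coef g q x.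
Proof. by move=> fg; congr exp_coef; apply: funext => j; apply: funext. Qed.

(** The addition theorem of the exponential: the product satisfies the
    differential equation of [e^(F+G)]. *)
Lemma exp_coef_add f g q x :
  (forall j, linear (f j)) -> (forall j, linear (g j)) ->
  (forall i j y, f i (f j y) = f j (f i y)) ->
  (forall i j y, g i (g j y) = g j (g i y)) ->
  (forall i j y, f i (g j y) = g j (f i y)) ->
  \sum_(t < q.+1) exp_coef f (q - t) (exp_coef g t x) =
  exp_coef (fun j y => f j y + g j y) q x.
Proof.
move=> fl gl ff gg fg; pose h j y := f j y + g j y.
have hl j : linear (h j) by apply: add_linear.
have hC i j y : h i (h j y) = h j (h i y).
  rewrite /h !(linD (fl _)) !(linD (gl _)) ff gg -!fg.
  by rewrite -!addrA; congr (_ + _); rewrite addrCA.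
move: q; apply: (@rec_uniq h) => [q|q|]; last 2 first.
- exact: exp_coef_rec.
- by rewrite big_ord_recl big_ord0 /= addr0 !exp_coef0.
have -> : q%:R *: \sum_(t < q.+1) exp_coef f (q - t) (exp_coef g t x) =
  \sum_(t < q.+1) (q - t)%:R *: exp_coef f (q - t) (exp_coef g t x) +
  \sum_(t < q.+1) exp_coef f (q - t) (t%:R *: exp_coef g t x).
  rewrite scaler_sumr -big_split /=; apply: eq_bigr => t _.
  rewrite (linZ (exp_coef_linear fl _)).
  by rewrite -scalerDl -natrD subnK // -ltnS.
under eq_bigr do rewrite exp_coef_rec //.
under [X in _ + X]eq_bigr => t _.
  rewrite exp_coef_rec // (lin_sum (exp_coef_linear fl _)).
  under eq_bigr do rewrite (linZ (exp_coef_linear fl _)).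
  over.
rewrite (exchange_tri q (fun t j =>
   j.+1%:R *: f j (exp_coef f (q - t - j.+1) (exp_coef g t x)))).
rewrite (exchange_tri2 q (fun t j =>
   j.+1%:R *: exp_coef f (q - t) (g j (exp_coef g (t - j.+1) x)))).
rewrite -big_split /=; apply: eq_bigr => j _.
rewrite /h scalerDr (lin_sum (fl j)) (lin_sum (gl j)) !scaler_sumr; congr (_ + _).
  by apply: eq_bigr => t _; rewrite subnAC.
apply: eq_bigr => t _; rewrite addnK [(t + _)%N]addnC subnDA.
by rewrite (exp_coef_comm fl ff _ _ (gl j)) // => i y; rewrite fg.
Qed.

End ExpSeries.

(** * Creation and annihilation parts composed with fields *)

Section Fields.
Variables (R : realType) (S : lmodType R[i]).
Implicit Types (p q r : nat -> S -> S) (F G : int -> S -> S) (x : S).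

(** [p] is a series in nonnegative powers of z, standing to the left of the
    field [F]; modes are indexed by the exponent of z. *)
Definition compL p F : int -> S -> S :=
  fun n x => nsum (fun t => p t (F (n - t%:Z) x)).

(** [q] is a series in the powers [z^(-d-j)], standing to the right of [F]. *)
Definition compR (d : nat) q F : int -> S -> S :=
  fun n x => nsum (fun j => F (n + d%:Z + j%:Z) (q j x)).

Definition fadd F G : int -> S -> S := fun n x => F n x + G n x.

Definition lower_bounded (f : int -> S) : Prop :=
  exists N : int, forall n, n < N -> f n = 0.

(** With modes indexed by exponents, a field applied to a vector is a Laurent
    series: it has finitely many negative powers. *)
Definition isfield F : Prop :=
  (forall n, linear (F n)) /\ (forall x, lower_bounded (F^~ x)).

(** The dual condition for a series in nonpositive powers: applied to a vector
    it is a polynomial in the inverse of z. *)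
Definition locally_finite q : Prop :=
  (forall j, linear (q j)) /\ (forall x, fin (q^~ x)).

Lemma fin_lower (f : int -> S) (n : int) :
  lower_bounded f -> fin (fun t => f (n - t%:Z)).
Proof.
move=> [N fN]; exists (absz (n - N)).+1 => m h; apply: fN; lia.
Qed.

Lemma compL_fin p F n x : (forall t, linear (p t)) -> isfield F ->
  fin (fun t => p t (F (n - t%:Z) x)).
Proof.
move=> pl [Fl Fb]; have [N fN] := fin_lower n (Fb x).
by exists N => m /fN ->; apply: lin0.
Qed.

Lemma compR_fin d q F n x : locally_finite q -> isfield F ->
  fin (fun j => F (n + d%:Z + j%:Z) (q j x)).
Proof.
move=> [ql qf] [Fl Fb]; have [N fN] := qf x.
by exists N => m /fN ->; apply: lin0.
Qed.

(** The lower bound of a field depends on the vector; finitely many vectors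
    have a common one, which is enough behind a locally finite series. *)
Lemma lower_uniform F (y : nat -> S) (J : nat) : isfield F ->
  exists N : int, forall j n, (j < J)%N -> n < N -> F n (y j) = 0.
Proof.
move=> [Fl Fb]; elim: J => [|J [N IH]]; first by exists 0 => j n; rewrite ltn0.
have [M FM] := Fb (y J); exists (Num.min N M) => j n.
rewrite lt_min ltnS leq_eqVlt => /orP[/eqP->|jJ] /andP[nN nM].
  exact: FM.
exact: IH.
Qed.

Lemma compL_field p F : (forall t, linear (p t)) -> isfield F ->
  isfield (compL p F).
Proof.
move=> pl Ff; have [Fl Fb] := Ff; split=> [n k x y|x].
  rewrite /compL (nsumZ _ (compL_fin n x pl Ff)).
  rewrite -nsumD; [|exact/finZ/(compL_fin n x pl Ff)|exact: (compL_fin n y pl Ff)].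
  by apply: eq_nsum => t; rewrite Fl pl.
have [N FN] := Fb x; exists N => n nN; apply: nsum_eq0 => t.
rewrite FN ?lin0 //; lia.
Qed.

Lemma compR_field d q F : locally_finite q -> isfield F ->
  isfield (compR d q F).
Proof.
move=> qf Ff; have [Fl Fb] := Ff; split=> [n k x y|x].
  rewrite /compR (nsumZ _ (compR_fin d n x qf Ff)).
  rewrite -nsumD; [|exact/finZ/(compR_fin d n x qf Ff)|exact: (compR_fin d n y qf Ff)].
  by apply: eq_nsum => t; rewrite qf.1 Fl.
have [J qJ] := qf.2 x; have [N FN] := lower_uniform (fun j => q j x) J Ff.
exists (N - d%:Z - J%:Z) => n nN; apply: nsum_eq0 => j.
case: (ltnP j J) => jJ; last by rewrite qJ // lin0.
rewrite FN //; lia.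
Qed.

Lemma fadd_field F G : isfield F -> isfield G -> isfield (fadd F G).
Proof.
move=> [Fl Fb] [Gl Gb]; split=> [n|x]; first exact: add_linear.
have [M FM] := Fb x; have [N GN] := Gb x; exists (Num.min M N) => n.
by rewrite lt_min => /andP[nM nN]; rewrite /fadd FM // GN // addr0.
Qed.

Lemma modes_ext F G : (forall n x, F n x = G n x) -> F = G.
Proof. by move=> FG; apply: funext => n; apply: funext => x. Qed.

Lemma compLD p F G : (forall t, linear (p t)) -> isfield F -> isfield G ->
  compL p (fadd F G) = fadd (compL p F) (compL p G).
Proof.
move=> pl Ff Gf; apply: modes_ext => n x.
rewrite /fadd /compL -nsumD; [|exact: (compL_fin n x pl Ff)|exact: (compL_fin n x pl Gf)].
by apply: eq_nsum => t; rewrite linD.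
Qed.

Lemma compRD d q F G : locally_finite q -> isfield F -> isfield G ->
  compR d q (fadd F G) = fadd (compR d q F) (compR d q G).
Proof.
move=> qf Ff Gf; apply: modes_ext => n x.
by rewrite /fadd /compR -nsumD; [|exact: (compR_fin d n x qf Ff)|exact: (compR_fin d n x qf Gf)].
Qed.

Lemma boxed_triangle (f : nat -> nat -> S) (N : nat) :
  (forall m t, (N <= m + t)%N -> f m t = 0) -> boxed f.
Proof. by move=> fN; exists N => m t h; apply: fN; case/orP: h; lia. Qed.

Lemma compL_boxed p p' F n x :
  (forall t, linear (p t)) -> (forall t, linear (p' t)) -> isfield F ->
  boxed (fun s t => p s (p' t (F (n - s%:Z - t%:Z) x))).
Proof.
move=> pl pl' [Fl Fb]; have [N FN] := Fb x.
apply: (@boxed_triangle _ (absz (n - N)).+1) => s t h.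
by rewrite FN ?lin0 //; lia.
Qed.

Lemma compLC p p' F : (forall t, linear (p t)) -> (forall t, linear (p' t)) ->
  isfield F -> (forall i j x, p i (p' j x) = p' j (p i x)) ->
  compL p (compL p' F) = compL p' (compL p F).
Proof.
move=> pl pl' Ff pp; apply: modes_ext => n x; rewrite /compL.
transitivity (nsum (fun s => nsum (fun t => p s (p' t (F (n - s%:Z - t%:Z) x))))).
  by apply: eq_nsum => s; rewrite (lin_nsum (pl s)) //; exact: (compL_fin _ x pl' Ff).
rewrite nsum_exchange; last exact: (compL_boxed n x pl pl' Ff).
apply: eq_nsum => t; rewrite (lin_nsum (pl' t)); last exact: (compL_fin _ x pl Ff).
by apply: eq_nsum => s /=; rewrite pp; congr (p' t (p s (F _ _))); lia.
Qed.

Lemma compL_conv p p' r F : (forall t, linear (p t)) -> (forall t, linear (p' t)) ->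
  isfield F -> (forall k x, \sum_(t < k.+1) p (k - t)%N (p' t x) = r k x) ->
  compL p (compL p' F) = compL r F.
Proof.
move=> pl pl' Ff pp; apply: modes_ext => n x; rewrite /compL.
transitivity (nsum (fun s => nsum (fun t => p s (p' t (F (n - s%:Z - t%:Z) x))))).
  by apply: eq_nsum => s; rewrite (lin_nsum (pl s)) //; exact: (compL_fin _ x pl' Ff).
rewrite nsum_diagonal; last exact: (compL_boxed n x pl pl' Ff).
apply: eq_nsum => k; rewrite -pp; apply: eq_bigr => t _.
by congr (p _ (p' t (F _ _))); have := ltn_ord t; lia.
Qed.

Lemma compR_boxed d d' q q' F n x : locally_finite q -> locally_finite q' ->
  isfield F ->
  (forall i j x, q i (q' j x) = q' j (q i x)) ->
  boxed (fun j i => F (n + d%:Z + j%:Z + d'%:Z + i%:Z) (q' i (q j x))).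
Proof.
move=> [ql qf] [ql' qf'] [Fl Fb] qq; have [N qN] := qf x; have [N' qN'] := qf' x.
exists (N + N')%N => j i h; case: (leqP N j) => jN.
  by rewrite qN // !lin0.
by rewrite -qq qN' ?lin0 //; case/orP: h; lia.
Qed.

Lemma compRC d d' q q' F : locally_finite q -> locally_finite q' -> isfield F ->
  (forall i j x, q i (q' j x) = q' j (q i x)) ->
  compR d q (compR d' q' F) = compR d' q' (compR d q F).
Proof.
move=> qf qf' Ff qq; apply: modes_ext => n x; rewrite /compR.
rewrite nsum_exchange; last exact: (compR_boxed d d' n x qf qf' Ff qq).
apply: eq_nsum => i; apply: eq_nsum => j; rewrite qq; congr (F _ _); lia.
Qed.

Lemma compR_conv q q' r F : locally_finite q -> locally_finite q' -> isfield F ->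
  (forall i j x, q i (q' j x) = q' j (q i x)) ->
  (forall k x, \sum_(t < k.+1) q (k - t)%N (q' t x) = r k x) ->
  compR 0 q (compR 0 q' F) = compR 0 r F.
Proof.
move=> qf qf' Ff qC qq; apply: modes_ext => n x; rewrite /compR.
rewrite nsum_diagonal; last exact: (compR_boxed 0 0 n x qf qf' Ff qC).
apply: eq_nsum => k; rewrite -qq lin_sum; last exact: Ff.1.
apply: eq_bigr => t _; rewrite qC; congr (F _ _); have := ltn_ord t; lia.
Qed.

(** The two series act on opposite sides of the field, so this is
    associativity; the point is the finiteness of the double sum. *)
Lemma compLR d p q F : (forall t, linear (p t)) -> locally_finite q -> isfield F ->
  compL p (compR d q F) = compR d q (compL p F).
Proof.
move=> pl qf Ff; apply: modes_ext => n x; rewrite /compL /compR.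
have [J qJ] := qf.2 x; have [N FN] := lower_uniform (fun j => q j x) J Ff.
transitivity (nsum (fun t => nsum (fun j => p t (F (n - t%:Z + d%:Z + j%:Z) (q j x))))).
  by apply: eq_nsum => t; rewrite (lin_nsum (pl t)) //; exact: (compR_fin d _ x qf Ff).
rewrite nsum_exchange.
  by apply: eq_nsum => j; apply: eq_nsum => t; congr (p t (F _ _)); lia.
exists (J + (absz (n + d%:Z + J%:Z - N)%R).+1)%N => t j h.
case: (ltnP j J) => jJ; last by rewrite qJ // (lin0 (Ff.1 _)) (lin0 (pl _)).
rewrite FN ?lin0 //; case/orP: h; lia.
Qed.

End Fields.

(** * Binomial kernels acting on series in two variables *)

Section Theta.
Variables (R : realType) (S : lmodType R[i]).
Local Notation C := R[i].
Local Notation ser2 := (int -> int -> S).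
Implicit Types (F G : int -> int -> S) (p q : int) (s k : C).

(** The supports that occur for a product of two fields applied to a vector:
    the variable of the operator applied first (here the second argument) is
    bounded below uniformly, the other one only for each fixed value of it. *)
Definition biser F : Prop :=
  (exists q0 : int, forall p q, q < q0 -> F p q = 0) /\
  (forall q, exists p0 : int, forall p, p < p0 -> F p q = 0).

(** The coefficient at the exponents [e0], [e1], [e2] of a kernel [z_w^(-1)
    ((z_x + s z_y)/z_w)^(-k) delta((z_x + s z_y)/z_w)] times a series [F] in
    [z_x] and [z_y]. Fixing the exponent of [z_w] leaves a single power [(z_x
    + s z_y)^(-1-e0-k)]; [k] is the part of the exponents that may be
    non-integral, and [e0], [e1], [e2] are the integral parts. *)
Definition Theta s k F (e0 e1 e2 : int) : S :=
  nsum (fun m : nat => (s ^+ m * cbinom (-1 - e0%:~R - k) m) *: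
        F (e1 + 1 + e0 + m%:Z) (e2 - m%:Z)).

(** Multiplication by [(z_x + s z_y)^y]. As [y] may be non-integral, the
    integer [d] says which shift of the exponent of [z_x] is recorded. *)
Definition binmul s (y : C) (d : int) F : ser2 := fun p q =>
  nsum (fun m : nat => (s ^+ m * cbinom y m) *: F (p - d + m%:Z) (q - m%:Z)).

Lemma biser_fin F (f : nat -> int) q (c : nat -> C) : biser F ->
  fin (fun m => c m *: F (f m) (q - m%:Z)).
Proof.
move=> [[q0 Fq] _]; exists (absz (q - q0)).+1 => m h.
rewrite Fq ?scaler0 //; lia.
Qed.

Lemma biser_lin k F G : biser F -> biser G ->
  biser (fun p q => k *: F p q + G p q).
Proof.
move=> [[q0 Fq] Fp] [[q1 Gq] Gp]; split.
  exists (Num.min q0 q1) => p q; rewrite lt_min => /andP[h0 h1].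
  by rewrite Fq // Gq // scaler0 addr0.
move=> q; have [p0 Fp0] := Fp q; have [p1 Gp1] := Gp q.
exists (Num.min p0 p1) => p; rewrite lt_min => /andP[h0 h1].
by rewrite Fp0 // Gp1 // scaler0 addr0.
Qed.

Lemma biser0 : biser (fun _ _ => 0).
Proof. by split; [exists 0|move=> q; exists 0]. Qed.

Lemma eq_Theta s k F G (e0 e1 e2 : int) : (forall p q, F p q = G p q) ->
  Theta s k F e0 e1 e2 = Theta s k G e0 e1 e2.
Proof. by move=> FG; apply: eq_nsum => m; rewrite FG. Qed.

Lemma Theta_lin s k z F G (e0 e1 e2 : int) : biser F -> biser G ->
  Theta s k (fun p q => z *: F p q + G p q) e0 e1 e2 =
  z *: Theta s k F e0 e1 e2 + Theta s k G e0 e1 e2.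
Proof.
move=> Fb Gb; rewrite /Theta nsumZ; last exact: biser_fin.
rewrite -nsumD; [|exact/finZ/biser_fin|exact: biser_fin].
by apply: eq_nsum => m; rewrite scalerDr !scalerA [z * _]mulrC.
Qed.

Lemma Theta_add s k F G (e0 e1 e2 : int) : biser F -> biser G ->
  Theta s k (fun p q => F p q + G p q) e0 e1 e2 =
  Theta s k F e0 e1 e2 + Theta s k G e0 e1 e2.
Proof.
move=> Fb Gb; rewrite -[X in X + _]scale1r -Theta_lin //.
by apply: eq_Theta => p q; rewrite scale1r.
Qed.

Lemma Theta_scale s k z F (e0 e1 e2 : int) : biser F ->
  Theta s k (fun p q => z *: F p q) e0 e1 e2 = z *: Theta s k F e0 e1 e2.
Proof.
move=> Fb; rewrite /Theta nsumZ; last exact: biser_fin.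
by apply: eq_nsum => m; rewrite !scalerA mulrC.
Qed.

Lemma Theta_sum s k (M : nat) (z : nat -> C) (F : nat -> ser2) (e0 e1 e2 : int) :
  (forall j, biser (F j)) ->
  Theta s k (fun p q => \sum_(j < M) z j *: F j p q) e0 e1 e2 =
  \sum_(j < M) z j *: Theta s k (F j) e0 e1 e2.
Proof.
move=> Fb; have bs N : biser (fun p q => \sum_(j < N) z j *: F j p q).
  elim: N => [|N IH].
    by split; [exists 0|move=> q; exists 0] => *; rewrite big_ord0.
  have := biser_lin (z N) (Fb N) IH.
  congr biser; apply: funext => p; apply: funext => q.
  by rewrite big_ord_recr /= addrC.
elim: M => [|M IH].
  by rewrite big_ord0; apply: nsum_eq0 => m; rewrite big_ord0 scaler0.
rewrite big_ord_recr /= -IH addrC -Theta_lin //.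
by apply: eq_Theta => p q; rewrite big_ord_recr /= addrC.
Qed.

Lemma Theta_op s k (g : S -> S) F (e0 e1 e2 : int) : linear g -> biser F ->
  Theta s k (fun p q => g (F p q)) e0 e1 e2 = g (Theta s k F e0 e1 e2).
Proof.
move=> gl Fb; rewrite /Theta (lin_nsum gl); last exact: biser_fin.
by apply: eq_nsum => m /=; rewrite (linZ gl).
Qed.

Lemma Theta_shift1 s k F d (e0 e1 e2 : int) :
  Theta s k (fun p q => F (p + d) q) e0 e1 e2 = Theta s k F e0 (e1 + d) e2.
Proof.
apply: eq_nsum => m; have -> // : e1 + 1 + e0 + m%:Z + d = e1 + d + 1 + e0 + m%:Z.
by lia.
Qed.

Lemma Theta_shift2 s k F d (e0 e1 e2 : int) :
  Theta s k (fun p q => F p (q + d)) e0 e1 e2 = Theta s k F e0 e1 (e2 + d).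
Proof.
by apply: eq_nsum => m; have -> // : e2 - m%:Z + d = e2 + d - m%:Z by lia.
Qed.

Lemma biser_shift1 F d : biser F -> biser (fun p q => F (p + d) q).
Proof.
move=> [[q0 Fq] Fp]; split; first by exists q0 => p q; apply: Fq.
move=> q; have [p0 Fp0] := Fp q; exists (p0 - d) => p h; apply: Fp0; lia.
Qed.

Lemma biser_shift2 F d : biser F -> biser (fun p q => F p (q + d)).
Proof.
move=> [[q0 Fq] Fp]; split; last by move=> q; apply: Fp.
exists (q0 - d) => p q h; apply: Fq; lia.
Qed.

Lemma biser_op (g : S -> S) F : linear g -> biser F -> biser (fun p q => g (F p q)).
Proof.
move=> gl [[q0 Fq] Fp]; split.
  by exists q0 => p q h; rewrite Fq // lin0.
by move=> q; have [p0 Fp0] := Fp q; exists p0 => p h; rewrite Fp0 // lin0.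
Qed.

Lemma biser_unif F (q : int) (M : nat) : biser F ->
  exists p0 : int, forall p (m : nat), (m < M)%N -> p < p0 -> F p (q - m%:Z) = 0.
Proof.
move=> [_ Fp]; elim: M => [|M [p0 IH]]; first by exists 0 => p m; rewrite ltn0.
have [p1 Fp1] := Fp (q - M%:Z); exists (Num.min p0 p1) => p m.
rewrite lt_min ltnS leq_eqVlt => /orP[/eqP->|mM] /andP[h0 h1]; first exact: Fp1.
exact: IH.
Qed.

(** A family whose bound in the first variable rises with [t], so that only
    finitely many [t] contribute to each coefficient of its sum. *)
Definition unif_biser (F : nat -> ser2) : Prop :=
  (exists q0 : int, forall t p q, q < q0 -> F t p q = 0) /\
  (forall q, exists p0 : int, forall t p, p < p0 + t%:Z -> F t p q = 0).

Lemma unif_biser_fin (F : nat -> ser2) p q : unif_biser F -> fin (fun t => F t p q).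
Proof.
move=> [_ Fp]; have [p0 Fp0] := Fp q; exists (absz (p - p0)).+1 => t h.
rewrite Fp0 //; lia.
Qed.

Lemma unif_biserE (F : nat -> ser2) t : unif_biser F -> biser (F t).
Proof.
move=> [[q0 Fq] Fp]; split; first by exists q0 => p q; apply: Fq.
by move=> q; have [p0 Fp0] := Fp q; exists p0 => p h; apply: Fp0; lia.
Qed.

(** Multiplication by the kernel commutes with series of operators: only the
    finiteness of the triple sum is at stake. *)
Lemma Theta_opser s k (H : nat -> S -> S) (F : nat -> ser2) (e0 e1 e2 : int) :
  (forall t, linear (H t)) -> unif_biser F ->
  Theta s k (fun p q => nsum (fun t => H t (F t p q))) e0 e1 e2 =
  nsum (fun t => H t (Theta s k (F t) e0 e1 e2)).
Proof.
move=> Hl Fb; have [[q0 Fq] Fp] := Fb.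
(* Beyond [M] the second exponent is too negative; below it finitely many
   bounds on the first exponent can be made uniform. *)
pose M := (absz (e2 - q0)).+1.
have qM m : (M <= m)%N -> e2 - m%:Z < q0 by rewrite /M; lia.
have [p0 pF] : exists p0 : int, forall t p (m : nat), (m < M)%N -> p < p0 + t%:Z ->
    F t p (e2 - m%:Z) = 0.
  elim: M {qM} => [|M [p0 IH]]; first by exists 0 => t p m; rewrite ltn0.
  have [p1 Fp1] := Fp (e2 - M%:Z); exists (Num.min p0 p1) => t p m.
  rewrite ltnS leq_eqVlt => /orP[/eqP->|mM] h; [apply: Fp1|apply: IH => //]; lia.
pose g t m := (s ^+ m * cbinom (-1 - e0%:~R - k) m) *: H t (F t (e1 + 1 + e0 + m%:Z) (e2 - m%:Z)).
pose T := (absz (e1 + 1 + e0 + M%:Z - p0)%R).+1.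
have g0 t m : (M <= m)%N || (T <= t)%N -> g t m = 0.
  rewrite /g; case: (leqP M m) => [/qM h _|mM /= tT].
    by rewrite Fq // (lin0 (Hl _)) scaler0.
  by rewrite pF // ?(lin0 (Hl _)) ?scaler0 //; move: tT; rewrite /T; lia.
have gb : boxed g.
  exists (M + T)%N => t m h; apply: g0; case/orP: h; lia.
transitivity (nsum (fun m => nsum (fun t => g t m))).
  apply: eq_nsum => m; rewrite nsumZ //.
  have [M' FM'] := unif_biser_fin (e1 + 1 + e0 + m%:Z) (e2 - m%:Z) Fb.
  by exists M' => t /FM' ->; rewrite (lin0 (Hl _)).
rewrite nsum_exchange; last exact: boxedC.
apply: eq_nsum => t; rewrite /Theta (lin_nsum (Hl t)); last first.
  exact/biser_fin/unif_biserE.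
by apply: eq_nsum => m; rewrite /g /= (linZ (Hl t)).
Qed.

Lemma unif_biser_shift F : biser F -> unif_biser (fun t p q => F (p - t%:Z) q).
Proof.
move=> [[q0 Fq] Fp]; split; first by exists q0 => t p q; apply: Fq.
by move=> q; have [p0 Fp0] := Fp q; exists p0 => t p h; apply: Fp0; lia.
Qed.

Lemma Theta_opser1 s k (H : nat -> S -> S) F (e0 e1 e2 : int) :
  (forall t, linear (H t)) -> biser F ->
  Theta s k (fun p q => nsum (fun t => H t (F (p - t%:Z) q))) e0 e1 e2 =
  nsum (fun t => H t (Theta s k F e0 (e1 - t%:Z) e2)).
Proof.
move=> Hl Fb; rewrite (Theta_opser s k e0 e1 e2 Hl (unif_biser_shift Fb)).
by apply: eq_nsum => t; rewrite -(Theta_shift1 s k F (- t%:Z)).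
Qed.

Lemma biser_opser (H : nat -> S -> S) (F : nat -> ser2) :
  (forall t, linear (H t)) -> unif_biser F ->
  biser (fun p q => nsum (fun t => H t (F t p q))).
Proof.
move=> Hl [[q0 Fq] Fp]; split.
  by exists q0 => p q h; apply: nsum_eq0 => t; rewrite Fq // lin0.
move=> q; have [p0 Fp0] := Fp q; exists p0 => p h; apply: nsum_eq0 => t.
rewrite Fp0 ?lin0 //; lia.
Qed.

Lemma biser_opser2 (H : nat -> S -> S) F : (forall t, linear (H t)) -> biser F ->
  biser (fun p q => nsum (fun t => H t (F p (q - t%:Z)))).
Proof.
move=> Hl Fb; have [[q0 Fq] Fp] := Fb; split.
  exists q0 => p q h; apply: nsum_eq0 => t; rewrite Fq ?lin0 //; lia.
move=> q; pose M := (absz (q - q0)).+1; have [p0 pF] := biser_unif q M Fb.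
exists p0 => p h; apply: nsum_eq0 => t; case: (ltnP t M) => tM.
  by rewrite pF // lin0.
by rewrite Fq ?lin0 //; move: tM; rewrite /M; lia.
Qed.

Lemma Theta_opser2 s k (H : nat -> S -> S) F (e0 e1 e2 : int) :
  (forall t, linear (H t)) -> biser F ->
  Theta s k (fun p q => nsum (fun t => H t (F p (q - t%:Z)))) e0 e1 e2 =
  nsum (fun t => H t (Theta s k F e0 e1 (e2 - t%:Z))).
Proof.
move=> Hl Fb; have [[q0 Fq] Fp] := Fb.
pose g t m := (s ^+ m * cbinom (-1 - e0%:~R - k) m) *: H t (F (e1 + 1 + e0 + m%:Z) (e2 - m%:Z - t%:Z)).
have gb : boxed g.
  apply: (@boxed_triangle _ _ _ (absz (e2 - q0)).+1) => t m h.
  by rewrite /g Fq ?(lin0 (Hl _)) ?scaler0 //; lia.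
transitivity (nsum (fun m => nsum (fun t => g t m))).
  apply: eq_nsum => m; rewrite nsumZ //.
  exists (absz (e2 - m%:Z - q0)%R).+1 => t h.
  by rewrite Fq ?(lin0 (Hl _)) //; lia.
rewrite nsum_exchange; last exact: boxedC.
apply: eq_nsum => t; rewrite /Theta (lin_nsum (Hl t)); last exact: biser_fin.
apply: eq_nsum => m; rewrite /g /= (linZ (Hl t)).
by have -> : e2 - m%:Z - t%:Z = e2 - t%:Z - m%:Z by lia.
Qed.

Lemma biser_binmul s (y : C) d F : biser F -> biser (binmul s y d F).
Proof.
move=> Fb; have [[q0 Fq] Fp] := Fb; split.
  exists q0 => p q h; apply: nsum_eq0 => m; rewrite Fq ?scaler0 //; lia.
move=> q; pose M := (absz (q - q0)).+1; have [p0 pF] := biser_unif q M Fb.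
exists (p0 + d - M%:Z) => p h; apply: nsum_eq0 => m; case: (ltnP m M) => mM.
  by rewrite pF ?scaler0 //; lia.
by rewrite Fq ?scaler0 //; move: mM; rewrite /M; lia.
Qed.

(** Powers of one binomial multiply by adding exponents, which is
    Vandermonde's identity; so multiplication by such a power only moves the
    exponent of the third variable and the parameter [k]. *)
Lemma Theta_binmul s k (y : C) d F (e0 e1 e2 : int) : biser F ->
  Theta s k (binmul s y d F) e0 e1 e2 =
  Theta s (k + d%:~R - y) F (e0 - d) e1 e2.
Proof.
move=> Fb; have [[q0 Fq] Fp] := Fb.
pose g m t := (s ^+ m * cbinom (-1 - e0%:~R - k) m * (s ^+ t * cbinom y t)) *:
  F (e1 + 1 + e0 + m%:Z - d + t%:Z) (e2 - m%:Z - t%:Z).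
transitivity (nsum (fun m => nsum (g m))).
  apply: eq_nsum => m; rewrite nsumZ; last exact: biser_fin.
  by apply: eq_nsum => t; rewrite scalerA.
rewrite nsum_diagonal; last first.
  apply: (@boxed_triangle _ _ _ (absz (e2 - q0)).+1) => m t h.
  by rewrite /g Fq ?scaler0 //; lia.
apply: eq_nsum => n; rewrite rmorphB /=.
have -> : -1 - (e0%:~R - d%:~R) - (k + d%:~R - y) = (-1 - e0%:~R - k) + y :> C by ring.
rewrite -cbinom_Vandermonde mulr_sumr scaler_suml; apply: eq_bigr => t _.
have tn : (t <= n)%N by rewrite -ltnS.
rewrite /g; have -> : e1 + 1 + e0 + (n - t)%N%:Z - d + t%:Z = e1 + 1 + (e0 - d) + n%:Z by lia.
have -> : e2 - (n - t)%N%:Z - t%:Z = e2 - n%:Z by lia.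
have -> : s ^+ n = s ^+ (n - t) * s ^+ t by rewrite -exprD subnK.
by congr (_ *: _); ring.
Qed.

Lemma Theta_binmulZ s k d F (e0 e1 e2 : int) : biser F ->
  Theta s k (binmul s d%:~R d F) e0 e1 e2 = Theta s k F (e0 - d) e1 e2.
Proof. by move=> Fb; rewrite Theta_binmul // addrK. Qed.

Lemma Theta_fsum s k (F : nat -> ser2) (M : nat) (e0 e1 e2 : int) :
  (forall j, biser (F j)) -> (forall j p q, (M <= j)%N -> F j p q = 0) ->
  Theta s k (fun p q => nsum (fun j => F j p q)) e0 e1 e2 =
  nsum (fun j => Theta s k (F j) e0 e1 e2).
Proof.
move=> Fb F0.
rewrite (@eq_Theta s k _ (fun p q => \sum_(j < M) 1 *: F j p q)) => [|p q].
  rewrite (Theta_sum s k M (fun=> 1)) // (@nsumE _ _ M) => [|j jM].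
    by apply: eq_bigr => j _; rewrite scale1r.
  by apply: nsum_eq0 => m; rewrite F0 // scaler0.
by rewrite (@nsumE _ _ M) => [|j jM]; [apply: eq_bigr => j _; rewrite scale1r|rewrite F0].
Qed.

Lemma biser_fsum (F : nat -> ser2) (M : nat) :
  (forall j, biser (F j)) -> (forall j p q, (M <= j)%N -> F j p q = 0) ->
  biser (fun p q => nsum (fun j => F j p q)).
Proof.
move=> Fb F0; have -> : (fun p q => nsum (fun j => F j p q)) = (fun p q => \sum_(j < M) F j p q).
  by apply: funext => p; apply: funext => q; rewrite (@nsumE _ _ M) // => j /F0 ->.
elim: M {F0} => [|M IH].
  congr biser: biser0; apply: funext => p; apply: funext => q; by rewrite big_ord0.
have := biser_lin 1 (Fb M) IH; congr biser; apply: funext => p; apply: funext => q.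
by rewrite big_ord_recr /= scale1r addrC.
Qed.

Lemma Theta_fin1 s k F (e0 e1 e2 : int) : biser F ->
  fin (fun t : nat => Theta s k F e0 (e1 - t%:Z) e2).
Proof.
move=> Fb; have [[q0 Fq] Fp] := Fb; pose M := (absz (e2 - q0)).+1.
have [p0 pF] := biser_unif e2 M Fb.
exists (absz (e1 + 1 + e0 + M%:Z - p0)%R).+1 => t h; apply: nsum_eq0 => m.
case: (ltnP m M) => mM; last by rewrite Fq ?scaler0 //; move: mM; rewrite /M; lia.
rewrite pF ?scaler0 //; lia.
Qed.

Lemma Theta_fin2 s k F (e0 e1 e2 : int) : biser F ->
  fin (fun t : nat => Theta s k F e0 e1 (e2 - t%:Z)).
Proof.
move=> [[q0 Fq] Fp]; exists (absz (e2 - q0)).+1 => t h; apply: nsum_eq0 => m.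
by rewrite Fq ?scaler0 //; lia.
Qed.

End Theta.

(** * The Heisenberg algebra and the exponentials Y_- and Y_+ *)

Section Heisenberg.
Variables (R : realType) (l : nat) (S : lmodType R[i]).
Variables (one : S) (a : 'I_l -> int -> S -> S).
Local Notation C := R[i].
Local Notation vec := 'rV[C]_l.
Implicit Types (b c : vec) (i : 'I_l) (x u v : S) (n : int).

Definition mono s : S := foldr (fun ik => a ik.1 (Negz ik.2)) one s.

(** Only the commutation relations, the vacuum and the spanning by creation
    operators are used, so the Fock space is an abstract module here. The zero
    modes vanish on it; the zero mode of a charge sector is added by [smode]. *)
Hypothesis a_lin : forall i n, linear (a i n).
Hypothesis a_zero : forall i x, a i 0 x = 0.
Hypothesis aC : forall i j n m x, a i n (a j m x) =
  a j m (a i n x) + (if (i == j) && (n + m == 0) then n%:~R *: x else 0).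
Hypothesis a_one : forall i (n : nat), a i n one = 0.
Hypothesis mono_span : forall P : S -> Prop, (forall s, P (mono s)) ->
  (forall k x y, P x -> P y -> P (k *: x + y)) -> forall x, P x.

Lemma fock_ind (P : S -> Prop) : P one ->
  (forall k x y, P x -> P y -> P (k *: x + y)) ->
  (forall i k x, P x -> P (a i (Negz k) x)) -> forall x, P x.
Proof.
move=> P1 Pl Pa; apply: mono_span => // s.
by elim: s => [|ik s IH] //=; apply: Pa.
Qed.

Definition amod b n x : S := \sum_(i < l) b 0 i *: a i n x.

(** The mode [a^i(n)] on the sector of charge [c]. *)
Definition smode c i n x : S := a i n x + (if n == 0 then c 0 i *: x else 0).

Lemma amod_lin b n : linear (amod b n).
Proof. by apply: sum_linear => i; apply: scale_linear. Qed.

Lemma smode_lin c i n : linear (smode c i n).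
Proof.
apply: add_linear => //; case: (n == 0); first exact: scaler_linear.
by move=> k x y; rewrite scaler0 addr0.
Qed.

Lemma smodeS c i (n : int) x : n != 0 -> smode c i n x = a i n x.
Proof. by rewrite /smode => /negbTE ->; rewrite addr0. Qed.

Lemma smode0 c i x : smode c i 0 x = c 0 i *: x.
Proof. by rewrite /smode a_zero add0r. Qed.

Lemma smode_one c i (n : nat) : smode c i n one = if n == 0%N then c 0 i *: one else 0.
Proof. by rewrite /smode a_one add0r. Qed.

Lemma smodeC b c i j n m x : smode b i n (smode c j m x) =
  smode c j m (smode b i n x) + (if (i == j) && (n + m == 0) then n%:~R *: x else 0).
Proof.
have [->|n0] := eqVneq n 0.
  by rewrite !smode0 (linZ (smode_lin _ _ _)) scale0r if_same addr0.
have [->|m0] := eqVneq m 0; last first.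
  by rewrite !(smodeS _ _ _ n0) !(smodeS _ _ _ m0) aC.
by rewrite !smode0 (linZ (smode_lin _ _ _)) addr0 (negbTE n0) andbF addr0.
Qed.

Lemma amod_comm b i n m x : a i n (amod b m x) =
  amod b m (a i n x) + (if n + m == 0 then (n%:~R * b 0 i) *: x else 0).
Proof.
rewrite /amod (lin_sum (a_lin _ _)).
under eq_bigr do rewrite (linZ (a_lin _ _)) aC scalerDr.
rewrite big_split /=; congr (_ + _).
rewrite (bigD1 i) //= eqxx /= big1 ?addr0 => [|j ji].
  by case: ifP => _; rewrite ?scaler0 // scalerA mulrC.
by rewrite eq_sym (negbTE ji) scaler0.
Qed.

Lemma a_creC i j k m x : a i (Negz k) (a j (Negz m) x) = a j (Negz m) (a i (Negz k) x).
Proof.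
have h : (Negz k + Negz m == 0) = false by lia.
by rewrite aC h andbF addr0.
Qed.

Lemma a_amodC b i n m x : n + m != 0 -> a i n (amod b m x) = amod b m (a i n x).
Proof. by move=> /negbTE h; rewrite amod_comm h addr0. Qed.

Lemma amodC b d n m x : n + m != 0 -> amod b n (amod d m x) = amod d m (amod b n x).
Proof.
move=> h; rewrite {1}/amod (lin_sum (amod_lin _ _)); apply: eq_bigr => i _.
by rewrite a_amodC // (linZ (amod_lin _ _)).
Qed.

Lemma amodD b d n x : amod (b + d) n x = amod b n x + amod d n x.
Proof.
by rewrite /amod -big_split /=; apply: eq_bigr => i _; rewrite !mxE scalerDl.
Qed.

(** The exponents of [Y_-(b,z)] and [Y_+(b,z)]; [j] stands for the mode number
    [j.+1], as in [exp_coef]. *)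
Definition logYm b (j : nat) x : S := j.+1%:R^-1 *: amod b (Negz j) x.
Definition logYp b (j : nat) x : S := - (j.+1%:R^-1 *: amod b j.+1 x).
(** The coefficients of [Y_-(b,z)] and [Y_+(b,z)] at the powers [q] and [-q]. *)
Definition Ym b := exp_coef (logYm b).
Definition Yp b := exp_coef (logYp b).

Lemma natSK (j : nat) : (j.+1%:R : C) * j.+1%:R^-1 = 1.
Proof. by rewrite mulfV // pnatr_eq0. Qed.

Lemma logYm_lin b j : linear (logYm b j).
Proof. exact/scale_linear/amod_lin. Qed.

Lemma logYp_lin b j : linear (logYp b j).
Proof.
move=> k x y; rewrite /logYp (linD (scale_linear _ (amod_lin _ _))).
by rewrite (linZ (scale_linear _ (amod_lin _ _))) opprD scalerN.
Qed.

Lemma logYmC b d (i j : nat) x : logYm b i (logYm d j x) = logYm d j (logYm b i x).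
Proof.
rewrite /logYm !(linZ (amod_lin _ _)) amodC; last by lia.
by rewrite !scalerA mulrC.
Qed.

Lemma logYpC b d (i j : nat) x : logYp b i (logYp d j x) = logYp d j (logYp b i x).
Proof.
rewrite /logYp !(linN (amod_lin _ _)) !(linZ (amod_lin _ _)) amodC; last by lia.
by rewrite !scalerN !scalerA mulrC.
Qed.

Lemma Ym_lin b q : linear (Ym b q).
Proof. exact/exp_coef_linear/logYm_lin. Qed.

Lemma Yp_lin b q : linear (Yp b q).
Proof. exact/exp_coef_linear/logYp_lin. Qed.

Lemma Ym0 b x : Ym b 0 x = x.
Proof. exact/exp_coef0. Qed.

Lemma Yp0 b x : Yp b 0 x = x.
Proof. exact/exp_coef0. Qed.

Lemma Ym_rec b q x :
  q%:R *: Ym b q x = \sum_(j < q) amod b (Negz j) (Ym b (q - j.+1) x).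
Proof.
rewrite /Ym (exp_coef_rec (logYm_lin b) (logYmC b b)).
by apply: eq_bigr => j _; rewrite /logYm scalerA natSK scale1r.
Qed.

Lemma Yp_rec b q x :
  q%:R *: Yp b q x = - \sum_(j < q) amod b j.+1 (Yp b (q - j.+1) x).
Proof.
rewrite /Yp (exp_coef_rec (logYp_lin b) (logYpC b b)).
rewrite -sumrN; apply: eq_bigr => j _.
by rewrite /logYp scalerN scalerA natSK scale1r.
Qed.

Lemma Ym_comm b (g : S -> S) q x : linear g ->
  (forall j y, g (amod b (Negz j) y) = amod b (Negz j) (g y)) ->
  g (Ym b q x) = Ym b q (g x).
Proof.
move=> gl gb; apply: (exp_coef_comm (logYm_lin b) (logYmC b b)) => //.
by move=> j y; rewrite /logYm (linZ gl) gb.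
Qed.

Lemma Yp_comm b (g : S -> S) q x : linear g ->
  (forall j y, g (amod b j.+1 y) = amod b j.+1 (g y)) ->
  g (Yp b q x) = Yp b q (g x).
Proof.
move=> gl gb; apply: (exp_coef_comm (logYp_lin b) (logYpC b b)) => //.
by move=> j y; rewrite /logYp (linN gl) (linZ gl) gb.
Qed.

Lemma a_cre_Ym b i k q x : a i (Negz k) (Ym b q x) = Ym b q (a i (Negz k) x).
Proof. by apply: Ym_comm => // j y; rewrite a_amodC //; lia. Qed.

Lemma a_ann_Yp b i (k : nat) q x : a i k (Yp b q x) = Yp b q (a i k x).
Proof. by apply: Yp_comm => // j y; rewrite a_amodC //; lia. Qed.

Lemma smode_ann_Yp b c i (k : nat) q x : smode c i k (Yp b q x) = Yp b q (smode c i k x).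
Proof.
rewrite /smode a_ann_Yp (linD (Yp_lin _ _)); congr (_ + _).
by case: eqP => _; rewrite ?(linZ (Yp_lin _ _)) // (lin0 (Yp_lin _ _)).
Qed.

Lemma YmC b d p q x : Ym b p (Ym d q x) = Ym d q (Ym b p x).
Proof.
apply: Ym_comm; first exact: Ym_lin.
by move=> j y; rewrite -Ym_comm //; [exact: amod_lin|move=> k z; apply: amodC; lia].
Qed.

Lemma YpC b d p q x : Yp b p (Yp d q x) = Yp d q (Yp b p x).
Proof.
apply: Yp_comm; first exact: Yp_lin.
by move=> j y; rewrite -Yp_comm //; [exact: amod_lin|move=> k z; apply: amodC; lia].
Qed.

Lemma Ym_add b d k x : \sum_(t < k.+1) Ym b (k - t) (Ym d t x) = Ym (b + d) k x.
Proof.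
rewrite /Ym (exp_coef_add _ _ (logYm_lin b) (logYm_lin d) (logYmC b b) (logYmC d d) (logYmC b d)).
by apply: eq_exp_coef => j y; rewrite /logYm amodD scalerDr.
Qed.

Lemma Yp_add b d k x : \sum_(t < k.+1) Yp b (k - t) (Yp d t x) = Yp (b + d) k x.
Proof.
rewrite /Yp (exp_coef_add _ _ (logYp_lin b) (logYp_lin d) (logYpC b b) (logYpC d d) (logYpC b d)).
by apply: eq_exp_coef => j y; rewrite /logYp amodD scalerDr opprD.
Qed.

(** The commutator of [a^i(k+1)] with the exponent of [Y_-] is the scalar [b_i
    z^(k+1)]. *)
Lemma a_ann_Ym b i (k : nat) q x : a i k.+1 (Ym b q x) =
  Ym b q (a i k.+1 x) + (if (k < q)%N then b 0 i *: Ym b (q - k.+1) x else 0).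
Proof.
apply: (exp_coef_commutator (logYm_lin b) (logYmC b b) _ _ (a_lin _ _)).
move=> j y; rewrite /logYm (linZ (a_lin _ _)) amod_comm scalerDr; congr (_ + _).
have -> : (k.+1%:Z + Negz j == 0) = (j == k) by apply/idP/idP; lia.
by case: eqP => [->|_]; rewrite ?scaler0 // scalerA mulrA mulVf ?mul1r // pnatr_eq0.
Qed.

Lemma a_cre_Yp b i (k : nat) q x : a i (Negz k) (Yp b q x) =
  Yp b q (a i (Negz k) x) + (if (k < q)%N then b 0 i *: Yp b (q - k.+1) x else 0).
Proof.
apply: (exp_coef_commutator (logYp_lin b) (logYpC b b) _ _ (a_lin _ _)).
move=> j y; rewrite /logYp (linN (a_lin _ _)) (linZ (a_lin _ _)) amod_comm.
rewrite scalerDr opprD; congr (_ + _).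
have -> : (Negz k + j.+1%:Z == 0) = (j == k) by apply/idP/idP; lia.
case: eqP => [->|_]; rewrite ?scaler0 ?oppr0 // scalerA mulrA -scaleNr; congr (_ *: _).
have -> : (Negz k)%:~R = - k.+1%:R :> C by rewrite NegzE mulrNz.
by rewrite -mulNr -mulrN opprK mulVf ?mul1r // pnatr_eq0.
Qed.

Lemma Yp_one b q : Yp b q one = one *+ (q == 0%N).
Proof.
case: q => [|q]; first by rewrite Yp0.
apply: (@natS_inj R _ q); rewrite Yp_rec /= mulr0n scaler0 big1 ?oppr0 // => j _.
have aj0 : amod b j.+1 one = 0.
  by rewrite /amod big1 // => i _; rewrite a_one scaler0.
rewrite Yp_comm ?aj0 ?(lin0 (Yp_lin _ _)) //; first exact: amod_lin.
by move=> k y; apply: amodC; lia.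
Qed.

(** [Y_+(b,z)] fixes the vacuum, and each creation operator raises the degree
    in the inverse of z by a bounded amount, by its commutator with [Y_+]. *)
Lemma Yp_lf b : locally_finite (Yp b).
Proof.
split=> [j|]; first exact: Yp_lin.
apply: fock_ind => [|k x y xf yf|i k x [N xf]].
- by exists 1%N => -[|q] // _; rewrite Yp_one.
- apply: (@eq_fin _ (fun j => k *: Yp b j x + Yp b j y)).
    by move=> j; rewrite (Yp_lin b j).
  by apply: finD => //; apply: finZ.
- exists (N + k.+1)%N => q h.
  have := a_cre_Yp b i k q x; rewrite xf ?(lin0 (a_lin _ _)); last by lia.
  case: ifP => kq; rewrite ?addr0 ?[Yp b (q - _) x]xf; try lia.
  by rewrite scaler0 addr0.
Qed.

Lemma smode_lf c i : locally_finite (fun n : nat => smode c i n).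
Proof.
split=> [j|]; first exact: smode_lin.
apply: fock_ind => [|k x y xf yf|j k x [N xf]].
- by exists 1%N => -[|q] // _; rewrite smode_one.
- apply: (@eq_fin _ (fun q => k *: smode c i q%:Z x + smode c i q%:Z y)).
    by move=> q; rewrite (smode_lin c i q).
  by apply: finD => //; apply: finZ.
- exists (N + k.+2)%N => q h; have n0 : q%:Z != 0 by lia.
  have h0 : (q%:Z + Negz k == 0) = false by lia.
  rewrite (smodeS _ _ _ n0) aC -(smodeS c _ _ n0) h0 andbF addr0 xf; last by lia.
  exact: lin0.
Qed.

(** * Normally ordered products *)

(** The coefficients of the creation part ([z^t]) and of the annihilation part
    ([z^(-j-k-1)]) of [(1/k!) (d/dz)^k a^i(z)]. *)
Definition cre i (k t : nat) x : S := cbinom (t + k)%N%:R k *: a i (Negz (t + k)) x.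
Definition ann c i (k j : nat) x : S := cbinom (- j%:R - 1) k *: smode c i j x.

Lemma cre_lin i k t : linear (cre i k t).
Proof. exact/scale_linear/a_lin. Qed.

Lemma ann_lf c i k : locally_finite (ann c i k).
Proof.
split=> [j|x]; first exact/scale_linear/smode_lin.
by apply: fin_scale; apply: (smode_lf c i).2.
Qed.

Definition id_field : int -> S -> S := fun n x => x *+ (n == 0).

Lemma id_field_field : isfield id_field.
Proof.
split=> [n k x y|x]; first by rewrite /id_field mulrnDl scalerMnr.
by exists 0 => n n0; rewrite /id_field; case: eqP => [h|//]; lia.
Qed.

(** One more factor of a normally ordered product: its creation part goes to
    the left of the other factors and its annihilation part to the right. *)
Definition nstep c i k (F : int -> S -> S) : int -> S -> S :=
  fadd (compL (cre i k) F) (compR k.+1 (ann c i k) F).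

Fixpoint Nlist s c : int -> S -> S :=
  if s is ik :: s' then nstep c ik.1 ik.2 (Nlist s' c) else id_field.

Lemma nstep_field c i k F : isfield F -> isfield (nstep c i k F).
Proof.
move=> Ff; apply: fadd_field.
  by apply: compL_field => // t; apply: cre_lin.
by apply: compR_field => //; apply: ann_lf.
Qed.

Lemma Nlist_field s c : isfield (Nlist s c).
Proof. by elim: s => [|ik s IH]; [exact: id_field_field|apply: nstep_field]. Qed.

Lemma creC i i' k k' t t' x : cre i k t (cre i' k' t' x) = cre i' k' t' (cre i k t x).
Proof. by rewrite /cre !(linZ (a_lin _ _)) a_creC !scalerA mulrC. Qed.

Lemma smode_annC c i i' (j j' : nat) x : smode c i j (smode c i' j' x) = smode c i' j' (smode c i j x).
Proof.
rewrite smodeC; case: andP => [[_ h]|]; last by rewrite addr0.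
have -> : (j : int) = 0 by lia.
by rewrite scale0r addr0.
Qed.

Lemma annC c i i' k k' j j' x : ann c i k j (ann c i' k' j' x) = ann c i' k' j' (ann c i k j x).
Proof. by rewrite /ann !(linZ (smode_lin _ _ _)) smode_annC !scalerA mulrC. Qed.

Lemma nstepC c i i' k k' F : isfield F ->
  nstep c i k (nstep c i' k' F) = nstep c i' k' (nstep c i k F).
Proof.
move=> Ff; have crl := cre_lin; have anl := ann_lf.
have Lf i0 k0 : isfield (compL (cre i0 k0) F) by apply: compL_field.
have Rf i0 k0 : isfield (compR k0.+1 (ann c i0 k0) F) by apply: compR_field.
rewrite /nstep !compLD // !compRD //.
rewrite [compL (cre i k) (compL _ _)]compLC //; last by move=> *; apply: creC.
rewrite [compR k.+1 _ (compR _ _ _)]compRC //; last by move=> *; apply: annC.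
rewrite !compLR //.
by apply: modes_ext => n x; rewrite /fadd -!addrA; congr (_ + _); rewrite !addrA; congr (_ + _); rewrite addrC.
Qed.

(** Creation operators commute with each other, and so do annihilation
    operators; normal ordering never compares one with the other. Hence the
    field of a state depends only on the multiset of its creation operators. *)
Lemma Nlist_perm s s' c : perm_eq s s' -> Nlist s c = Nlist s' c.
Proof.
move=> ss; have Nrot p s1 : forall s2, Nlist (s1 ++ p :: s2) c = Nlist (p :: s1 ++ s2) c.
  elim: s1 => [|q s1 IH] s2 //=; rewrite IH /= nstepC //; exact: Nlist_field.
elim: s s' ss => [|p s IH] s' ss.
  by move/perm_size/esym/size0nil: ss => ->.
have ps : p \in s' by rewrite -(perm_mem ss) mem_head.
case/splitPr: ps ss => s1 s2 ss; rewrite Nrot /=; congr nstep; apply: IH.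
by rewrite -(perm_cons p) (perm_trans ss) // perm_catC /= perm_cons perm_catC.
Qed.

(** * Vertex operators of exponentials on a charge sector *)

Section Vertex.
Variable N : S -> vec -> int -> S -> S.
Hypothesis N_lin : forall c n x, linear (fun u => N u c n x).
Hypothesis N_mono : forall s c n x, N (mono s) c n x = Nlist s c n x.

Lemma N_one c : N one c = id_field.
Proof. by apply: modes_ext => n x; apply: (N_mono [::]). Qed.

Lemma lin_comb_field k F G : isfield F -> isfield G ->
  isfield (fun n x => k *: F n x + G n x).
Proof.
move=> Ff Gf; apply: fadd_field => //; split=> [n|x].
  exact/scale_linear/(Ff.1 n).
by have [M FM] := Ff.2 x; exists M => n /FM ->; rewrite scaler0.
Qed.

Lemma N_field u c : isfield (N u c).
Proof.
elim/mono_span: u => [s|k x y xf yf].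
  have -> : N (mono s) c = Nlist s c by apply: modes_ext => n x; apply: N_mono.
  exact: Nlist_field.
have -> : N (k *: x + y) c = (fun n z => k *: N x c n z + N y c n z).
  by apply: modes_ext => n z; apply: (N_lin c n z).
exact: lin_comb_field.
Qed.

Lemma compL_lin p k F G : (forall t, linear (p t)) -> isfield F -> isfield G ->
  compL p (fun n x => k *: F n x + G n x) =
  (fun n x => k *: compL p F n x + compL p G n x).
Proof.
move=> pl Ff Gf; apply: modes_ext => n x; rewrite /compL.
rewrite (nsumZ _ (compL_fin n x pl Ff)) -nsumD.
- by apply: eq_nsum => t; rewrite pl.
- exact/finZ/(compL_fin n x pl Ff).
- exact/(compL_fin n x pl Gf).
Qed.

Lemma compR_lin d q k F G : locally_finite q -> isfield F -> isfield G ->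
  compR d q (fun n x => k *: F n x + G n x) =
  (fun n x => k *: compR d q F n x + compR d q G n x).
Proof.
move=> ql Ff Gf; apply: modes_ext => n x; rewrite /compR.
rewrite (nsumZ _ (compR_fin d n x ql Ff)) -nsumD //.
- exact/finZ/(compR_fin d n x ql Ff).
- exact/(compR_fin d n x ql Gf).
Qed.

Lemma nstep_lin c i k z F G : isfield F -> isfield G ->
  nstep c i k (fun n x => z *: F n x + G n x) =
  (fun n x => z *: nstep c i k F n x + nstep c i k G n x).
Proof.
move=> Ff Gf; rewrite /nstep compL_lin ?compR_lin //; [|exact: ann_lf|exact: cre_lin].
by apply: modes_ext => n x; rewrite /fadd scalerDr !addrA; congr (_ + _); rewrite addrAC.
Qed.

(** The defining rule on monomials extends by linearity in the state. *)
Lemma N_cons i k u c : N (a i (Negz k) u) c = nstep c i k (N u c).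
Proof.
elim/mono_span: u => [s|z x y xf yf].
  have -> : N (mono s) c = Nlist s c by apply: modes_ext => n x; apply: N_mono.
  by apply: modes_ext => n x; apply: (N_mono ((i, k) :: s)).
have e : N (z *: x + y) c = (fun n w => z *: N x c n w + N y c n w).
  by apply: modes_ext => n w; apply: (N_lin c n w).
rewrite e nstep_lin -?xf -?yf; [|exact: N_field|exact: N_field].
by apply: modes_ext => n w; rewrite a_lin; apply: (N_lin c n w).
Qed.

(** The modes of [Y_-(b,z) Y(u,z) Y_+(b,z)] on the sector of charge [c],
    without the power of z that comes from the zero mode. *)
Definition vop u b c : int -> S -> S := compL (Ym b) (compR 0 (Yp b) (N u c)).

Lemma vop_field u b c : isfield (vop u b c).
Proof.
apply: compL_field; first exact: Ym_lin.
apply: compR_field; [exact: Yp_lf|exact: N_field].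
Qed.

Lemma vop_lin_u b c n x : linear (fun u => vop u b c n x).
Proof.
move=> k u v; have e : N (k *: u + v) c = (fun n w => k *: N u c n w + N v c n w).
  by apply: modes_ext => m w; apply: (N_lin c m w).
have pl := Ym_lin b; have ql := Yp_lf b; have Nf := N_field.
have Rf w : isfield (compR 0 (Yp b) (N w c)) by apply: compR_field.
by rewrite /vop e compR_lin // compL_lin.
Qed.

Lemma vop_lin u b c n : linear (vop u b c n).
Proof. exact: (vop_field u b c).1. Qed.

Lemma vop_u0 b c n x : vop 0 b c n x = 0.
Proof. exact: (lin0 (vop_lin_u b c n x)). Qed.

Lemma vop_uZ k u b c n x : vop (k *: u) b c n x = k *: vop u b c n x.
Proof. exact: (linZ (vop_lin_u b c n x)). Qed.

Lemma vop_x0 u b c n : vop u b c n 0 = 0.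
Proof. exact: (lin0 (vop_lin u b c n)). Qed.

Lemma vop_xZ k u b c n x : vop u b c n (k *: x) = k *: vop u b c n x.
Proof. exact: (linZ (vop_lin u b c n)). Qed.

Lemma compL_nstep p c i k F : (forall t, linear (p t)) -> isfield F ->
  (forall (s t : nat) x, p s (cre i k t x) = cre i k t (p s x)) ->
  compL p (nstep c i k F) = nstep c i k (compL p F).
Proof.
move=> pl Ff pC; have crl := cre_lin i k; have anl := ann_lf c i k.
rewrite /nstep compLD //; first by rewrite compLC // compLR.
  exact: compL_field.
exact: compR_field.
Qed.

Lemma compR_nstep q c i k F : locally_finite q -> isfield F ->
  (forall (s t : nat) x, q s (ann c i k t x) = ann c i k t (q s x)) ->
  compR 0 q (nstep c i k F) = nstep c i k (compR 0 q F).
Proof.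
move=> ql Ff qC; have crl := cre_lin i k; have anl := ann_lf c i k.
rewrite /nstep compRD //; first by rewrite compRC // -compLR.
  exact: compL_field.
exact: compR_field.
Qed.

Lemma Ym_cre b i k (s t : nat) x : Ym b s (cre i k t x) = cre i k t (Ym b s x).
Proof. by rewrite /cre (linZ (Ym_lin _ _)) a_cre_Ym. Qed.

Lemma Yp_ann b c i k (s t : nat) x : Yp b s (ann c i k t x) = ann c i k t (Yp b s x).
Proof. by rewrite /ann (linZ (Yp_lin _ _)) smode_ann_Yp. Qed.

(** The creation part of the new factor commutes with [Y_-] and its
    annihilation part with [Y_+], so both can be moved outside. *)
Lemma vop_cons i k u b c : vop (a i (Negz k) u) b c = nstep c i k (vop u b c).
Proof.
rewrite /vop N_cons compR_nstep; [|exact: Yp_lf|exact: N_field|exact: Yp_ann].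
rewrite compL_nstep //; [exact: Ym_lin| |exact: Ym_cre].
apply: compR_field; [exact: Yp_lf|exact: N_field].
Qed.

(** Exponentials of commuting exponents multiply, on each side of the field
    separately. *)
Lemma vop_add u b d c :
  compL (Ym d) (compR 0 (Yp d) (vop u b c)) = vop u (d + b) c.
Proof.
have pl := Ym_lin; have ql := Yp_lf; have Nf := N_field.
have Rf e : isfield (compR 0 (Yp e) (N u c)) by apply: compR_field.
have qa := Yp_add; have pa := Ym_add; have qC := YpC.
rewrite /vop -[compR 0 (Yp d) (compL _ _)]compLR //.
rewrite (compL_conv _ _ _ (Ym_add d b)) //; last by apply: compR_field.
by rewrite (@compR_conv _ _ (Yp d) (Yp b) (Yp (d + b))).
Qed.

Lemma vop_oneE b c n x : vop one b c n x =
  compL (Ym b) (compR 0 (Yp b) id_field) n x.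
Proof. by rewrite /vop N_one. Qed.

Lemma vop_one_c b c c' : vop one b c = vop one b c'.
Proof. by rewrite /vop !N_one. Qed.

(** For [n > 0] only [Y_-] fails to commute with [a^i(n)], for [n < 0] only
    [Y_+]; in both cases the commutator is the scalar [b_i z^n]. *)
Lemma vop_one_comm b c i n q x : n != 0 -> a i n (vop one b c q x) =
  vop one b c q (a i n x) + b 0 i *: vop one b c (q - n) x.
Proof.
have idf := id_field_field; have pl := Ym_lin b; have ql := Yp_lf b.
have Rf : isfield (compR 0 (Yp b) id_field) by apply: compR_field.
have Lf : isfield (compL (Ym b) id_field) by apply: compL_field.
have ida i' n' m y : a i' n' (id_field m y) = id_field m (a i' n' y).
  by rewrite /id_field; case: (m == 0); rewrite ?(lin0 (a_lin _ _)).
have fin1 i' n' : fin (fun j => a i' n' (compR 0 (Yp b) id_field (q - j%:Z) x)).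
  exact: (compL_fin q x (fun=> a_lin i' n') Rf).
case: n => [[|n] //|n] _; last first.
  have E F y : isfield F -> compL (Ym b) (compR 0 (Yp b) F) q y = compR 0 (Yp b) (compL (Ym b) F) q y.
    by move=> Ff; rewrite compLR.
  rewrite !vop_oneE !E //.
  rewrite {1}/compR (lin_nsum (a_lin _ _)); last exact: (compR_fin 0 q x ql Lf).
  rewrite (@eq_nsum _ _ (fun j => compL (Ym b) id_field (q + 0%:Z + j%:Z) (Yp b j (a i (Negz n) x)) +
    (if (n < j)%N then b 0 i *: compL (Ym b) id_field (q + 0%:Z + j%:Z) (Yp b (j - n.+1) x) else 0))).
    rewrite nsumD; [|exact: (compR_fin 0 q _ ql Lf)|]; last first.
      have [M qM] := ql.2 x; exists (M + n.+1)%N => j h.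
      by case: ifP => // nj; rewrite qM ?(lin0 (Lf.1 _)) ?scaler0 //; lia.
    congr (_ + _); rewrite (@nsum_shift _ _ n.+1).
    - rewrite compLR // nsumZ; last exact: (compR_fin 0 _ x ql Lf).
      apply: eq_nsum => j; rewrite ifT; last by lia.
      have -> : q + 0%:Z + (n.+1 + j)%:Z = q - Negz n + 0%:Z + j%:Z by lia.
      by rewrite addKn.
    - by move=> j jn; rewrite ifF //; lia.
    - have [M qM] := ql.2 x; exists (M + n.+1)%N => j h.
      by case: ifP => // nj; rewrite qM ?(lin0 (Lf.1 _)) ?scaler0 //; lia.
  move=> j /=; rewrite /compL.
  rewrite (lin_nsum (a_lin _ _)); last exact: (compL_fin _ _ pl idf).
  transitivity (compL (Ym b) id_field (q + 0%:Z + j%:Z) (a i (Negz n) (Yp b j x))).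
    by apply: eq_nsum => t /=; rewrite a_cre_Ym ida.
  rewrite a_cre_Yp (linD (Lf.1 _)); congr (_ + _).
  by case: ifP => _; rewrite ?(linZ (Lf.1 _)) // (lin0 (Lf.1 _)).
rewrite !vop_oneE {1}/compL (lin_nsum (a_lin _ _)); last exact: (compL_fin q x pl Rf).
have aR m : a i n.+1 (compR 0 (Yp b) id_field m x) = compR 0 (Yp b) id_field m (a i n.+1 x).
  rewrite /compR (lin_nsum (a_lin _ _)); last exact: (compR_fin 0 m x ql idf).
  by apply: eq_nsum => j /=; rewrite ida a_ann_Yp.
rewrite (@eq_nsum _ _ (fun t => Ym b t (compR 0 (Yp b) id_field (q - t%:Z) (a i n.+1 x)) +
    (if (n < t)%N then b 0 i *: Ym b (t - n.+1) (compR 0 (Yp b) id_field (q - t%:Z) x) else 0))).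
  have [M RM] := fin_lower q (Rf.2 x).
  have fin2 : fin (fun t => if (n < t)%N then b 0 i *: Ym b (t - n.+1) (compR 0 (Yp b) id_field (q - t%:Z) x) else 0).
    by exists M => t Mt; case: ifP => // _; rewrite RM // (lin0 (pl _)) scaler0.
  rewrite nsumD; [|exact: (compL_fin q _ pl Rf)|exact: fin2].
  congr (_ + _); rewrite (@nsum_shift _ _ n.+1) //; last by move=> j jn; rewrite ifF //; lia.
  rewrite nsumZ; last exact: (compL_fin _ x pl Rf).
  apply: eq_nsum => j; rewrite ifT; last by lia.
  have -> : q - (n.+1 + j)%:Z = q - n.+1%:Z - j%:Z by lia.
  by rewrite addKn.
by move=> t /=; rewrite a_ann_Ym aR.
Qed.

Lemma smode_vop_one b c i n q x : smode (b + c) i n (vop one b c q x) =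
  vop one b c q (smode c i n x) + b 0 i *: vop one b c (q - n) x.
Proof.
case: (n =P 0) => [->|/eqP n0]; last by rewrite !(smodeS _ _ _ n0) vop_one_comm.
by rewrite !smode0 vop_xZ mxE scalerDl addrC subr0.
Qed.

Lemma vop_one_one b c (q : int) : vop one b c q one = if q is Posz k then Ym b k one else 0.
Proof.
rewrite vop_oneE {1}/compL.
have R1 m : compR 0 (Yp b) id_field m one = one *+ (m == 0).
  rewrite /compR (@nsum_one _ _ 0) => [|j j0].
    by rewrite Yp0 /id_field !addr0.
  by rewrite Yp_one (negbTE j0) mulr0n (lin0 (id_field_field.1 _)).
case: q => q.
  rewrite (@nsum_one _ _ q) => [|j jq]; first by rewrite R1 subrr.
  have h : (q%:Z - j%:Z == 0) = false by lia.
  by rewrite R1 h (lin0 (Ym_lin _ _)).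
apply: nsum_eq0 => j; rewrite R1.
have h : (Negz q - j%:Z == 0) = false by lia.
by rewrite h (lin0 (Ym_lin _ _)).
Qed.

Lemma nstep_sum c i k (M : nat) (z : nat -> C) (d : nat -> int)
    (F : nat -> int -> S -> S) : (forall j, isfield (F j)) ->
  nstep c i k (fun n x => \sum_(j < M) z j *: F j (n + d j) x) =
  (fun n x => \sum_(j < M) z j *: nstep c i k (F j) (n + d j) x).
Proof.
move=> Ff.
have sf G e : isfield G -> isfield (fun n x => G (n + e) x).
  move=> [Gl Gb]; split=> [n|x]; first exact: Gl.
  have [q Gq] := Gb x; exists (q - e) => n h; apply: Gq; lia.
have sn G e n x : nstep c i k (fun n x => G (n + e) x) n x = nstep c i k G (n + e) x.
  rewrite /nstep /fadd /compL /compR; congr (_ + _); apply: eq_nsum => t.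
    by have -> : n - t%:Z + e = n + e - t%:Z by lia.
  by have -> : n + k.+1%:Z + t%:Z + e = n + e + k.+1%:Z + t%:Z by lia.
have zf : isfield (fun (n : int) (x : S) => 0 : S).
  by split=> [n e x y|x]; [rewrite scaler0 addr0|exists 0].
have mf N0 : isfield (fun n x => \sum_(j < N0) z j *: F j (n + d j) x).
  elim: N0 => [|N0 IH].
    by congr isfield: zf; apply: modes_ext => n x; rewrite big_ord0.
  have := lin_comb_field (z N0) (sf _ (d N0) (Ff N0)) IH.
  by congr isfield; apply: modes_ext => n x; rewrite big_ord_recr /= addrC.
elim: M => [|M IH].
  have e0 G : (fun (n : int) (x : S) => \sum_(j < 0) G j n x) = (fun n x => 0) :> (int -> S -> S).
    by apply: modes_ext => n x; rewrite big_ord0.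
  rewrite !e0; apply: modes_ext => n x; rewrite /nstep /fadd /compL /compR.
  by rewrite !nsum_eq0 ?addr0 // => t; rewrite (lin0 (cre_lin _ _ _)).
have eS (G : nat -> int -> S -> S) : (fun n x => \sum_(j < M.+1) z j *: G j (n + d j) x) =
   (fun n x => z M *: G M (n + d M) x + \sum_(j < M) z j *: G j (n + d j) x).
  by apply: modes_ext => n x; rewrite big_ord_recr /= addrC.
rewrite (eS F) (eS (fun j => nstep c i k (F j))) (nstep_lin _ _ _ _ (sf _ (d M) (Ff M)) (mf M)) IH.
by apply: modes_ext => n x; rewrite sn.
Qed.

(** How a commutator [D] with the field [F] propagates to a normally ordered
    product with one more factor: the mode also contracts with the new factor,
    which gives the series [(1/k!) (d/dz)^k (n z^(n-1))]. *)
Lemma smode_nstep d c i i' k n F D q x : isfield F -> isfield D ->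
  (forall q x, smode d i n (F q x) = F q (smode c i n x) + D q x) ->
  smode d i n (nstep c i' k F q x) = nstep c i' k F q (smode c i n x) +
    (nstep c i' k D q x +
     (if i == i' then (n%:~R * cbinom (n%:~R - 1) k) *: F (q - n + k.+1%:Z) x else 0)).
Proof.
move=> Ff Df FD; have crl := cre_lin i' k; have anl := ann_lf c i' k.
(* The contractions with the creation and with the annihilation part. For a
   given [n] at most one term of one of them is nonzero. *)
pose Z1 (t : nat) : S := if (i == i') && (n == (t + k).+1%:Z) then
  (cbinom (t + k)%N%:R k * n%:~R) *: F (q - t%:Z) x else 0.
pose Z2 (j : nat) : S := if (i == i') && (n == - j%:Z) then
  (cbinom (- j%:R - 1) k * n%:~R) *: F (q + k.+1%:Z + j%:Z) x else 0.
have Z1f : fin Z1.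
  exists (absz n).+1 => t h; rewrite /Z1; have -> : (n == (t + k).+1%:Z) = false by lia.
  by rewrite andbF.
have Z2f : fin Z2.
  exists (absz n).+1 => t h; rewrite /Z2; have -> : (n == - t%:Z) = false by lia.
  by rewrite andbF.
have hL : smode d i n (compL (cre i' k) F q x) =
  compL (cre i' k) F q (smode c i n x) + (compL (cre i' k) D q x + nsum Z1).
  rewrite {1}/compL (lin_nsum (smode_lin _ _ _)); last exact: (compL_fin q x crl Ff).
  have fD := compL_fin q x crl Df; have fF := compL_fin q (smode c i n x) crl Ff.
  rewrite /compL -(nsumD fD Z1f) -(nsumD fF (finD fD Z1f)); apply: eq_nsum => t /=.
  rewrite addrA -(linD (crl t)) -FD /cre (linZ (smode_lin _ _ _)).
  rewrite -(smodeS d) // smodeC scalerDr (smodeS d) //; congr (_ + _); rewrite /Z1.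
  have -> : (n + Negz (t + k) == 0) = (n == (t + k).+1%:Z) by apply/idP/idP; lia.
  by case: ifP => _; rewrite ?scaler0 // scalerA.
have hR : smode d i n (compR k.+1 (ann c i' k) F q x) =
  compR k.+1 (ann c i' k) F q (smode c i n x) + (compR k.+1 (ann c i' k) D q x + nsum Z2).
  rewrite {1}/compR (lin_nsum (smode_lin _ _ _)); last exact: (compR_fin k.+1 q x anl Ff).
  have fD := compR_fin k.+1 q x anl Df; have fF := compR_fin k.+1 q (smode c i n x) anl Ff.
  rewrite /compR -(nsumD fD Z2f) -(nsumD fF (finD fD Z2f)); apply: eq_nsum => j /=.
  rewrite FD [D _ _ + _]addrC addrA; congr (_ + _).
  rewrite /ann (linZ (smode_lin _ _ _)) smodeC scalerDr (linD (Ff.1 _)); congr (_ + _).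
  rewrite /Z2; have -> : (n + j%:Z == 0) = (n == - j%:Z) by apply/idP/idP; lia.
  by case: ifP => _; rewrite ?scaler0 ?(lin0 (Ff.1 _)) // scalerA (linZ (Ff.1 _)).
rewrite /nstep /fadd (linD (smode_lin _ _ _)) hL hR.
rewrite addrACA; congr (_ + _); rewrite addrACA; congr (_ + _).
rewrite /Z1 /Z2; case: eqP => /= _; last by rewrite !nsum_eq0 ?addr0.
case: n {FD Z1 Z2 Z1f Z2f hL hR} => n.
  rewrite [X in _ + X]nsum_eq0 ?addr0 => [|j]; last first.
    case: eqP => // e; have -> : n = 0%N by lia.
    by rewrite mulr0 scale0r.
  case: (ltnP k n) => kn.
    rewrite (@nsum_one _ _ (n - k.+1)%N) => [|t ht]; last by rewrite ifF //; lia.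
    rewrite ifT; last by lia.
    have -> : (n - k.+1 + k)%N = n.-1 by lia.
    have -> : n.-1%:R = n%:~R - 1 :> C.
      by rewrite -pmulrn -{2}(prednK (leq_ltn_trans (leq0n _) kn)) -natr1 addrK.
    have -> : q - n%:Z + k.+1%:Z = q - (n - k.+1)%N%:Z by lia.
    by rewrite mulrC.
  rewrite nsum_eq0 => [|t]; last by rewrite ifF //; lia.
  case: n kn => [|n] kn; first by rewrite mul0r scale0r.
  have -> : (n.+1%:~R : C) - 1 = n%:R by rewrite -pmulrn -natr1 addrK.
  by rewrite cbinom_nat0 // mulr0 scale0r.
rewrite nsum_eq0 // add0r.
rewrite (@nsum_one _ _ n.+1) => [|j hj]; last by rewrite ifF //; lia.
rewrite ifT; last by lia.
have -> : - n.+1%:R - 1 = (Negz n)%:~R - 1 :> C by rewrite NegzE mulrNz.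
have -> : q - Negz n + k.+1%:Z = q + k.+1%:Z + n.+1%:Z by lia.
by rewrite mulrC.
Qed.

(** The commutator formula, by induction on the state. In the step the
    contraction with the new factor [a^i(-k-1)] is the term [j = k+1] of the
    sum, where the mode [j] contracts with that creation operator in the
    state. *)
Lemma vop_comm v b c i n q x :
  smode (b + c) i n (vop v b c q x) = vop v b c q (smode c i n x) +
  nsum (fun j : nat => cbinom n%:~R j *: vop (smode b i j v) b c (q - n + j%:Z) x).
Proof.
have fT (w : S) q0 x0 : fin (fun j : nat => cbinom n%:~R j *: vop (smode b i j w) b c (q0 - n + j%:Z) x0).
  have [M wM] := (smode_lf b i).2 w; exists M => j /wM ->.
  by rewrite vop_u0 scaler0.
elim/fock_ind: v q x => [|k y z IHy IHz|i' k v IH] q x.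
- rewrite (@nsum_one _ _ 0) => [|j j0].
    rewrite smode_one eqxx cbinom0 scale1r addr0 vop_uZ.
    exact: smode_vop_one.
  by rewrite smode_one (negbTE j0) vop_u0 scaler0.
- rewrite !(vop_lin_u b c q) (linD (smode_lin _ _ _)) (linZ (smode_lin _ _ _)) IHy IHz.
  rewrite scalerDr addrACA; congr (_ + _).
  rewrite (nsumZ _ (fT y q x)) -(nsumD (finZ _ (fT y q x)) (fT z q x)).
  apply: eq_nsum => j; rewrite (smode_lin b i j) (vop_lin_u b c _ x) scalerDr.
  by rewrite !scalerA mulrC.
have [M vM] := (smode_lf b i).2 v.
have [M' vM'] := (smode_lf b i).2 (a i' (Negz k) v).
(* The commutator with the field of [v]. The bound [M] does not depend on the
   vector, so that [D] is again a field. *)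
pose D q x := \sum_(j < M) cbinom n%:~R j *: vop (smode b i j v) b c (q + (- n + j%:Z)) x.
have DE q0 x0 : nsum (fun j : nat => cbinom n%:~R j *: vop (smode b i j v) b c (q0 - n + j%:Z) x0) = D q0 x0.
  rewrite (@nsumE _ _ M) => [|j /vM ->]; last by rewrite vop_u0 scaler0.
  by apply: eq_bigr => j _; rewrite addrA.
have Df : isfield D.
  have TD : D = (fun q0 x0 => smode (b + c) i n (vop v b c q0 x0) - vop v b c q0 (smode c i n x0)).
    by apply: modes_ext => q0 x0; rewrite IH DE addrC addKr.
  rewrite TD; split=> [q0|x0].
    apply: add_linear; first exact: (comp_linear (smode_lin _ _ _) ((vop_field _ _ _).1 _)).
    move=> e y z; rewrite (smode_lin c i n) ((vop_field _ _ _).1 q0) opprD scalerN //.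
  have [P TP] := (vop_field v b c).2 x0; have [Q TQ] := (vop_field v b c).2 (smode c i n x0).
  exists (Num.min P Q) => m; rewrite lt_min => /andP[mP mQ].
  by rewrite TP // TQ // (lin0 (smode_lin _ _ _)) subr0.
rewrite vop_cons (@smode_nstep (b + c) c i i' k n _ D q x (vop_field v b c) Df); last first.
  by move=> q0 x0; rewrite IH DE.
congr (_ + _).
rewrite (nstep_sum c i' k M (fun j => cbinom n%:~R j) (fun j => - n + j%:Z) (F := fun j => vop (smode b i j v) b c)); last by move=> j; apply: vop_field.
rewrite (@eq_nsum _ _ (fun j : nat =>
   cbinom n%:~R j *: vop (a i' (Negz k) (smode b i j v)) b c (q - n + j%:Z) x +
   (if (i == i') && (j == k.+1) then (cbinom n%:~R j * j%:R) *: vop v b c (q - n + j%:Z) x else 0))); last first.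
  move=> j; rewrite -(smodeS b) // smodeC (smodeS b) // (linD (vop_lin_u _ _ _ _)) scalerDr.
  congr (_ + _); have -> : (j%:Z + Negz k == 0) = (j == k.+1) by apply/idP/idP; lia.
  by case: ifP => _; rewrite ?vop_uZ ?vop_u0 ?scaler0 // scalerA.
rewrite nsumD; first 1 last.
- exists M => j /vM ->.
  by rewrite (lin0 (a_lin _ _)) vop_u0 scaler0.
- by exists k.+2 => j h; rewrite ifF //; apply/negbTE; rewrite negb_and; lia.
congr (_ + _).
  rewrite (@nsumE _ _ M) => [|j /vM ->]; last first.
    by rewrite (lin0 (a_lin _ _)) vop_u0 scaler0.
  by apply: eq_bigr => j _; rewrite vop_cons addrA.
case: eqP => /= _; last by rewrite nsum_eq0.
rewrite (@nsum_one _ _ k.+1) => [|j jk]; last by rewrite (negbTE jk).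
by rewrite eqxx [X in X *: _ = _]mulrC [X in _ = X *: _]mulrC cbinomSl [X in X *: _ = _]mulrC.
Qed.

(** Li's operator: [Y_+(d,-z)] applied to the state moves the zero modes of
    the sector by [d]. Each creation operator [a^i(-k-1)] of the state
    contracts with [Y_+(d,-z)] once, and this contraction is the contribution
    of [d_i] to the zero mode in the annihilation part of the corresponding
    factor. *)
Lemma vop_shift u b c d n x :
  nsum (fun j : nat => (-1) ^+ j *: vop (Yp d j u) b c (n + j%:Z) x) =
  vop u b (c + d) n x.
Proof.
have fT (w : S) n0 x0 : fin (fun j : nat => (-1) ^+ j *: vop (Yp d j w) b c (n0 + j%:Z) x0).
  have [M wM] := (Yp_lf d).2 w; exists M => j /wM ->.
  by rewrite vop_u0 scaler0.
elim/fock_ind: u n x => [|k y z IHy IHz|i k v IH] n x.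
- rewrite (@nsum_one _ _ 0) => [|j j0].
    by rewrite Yp0 scale1r addr0 (vop_one_c _ c (c + d)).
  by rewrite Yp_one (negbTE j0) vop_u0 scaler0.
- rewrite (vop_lin_u b (c + d)) -IHy -IHz (nsumZ _ (fT y n x)) -(nsumD (finZ _ (fT y n x)) (fT z n x)).
  apply: eq_nsum => j; rewrite (Yp_lin d j) (vop_lin_u b c _ x) scalerDr.
  by rewrite !scalerA mulrC.
have [M vM] := (Yp_lf d).2 v.
have e1 : vop v b (c + d) = (fun n x => \sum_(j < M) (-1) ^+ j *: vop (Yp d j v) b c (n + j%:Z) x).
  apply: modes_ext => n0 x0; rewrite -IH (@nsumE _ _ M) // => j /vM ->.
  by rewrite vop_u0 scaler0.
have e2 : nstep c i k (vop v b (c + d)) n x =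
   nsum (fun j : nat => (-1) ^+ j *: vop (a i (Negz k) (Yp d j v)) b c (n + j%:Z) x).
  rewrite e1 (nstep_sum c i k M (fun j => (-1) ^+ j) (fun j => j%:Z) (F := fun j => vop (Yp d j v) b c)); last by move=> j; apply: vop_field.
  rewrite (@nsumE _ _ M) => [|j /vM ->]; last first.
    by rewrite (lin0 (a_lin _ _)) vop_u0 scaler0.
  by apply: eq_bigr => j _; rewrite vop_cons.
have e3 : nstep (c + d) i k (vop v b (c + d)) n x =
  nstep c i k (vop v b (c + d)) n x + ((-1) ^+ k * d 0 i) *: vop v b (c + d) (n + k.+1%:Z) x.
  have anf := ann_lf; have Tf := vop_field v b (c + d).
  rewrite /nstep /fadd -addrA; congr (_ + _).
  have f1 := compR_fin k.+1 n x (anf c i k) Tf.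
  (* Only the annihilation operator of index 0 sees the change of zero mode. *)
  pose Z (j : nat) : S := if j == 0%N then ((-1) ^+ k * d 0 i) *: vop v b (c + d) (n + k.+1%:Z) x else 0.
  have -> : ((-1) ^+ k * d 0 i) *: vop v b (c + d) (n + k.+1%:Z) x = nsum Z.
    by rewrite (@nsum_one _ _ 0) // => j j0; rewrite /Z (negbTE j0).
  rewrite /compR -nsumD //; last by exists 1%N => -[|j].
  apply: eq_nsum => -[|j]; rewrite /Z /= ?addr0; last first.
    by congr (vop _ _ _ _ _); rewrite /ann (smodeS (c + d)) // (smodeS c).
  rewrite /ann !smode0 mxE scalerDl scalerDr (linD (Tf.1 _)); congr (_ + _).
  rewrite !(linZ (Tf.1 _)) scalerA; congr (_ * _ *: _).
  by rewrite cbinom_neg add0r cbinom_nat binn mulr1.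
have aq j : Yp d j (a i (Negz k) v) = a i (Negz k) (Yp d j v) -
   (if (k < j)%N then d 0 i *: Yp d (j - k.+1) v else 0).
  by rewrite a_cre_Yp addrK.
(* The contractions of [a^i(-k-1)] with [Y_+(d,-z)]. *)
pose Y (j : nat) : S := if (k < j)%N then ((-1) ^+ j * d 0 i) *: vop (Yp d (j - k.+1) v) b c (n + j%:Z) x else 0.
have Yf : fin Y.
  exists (M + k.+1)%N => j h; rewrite /Y; case: ifP => // kj.
  by rewrite vM ?vop_u0 ?scaler0 //; lia.
have f2 : fin (fun j : nat => (-1) ^+ j *: vop (a i (Negz k) (Yp d j v)) b c (n + j%:Z) x).
  exists M => j /vM ->; by rewrite (lin0 (a_lin _ _)) vop_u0 scaler0.
rewrite vop_cons e3 e2 (@eq_nsum _ _ (fun j : nat =>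
   (-1) ^+ j *: vop (a i (Negz k) (Yp d j v)) b c (n + j%:Z) x + - Y j)); last first.
  move=> j; rewrite aq (linB (vop_lin_u _ _ _ _)) scalerBr; congr (_ - _).
  rewrite /Y; case: ifP => _; last by rewrite vop_u0 scaler0.
  by rewrite vop_uZ scalerA.
rewrite (nsumD f2 (fin_opp Yf)); congr (_ + _).
rewrite -(nsumN Yf) (@nsum_shift _ _ k.+1) //; last by move=> j jk; rewrite /Y ifF //; lia.
rewrite -IH (nsumZ _ (fT v _ x)) (nsumN (f := fun m => Y (k.+1 + m)%N)); last first.
  by have [P YP] := Yf; exists P => m h; apply: YP; lia.
apply: eq_nsum => j; rewrite /Y ifT; last by lia.
rewrite addKn -scaleNr scalerA; have -> : n + (k.+1 + j)%N%:Z = n + k.+1%:Z + j%:Z by lia.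
by congr (_ *: _); rewrite exprD exprS; ring.
Qed.
(** The coefficients of the powers [(z1 - z2)^(-j-k-1)] expanded in [z2], as
    they arise when the annihilation part of a derivative of a current passes
    an operator on its right. *)
Lemma cbinom_ann (j m k : nat) :
  cbinom (- (j + m)%N%:R - 1 : C) k * cbinom (j + m)%N%:R j =
  cbinom (- j%:R - 1) k * ((-1) ^+ m * cbinom (- (j + k.+1)%N%:Z)%:~R m).
Proof.
have -> : (- (j + k.+1)%N%:Z)%:~R = - (j + k)%N%:R - 1 :> C.
  by rewrite mulrNz -pmulrn addnS -natr1 opprD.
rewrite !cbinom_neg -!natrD [X in _ = _ * X]mulrA -exprMn mulrNN mulr1 expr1n mul1r.
rewrite -[LHS]mulrA -[RHS]mulrA; congr (_ * _).
have := cbinomM ((j + m + k)%N%:R : C) j k.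
rewrite {3}natrD addrK => <-; rewrite mulrC; congr (_ * _).
rewrite !cbinom_nat; congr (_%:R).
rewrite -[RHS]bin_sub; last by lia.
by congr ('C(_, _)); lia.
Qed.

(** The same for the creation part and an operator on its left; now the powers
    are expanded in [z1]. *)
Lemma cbinom_cre (t k j : nat) :
  - (cbinom (t + k)%N%:R k * cbinom (Negz (t + k))%:~R j) =
  (-1) ^+ (j + k.+1) * cbinom (- j%:R - 1) k *
    ((-1) ^+ t * cbinom (- (j + k.+1)%N%:Z)%:~R t) :> C.
Proof.
have -> : (- (j + k.+1)%N%:Z)%:~R = - (j + k)%N%:R - 1 :> C.
  by rewrite mulrNz -pmulrn addnS -natr1 opprD.
have -> : (Negz (t + k))%:~R = - (t + k)%N%:R - 1 :> C.
  by rewrite NegzE mulrNz -pmulrn -natr1 opprD.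
rewrite !cbinom_neg -!natrD.
have e1 := cbinomM ((t + k + j)%N%:R : C) t k.
have e2 := cbinomM ((j + k + t)%N%:R : C) j k.
have f : (t + k + j)%N%:R - k%:R = (j + t)%N%:R :> C.
  by rewrite -addnA addnCA addnC natrD addrK addnC.
have f' : (j + k + t)%N%:R - k%:R = (j + t)%N%:R :> C.
  by rewrite addnAC natrD addrK.
have g : cbinom ((t + k + j)%N%:R : C) j = cbinom (t + k + j)%N%:R (t + k).
  by rewrite !cbinom_nat -[in RHS]bin_sub ?leq_addr // addKn.
have g' : cbinom ((j + k + t)%N%:R : C) t = cbinom (j + k + t)%N%:R (j + k).
  by rewrite !cbinom_nat -[in RHS]bin_sub ?leq_addr // addKn.
have h : cbinom ((j + t)%N%:R : C) t = cbinom (j + t)%N%:R j.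
  by rewrite !cbinom_nat -[in RHS]bin_sub ?leq_addr // addKn.
rewrite g g' [cbinom (t + k)%N%:R k * _]mulrCA [cbinom (t + k)%N%:R k * _]mulrC e1.
rewrite [LHS](_ : _ = - ((-1) ^+ j * (cbinom (t + k + j)%N%:R k * cbinom (j + t)%N%:R t))); last by rewrite f.
have -> : (-1) ^+ (j + k.+1) * ((-1) ^+ k * cbinom (j + k)%N%:R k) *
  ((-1) ^+ t * ((-1) ^+ t * cbinom (j + k + t)%N%:R (j + k))) =
  (-1) ^+ (j + k.+1) * (-1) ^+ k * ((-1) ^+ t * (-1) ^+ t) *
   (cbinom (j + k + t)%N%:R (j + k) * cbinom (j + k)%N%:R k) :> C by ring.
rewrite e2 f' -h -exprMn mulrNN mulr1 expr1n mulr1 -exprD.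
have -> : ((j + k.+1 + k) = (j + (k + k)).+1)%N by lia.
rewrite exprS exprD -[X in _ * (_ * X)]signr_odd addnn odd_double expr0 mulr1.
have -> : (t + k + j = j + k + t)%N by lia.
by rewrite mulN1r mulNr.
Qed.

(** * Recursions for the two products and the iterate *)

Section Jacobi.
Variables bu bv bw : vec.
Implicit Types (w : S) (p q r : int).

(** The two products and the iterate, in the variables (z1, z2), (z2, z1) and
    (z2, z0) respectively. The charge of the intermediate vector determines
    the sector on which each outer operator acts. *)
Definition prod12 u v w p q : S := vop u bu (bv + bw) p (vop v bv bw q w).
Definition prod21 u v w q p : S := vop v bv (bu + bw) q (vop u bu bw p w).
Definition iterate u v w (s r : int) : S := vop (vop u bu bv r v) (bu + bv) bw s w.

Definition jacobi_at u v w (e0 e1 e2 : int) : Prop :=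
  Theta (-1) (dot bu bv) (prod12 u v w) e0 e1 e2 -
  (-1) ^ (1 + e0) *: Theta (-1) (dot bu bv) (prod21 u v w) e0 e2 e1 =
  Theta 1 (dot bu bw) (iterate u v w) e1 e2 e0.

Lemma comp_biser F G w : isfield F -> isfield G -> biser (fun p q => F p (G q w)).
Proof.
move=> [Fl Fb] [Gl Gb]; split; last by move=> q; apply: Fb.
by have [q0 Gq] := Gb w; exists q0 => p q /Gq ->; apply: lin0.
Qed.

Lemma prod12_biser u v w : biser (prod12 u v w).
Proof. by apply: comp_biser; apply: vop_field. Qed.

Lemma prod21_biser u v w : biser (prod21 u v w).
Proof. by apply: comp_biser; apply: vop_field. Qed.

Lemma iterate_biser u v w : biser (iterate u v w).
Proof.
split; last by move=> r; apply: (vop_field _ _ _).2.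
have [r0 Tr] := (vop_field u bu bv).2 v; exists r0 => s r /Tr h.
by rewrite /iterate h vop_u0.
Qed.

Lemma vop_cre u b c q i k x : vop u b c q (a i (Negz k) x) =
  a i (Negz k) (vop u b c q x) -
  nsum (fun j : nat => cbinom (Negz k)%:~R j *: vop (smode b i j u) b c (q - Negz k + j%:Z) x).
Proof. by rewrite -(smodeS c) // -(smodeS (b + c)) // vop_comm addrK. Qed.

Lemma biser_unif_family (F : nat -> int -> int -> S) (M : nat) :
  (forall j, biser (F j)) ->
  exists q0 : int, forall j p q, (j < M)%N -> q < q0 -> F j p q = 0.
Proof.
move=> Fb; elim: M => [|M [q0 IH]]; first by exists 0 => j p q; rewrite ltn0.
have [[q1 F1] _] := Fb M; exists (Num.min q0 q1) => j p q.
rewrite lt_min ltnS leq_eqVlt => /orP[/eqP->|jM] /andP[h0 h1]; first exact: F1.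
exact: IH.
Qed.

(** The annihilation part of the new factor has to pass the operator of [v];
    by the commutator formula this produces modes applied to [v], with
    coefficients that sum up to powers of [z1 - z2]. *)
Lemma prod12_u i k u v w p q : prod12 (a i (Negz k) u) v w p q =
  nsum (fun t : nat => cre i k t (prod12 u v w (p - t%:Z) q)) +
  (nsum (fun j : nat => prod12 u v (ann bw i k j w) (p + (k.+1%:Z + j%:Z)) q) +
   nsum (fun j : nat => cbinom (- j%:R - 1) k *:
     binmul (-1) (- (j + k.+1)%N%:Z)%:~R (- (j + k.+1)%N%:Z) (prod12 u (smode bv i j v) w) p q)).
Proof.
have [M vM] := (smode_lf bv i).2 v.
have S0 j p' q' : (M <= j)%N -> prod12 u (smode bv i j v) w p' q' = 0.
  by move=> /vM h; rewrite /prod12 h vop_u0 vop_x0.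
(* [j] is the index of the annihilation part, [j'] that of the commutator
   formula; the powers of [z1 - z2] appear after the substitution [j = j' + m]. *)
pose G (j j' : nat) : S := (cbinom (- j%:R - 1) k * cbinom j%:R j') *:
  prod12 u (smode bv i j' v) w (p + k.+1%:Z + j%:Z) (q - j%:Z + j'%:Z).
have Gb : boxed G.
  have [q0 Fq] := biser_unif_family M (fun j => prod12_biser u (smode bv i j v) w).
  exists (M + (absz (q + M%:Z - q0)%R).+1)%N => j j' h; rewrite /G.
  case: (ltnP j' M) => jM; last by rewrite S0 ?scaler0.
  rewrite Fq ?scaler0 //; case/orP: h; lia.
rewrite {1}/prod12 vop_cons /nstep /fadd; congr (_ + _); rewrite /compR.
have fw : fin (fun j : nat => prod12 u v (ann bw i k j w) (p + (k.+1%:Z + j%:Z)) q).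
  have [P wP] := (ann_lf bw i k).2 w; exists P => j /wP h.
  by rewrite /prod12 h vop_x0 vop_x0.
have -> : nsum (fun j : nat => cbinom (- j%:R - 1) k *:
     binmul (-1) (- (j + k.+1)%N%:Z)%:~R (- (j + k.+1)%N%:Z) (prod12 u (smode bv i j v) w) p q) =
  nsum (fun j => nsum (G j)).
  rewrite nsum_exchange //; apply: eq_nsum => j'.
  rewrite (@nsum_shift _ (G^~ j') j'); last 2 first.
  - by move=> j jj; rewrite /G cbinom_nat0 // mulr0 scale0r.
  - exact: (boxed_finr j' Gb).
  rewrite nsumZ; last exact/biser_fin/prod12_biser.
  apply: eq_nsum => m; rewrite scalerA /G cbinom_ann.
  have -> : p - - (j' + k.+1)%N%:Z + m%:Z = p + k.+1%:Z + (j' + m)%N%:Z by lia.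
  by have -> : q - m%:Z = q - (j' + m)%N%:Z + j'%:Z by lia.
rewrite -(nsumD fw (boxed_nsum Gb)); apply: eq_nsum => j.
rewrite /ann vop_comm scalerDr (linD (vop_lin _ _ _ _)); congr (_ + _).
  by rewrite /prod12 !vop_xZ addrA.
rewrite vop_xZ (lin_nsum (vop_lin _ _ _ _)); last first.
  exists M => j' /vM h; by rewrite h vop_u0 scaler0.
rewrite nsumZ; last first.
  exists M => j' /vM /= h; by rewrite h vop_u0 scaler0 vop_x0.
by apply: eq_nsum => j'; rewrite /G /= vop_xZ scalerA.
Qed.

(** Here the creation part has to pass the operator of [v] standing on its
    left. *)
Lemma prod21_u i k u v w q p : prod21 (a i (Negz k) u) v w q p =
  nsum (fun t : nat => cre i k t (prod21 u v w q (p - t%:Z))) +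
  (nsum (fun j : nat => prod21 u v (ann bw i k j w) q (p + (k.+1%:Z + j%:Z))) +
   nsum (fun j : nat => ((-1) ^+ (j + k.+1) * cbinom (- j%:R - 1) k) *:
     binmul (-1) (- (j + k.+1)%N%:Z)%:~R (- (j + k.+1)%N%:Z) (prod21 u (smode bv i j v) w) q p)).
Proof.
have [M vM] := (smode_lf bv i).2 v.
have S0 j p' q' : (M <= j)%N -> prod21 u (smode bv i j v) w p' q' = 0.
  by move=> /vM h; rewrite /prod21 h vop_u0.
pose G (t j : nat) : S := (- (cbinom (t + k)%N%:R k * cbinom (Negz (t + k))%:~R j)) *:
  prod21 u (smode bv i j v) w (q - Negz (t + k) + j%:Z) (p - t%:Z).
have Gb : boxed G.
  have [q0 Fq] := biser_unif_family M (fun j => prod21_biser u (smode bv i j v) w).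
  exists (M + (absz (p + M%:Z - q0)%R).+1)%N => t j h; rewrite /G.
  case: (ltnP j M) => jM; last by rewrite S0 ?scaler0.
  rewrite Fq ?scaler0 //; case/orP: h; lia.
have crl := cre_lin i k; have Tf := vop_field u bu bw.
have f1 := compL_fin p w crl Tf; have f2 := compR_fin k.+1 p w (ann_lf bw i k) Tf.
have f3 : fin (fun t : nat => cre i k t (prod21 u v w q (p - t%:Z))).
  have [P fP] := fin_lower p (Tf.2 w); exists P => t /fP h.
  by rewrite /prod21 h vop_x0 (lin0 (crl _)).
rewrite {1}/prod21 vop_cons /nstep /fadd (linD (vop_lin _ _ _ _)) /compR /compL.
rewrite (lin_nsum (vop_lin _ _ _ _) f1) (lin_nsum (vop_lin _ _ _ _) f2).
rewrite [X in _ = _ + X]addrC [RHS]addrA; congr (_ + _); last first.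
  by apply: eq_nsum => j /=; rewrite addrA.
have -> : nsum (fun j : nat => ((-1) ^+ (j + k.+1) * cbinom (- j%:R - 1) k) *:
     binmul (-1) (- (j + k.+1)%N%:Z)%:~R (- (j + k.+1)%N%:Z) (prod21 u (smode bv i j v) w) q p) =
  nsum (fun t => nsum (G t)).
  rewrite nsum_exchange //; apply: eq_nsum => j.
  rewrite nsumZ; last exact/biser_fin/prod21_biser.
  apply: eq_nsum => t; rewrite scalerA /G cbinom_cre.
  by have -> : q - - (j + k.+1)%N%:Z + t%:Z = q - Negz (t + k) + j%:Z by lia.
rewrite -(nsumD f3 (boxed_nsum Gb)); apply: eq_nsum => t /=.
rewrite /cre vop_xZ vop_cre scalerBr; congr (_ + _).
have f4 : fin (fun j : nat => cbinom (Negz (t + k))%:~R j *: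
   vop (smode bv i j v) bv (bu + bw) (q - Negz (t + k) + j%:Z) (vop u bu bw (p - t%:Z) w)).
  exists M => j /vM h; by rewrite h vop_u0 scaler0.
rewrite nsumZ // nsumN; last exact: finZ.
by apply: eq_nsum => j; rewrite /G scalerA scaleNr.
Qed.

(** The creation part of the new factor at [z0] becomes, in the outer
    operator, the factor at [z2 + z0] expanded around [z2]: its own creation
    part in front and its annihilation part on [w]. The annihilation part at
    [z0] acts on [v] alone. *)
Lemma iterate_u i k u v w (s r : int) : iterate (a i (Negz k) u) v w s r =
  nsum (fun t : nat => cre i k t (binmul 1 t%:~R t%:Z (iterate u v w) s r)) +
  (nsum (fun j : nat => binmul 1 (- (j + k.+1)%N%:Z)%:~R (- (j + k.+1)%N%:Z)
       (iterate u v (ann bw i k j w)) s r) +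
   nsum (fun j : nat => cbinom (- j%:R - 1) k *:
       iterate u (smode bv i j v) w s (r + (k.+1%:Z + j%:Z)))).
Proof.
have crl := cre_lin i k; have Tf := vop_field u bu bv.
have f1 := compL_fin r v crl Tf; have f2 := compR_fin k.+1 r v (ann_lf bv i k) Tf.
rewrite {1}/iterate vop_cons /nstep /fadd (linD (vop_lin_u _ _ _ _)) /compR /compL.
rewrite (lin_nsum (vop_lin_u _ _ _ _) f1) (lin_nsum (vop_lin_u _ _ _ _) f2).
rewrite [RHS]addrA; congr (_ + _); last first.
  apply: eq_nsum => j /=; rewrite /iterate /ann vop_xZ vop_uZ.
  by rewrite addrA.
have [M rM] := fin_lower r (Tf.2 v).
have X0 (t : nat) w' (s' : int) : (M <= t)%N -> iterate u v w' s' (r - t%:Z) = 0.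
  by move=> /rM h; rewrite /iterate h vop_u0.
pose A (t' t : nat) : S := cbinom (t + k)%N%:R k *: cre i (t + k) t' (iterate u v w (s - t'%:Z) (r - t%:Z)).
have Ab : boxed A.
  have [s0 Xs] := biser_unif r M (iterate_biser u v w).
  exists (M + (absz (s - s0)%R).+1)%N => t' t h; rewrite /A.
  case: (ltnP t M) => tM; last by rewrite X0 // (lin0 (cre_lin _ _ _)) scaler0.
  rewrite Xs ?(lin0 (cre_lin _ _ _)) ?scaler0 //; case/orP: h; lia.
pose B (t j : nat) : S := cbinom (t + k)%N%:R k *:
  iterate u v (ann bw i (t + k) j w) (s + (t + k).+1%:Z + j%:Z) (r - t%:Z).
have [P wP] := (smode_lf bw i).2 w.
have Bb : boxed B.
  exists (M + P)%N => t j h; rewrite /B.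
  case: (ltnP t M) => tM; last by rewrite X0 // scaler0.
  rewrite /iterate /ann wP; last by case/orP: h; lia.
  by rewrite scaler0 vop_x0 scaler0.
transitivity (nsum (fun t => nsum (A^~ t)) + nsum (fun t => nsum (B t))).
  rewrite -(nsumD (boxed_nsum (boxedC Ab)) (boxed_nsum Bb)); apply: eq_nsum => t /=.
  rewrite {1}/cre vop_uZ vop_cons /nstep /fadd scalerDr /compL /compR.
  have Tf' := vop_field (vop u bu bv (r - t%:Z) v) (bu + bv) bw.
  rewrite (nsumZ _ (compL_fin s w (cre_lin i (t + k)) Tf')).
  by rewrite (nsumZ _ (compR_fin (t + k).+1 s w (ann_lf bw i (t + k)) Tf')).
congr (_ + _).
  rewrite -(nsum_exchange Ab) nsum_diagonal //; apply: eq_nsum => n.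
  rewrite /binmul (@nsumE _ _ n.+1) => [|m nm]; last first.
    by rewrite -pmulrn cbinom_nat0 // mulr0 scale0r.
  rewrite (lin_sum (crl n)); apply: eq_bigr => t _.
  have tn : (t <= n)%N by rewrite -ltnS.
  rewrite (linZ (crl n)) /A /cre !scalerA expr1n mul1r.
  have -> : (n - t + (t + k) = n + k)%N by lia.
  have -> : s - (n - t)%N%:Z = s - n%:Z + t%:Z by lia.
  congr (_ *: _); have := cbinomM ((n + k)%N%:R : C) t k.
  by rewrite mulrC => ->; rewrite natrD addrK mulrC -pmulrn -natrD.
rewrite nsum_exchange //; apply: eq_nsum => j; apply: eq_nsum => t.
rewrite /B /iterate /ann !vop_xZ !scalerA.
have -> : s - - (j + k.+1)%N%:Z + t%:Z = s + (t + k).+1%:Z + j%:Z by lia.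
congr (_ *: _); rewrite mulrC cbinomM expr1n mul1r mulrC; congr (cbinom _ _ * _).
by rewrite mulrNz -pmulrn addnS -natr1 natrD; ring.
Qed.

Lemma ann_small w i k : exists M, forall j, (M <= j)%N -> ann bw i k j w = 0.
Proof. exact: (ann_lf bw i k).2. Qed.

Lemma prod12_w0 u v p q : prod12 u v 0 p q = 0.
Proof. by rewrite /prod12 !vop_x0. Qed.

Lemma prod21_w0 u v p q : prod21 u v 0 p q = 0.
Proof. by rewrite /prod21 !vop_x0. Qed.

Lemma iterate_w0 u v p q : iterate u v 0 p q = 0.
Proof. by rewrite /iterate !vop_x0. Qed.

Lemma prod12_v0 u w p q : prod12 u 0 w p q = 0.
Proof. by rewrite /prod12 vop_u0 vop_x0. Qed.

Lemma prod21_v0 u w p q : prod21 u 0 w p q = 0.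
Proof. by rewrite /prod21 vop_u0. Qed.

Lemma iterate_v0 u w p q : iterate u 0 w p q = 0.
Proof. by rewrite /iterate vop_x0 vop_u0. Qed.

Lemma signz_neq0 : (-1 : C) != 0.
Proof. by rewrite oppr_eq0 oner_eq0. Qed.

Lemma binmul0 z (y : C) d F p q : (forall p q, F p q = 0) -> binmul z y d F p q = 0 :> S.
Proof. by move=> F0; apply: nsum_eq0 => m; rewrite F0 scaler0. Qed.

Lemma nsumB (z : C) (f g : nat -> S) : fin f -> fin g ->
  nsum f - z *: nsum g = nsum (fun m => f m - z *: g m).
Proof.
move=> ff fg; rewrite (nsumZ _ fg) nsumN; last exact: finZ.
by rewrite -nsumD //; apply/fin_opp/finZ.
Qed.

Lemma signzD (e : int) (n : nat) : (-1) ^ (1 + (e + n%:Z)) = (-1) ^ (1 + e) * (-1) ^+ n :> C.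
Proof. by rewrite addrA expfzDr ?signz_neq0. Qed.

Lemma Theta_add_nsum2 z k (F : int -> int -> S) (G H : nat -> int -> int -> S)
    (M P : nat) (e0 e1 e2 : int) : biser F ->
  (forall j, biser (G j)) -> (forall j p q, (M <= j)%N -> G j p q = 0) ->
  (forall j, biser (H j)) -> (forall j p q, (P <= j)%N -> H j p q = 0) ->
  Theta z k (fun p q => F p q + (nsum (fun j => G j p q) + nsum (fun j => H j p q))) e0 e1 e2 =
  Theta z k F e0 e1 e2 +
    (nsum (fun j => Theta z k (G j) e0 e1 e2) + nsum (fun j => Theta z k (H j) e0 e1 e2)).
Proof.
move=> Fb Gb G0 Hb H0; have sG := biser_fsum Gb G0; have sH := biser_fsum Hb H0.
rewrite (Theta_add _ _ _ _ _ Fb) ?(Theta_add _ _ _ _ _ sG sH).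
  by rewrite (Theta_fsum _ _ _ _ _ Gb G0) (Theta_fsum _ _ _ _ _ Hb H0).
have := biser_lin 1 sG sH.
by congr biser; apply: funext => p; apply: funext => q; rewrite scale1r.
Qed.

(** The three recursions have the same shape: a sum over creation operators, a
    sum over modes applied to [w] and a sum over modes applied to [v].
    Multiplying by an integral power of a binomial only shifts one exponent,
    so the identities already known match the sums term by term. *)
Lemma jacobi_u i k u : (forall v w e0 e1 e2, jacobi_at u v w e0 e1 e2) ->
  forall v w e0 e1 e2, jacobi_at (a i (Negz k) u) v w e0 e1 e2.
Proof.
move=> J v w e0 e1 e2; rewrite /jacobi_at.
have crl := cre_lin i k; have B1 := prod12_biser; have B2 := prod21_biser; have B3 := iterate_biser.
have [P wP] := ann_small w i k; have [M vM] := (smode_lf bv i).2 v.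
(* The exponent of the binomial that accompanies the mode [j]. *)
pose y (j : nat) : int := - (j + k.+1)%N%:Z.
have unif1 : unif_biser (fun t : nat => binmul 1 t%:~R t%:Z (iterate u v w)).
  have [[r0 Xr] Xs] := B3 u v w; split.
    exists r0 => t s r h; apply: nsum_eq0 => m; rewrite Xr ?scaler0 //; lia.
  move=> r; pose Q := (absz (r - r0)%R).+1.
  have [s0 Xs0] := biser_unif r Q (B3 u v w).
  exists (s0 - Q%:Z) => t s h; apply: nsum_eq0 => m; case: (ltnP m Q) => mQ.
    by rewrite Xs0 ?scaler0 //; lia.
  by rewrite Xr ?scaler0 //; move: mQ; rewrite /Q; lia.
have L1 : Theta (-1) (dot bu bv) (prod12 (a i (Negz k) u) v w) e0 e1 e2 =
   nsum (fun t : nat => cre i k t (Theta (-1) (dot bu bv) (prod12 u v w) e0 (e1 - t%:Z) e2)) +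
   (nsum (fun j : nat => Theta (-1) (dot bu bv) (prod12 u v (ann bw i k j w)) e0 (e1 + (k.+1%:Z + j%:Z)) e2) +
    nsum (fun j : nat => cbinom (- j%:R - 1) k *:
      Theta (-1) (dot bu bv) (prod12 u (smode bv i j v) w) (e0 - y j) e1 e2)).
  rewrite (eq_Theta _ _ _ _ _ (prod12_u i k u v w)).
  have b1 := biser_opser crl (unif_biser_shift (B1 u v w)).
  pose F2 (j : nat) p q := prod12 u v (ann bw i k j w) (p + (k.+1%:Z + j%:Z)) q.
  have F2b j : biser (F2 j) by apply: biser_shift1.
  have F20 j p q : (P <= j)%N -> F2 j p q = 0 by move=> /wP h; rewrite /F2 h prod12_w0.
  pose F3 (j : nat) p q := cbinom (- j%:R - 1) k *: binmul (-1) (y j)%:~R (y j) (prod12 u (smode bv i j v) w) p q.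
  have F3b j : biser (F3 j) by apply/biser_op; [exact: scaler_linear|exact: biser_binmul].
  have F30 j p q : (M <= j)%N -> F3 j p q = 0.
    by move=> /vM h; rewrite /F3 h binmul0 ?scaler0 // => *; exact: prod12_v0.
  rewrite (Theta_add_nsum2 _ _ _ _ _ b1 F2b F20 F3b F30).
  rewrite (Theta_opser1 _ _ _ _ _ crl (B1 u v w)); congr (_ + (_ + _)); apply: eq_nsum => j.
    exact: Theta_shift1.
  rewrite Theta_scale; last exact: biser_binmul.
  by rewrite Theta_binmulZ.
have L2 : Theta (-1) (dot bu bv) (prod21 (a i (Negz k) u) v w) e0 e2 e1 =
   nsum (fun t : nat => cre i k t (Theta (-1) (dot bu bv) (prod21 u v w) e0 e2 (e1 - t%:Z))) +
   (nsum (fun j : nat => Theta (-1) (dot bu bv) (prod21 u v (ann bw i k j w)) e0 e2 (e1 + (k.+1%:Z + j%:Z))) +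
    nsum (fun j : nat => ((-1) ^+ (j + k.+1) * cbinom (- j%:R - 1) k) *:
      Theta (-1) (dot bu bv) (prod21 u (smode bv i j v) w) (e0 - y j) e2 e1)).
  rewrite (eq_Theta _ _ _ _ _ (fun q p => prod21_u i k u v w q p)).
  have b1 := biser_opser2 crl (B2 u v w).
  pose F2 (j : nat) q p := prod21 u v (ann bw i k j w) q (p + (k.+1%:Z + j%:Z)).
  have F2b j : biser (F2 j) by apply: biser_shift2.
  have F20 j p q : (P <= j)%N -> F2 j p q = 0 by move=> /wP h; rewrite /F2 h prod21_w0.
  pose F3 (j : nat) p q := ((-1) ^+ (j + k.+1) * cbinom (- j%:R - 1) k) *:
    binmul (-1) (y j)%:~R (y j) (prod21 u (smode bv i j v) w) p q.
  have F3b j : biser (F3 j) by apply/biser_op; [exact: scaler_linear|exact: biser_binmul].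
  have F30 j p q : (M <= j)%N -> F3 j p q = 0.
    by move=> /vM h; rewrite /F3 h binmul0 ?scaler0 // => *; exact: prod21_v0.
  rewrite (Theta_add_nsum2 _ _ _ _ _ b1 F2b F20 F3b F30).
  rewrite (Theta_opser2 _ _ _ _ _ crl (B2 u v w)); congr (_ + (_ + _)); apply: eq_nsum => j.
    exact: Theta_shift2.
  rewrite Theta_scale; last exact: biser_binmul.
  by rewrite Theta_binmulZ.
have L3 : Theta 1 (dot bu bw) (iterate (a i (Negz k) u) v w) e1 e2 e0 =
   nsum (fun t : nat => cre i k t (Theta 1 (dot bu bw) (iterate u v w) (e1 - t%:Z) e2 e0)) +
   (nsum (fun j : nat => Theta 1 (dot bu bw) (iterate u v (ann bw i k j w)) (e1 - y j) e2 e0) +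
    nsum (fun j : nat => cbinom (- j%:R - 1) k *:
      Theta 1 (dot bu bw) (iterate u (smode bv i j v) w) e1 e2 (e0 + (k.+1%:Z + j%:Z)))).
  rewrite (eq_Theta _ _ _ _ _ (iterate_u i k u v w)).
  have b1 := biser_opser crl unif1.
  pose F2 (j : nat) := binmul 1 (y j)%:~R (y j) (iterate u v (ann bw i k j w)).
  have F2b j : biser (F2 j) by apply: biser_binmul.
  have F20 j p q : (P <= j)%N -> F2 j p q = 0.
    by move=> /wP h; rewrite /F2 h binmul0 // => *; exact: iterate_w0.
  pose F3 (j : nat) s r := cbinom (- j%:R - 1) k *: iterate u (smode bv i j v) w s (r + (k.+1%:Z + j%:Z)).
  have F3b j : biser (F3 j) by apply/biser_op; [exact: scaler_linear|exact: biser_shift2].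
  have F30 j p q : (M <= j)%N -> F3 j p q = 0.
    by move=> /vM h; rewrite /F3 h iterate_v0 scaler0.
  rewrite (Theta_add_nsum2 _ _ _ _ _ b1 F2b F20 F3b F30).
  rewrite (Theta_opser _ _ _ _ _ crl unif1); congr (_ + (_ + _)); apply: eq_nsum => j.
  - by rewrite Theta_binmulZ.
  - by rewrite Theta_binmulZ.
  - rewrite Theta_scale; last exact: biser_shift2.
    by congr (_ *: _); apply: Theta_shift2.
have yE (e : int) j : e - y j = e + (k.+1%:Z + j%:Z) by rewrite /y; lia.
have swap (A B A' B' A'' B'' : S) z : A - z *: A' = A'' -> B - z *: B' = B'' ->
  (A + B) - z *: (A' + B') = A'' + B''.
  by move=> <- <-; rewrite scalerDr opprD addrACA.
rewrite L1 L2 L3; apply: (swap); last apply: (swap).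
- rewrite nsumB.
  + apply: eq_nsum => t; rewrite -(linZ (crl t)) -(linB (crl t)); congr (cre i k t _).
    exact: J.
  + have [Q fQ] := Theta_fin1 (-1) (dot bu bv) e0 e1 e2 (B1 u v w).
    by exists Q => t /fQ ->; apply: lin0.
  + have [Q fQ] := Theta_fin2 (-1) (dot bu bv) e0 e2 e1 (B2 u v w).
    by exists Q => t /fQ ->; apply: lin0.
- rewrite nsumB.
  + by apply: eq_nsum => j; rewrite yE; apply: J.
  + by exists P => j /wP ->; apply: nsum_eq0 => m; rewrite prod12_w0 scaler0.
  + by exists P => j /wP ->; apply: nsum_eq0 => m; rewrite prod21_w0 scaler0.
- rewrite nsumB.
  + apply: eq_nsum => j; rewrite -J yE scalerBr; congr (_ - _).
    rewrite !scalerA; congr (_ *: _).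
    have -> : k.+1%:Z + j%:Z = (j + k.+1)%N%:Z by lia.
    by rewrite signzD; ring.
  + exists M => j /vM ->; rewrite [Theta _ _ _ _ _ _]nsum_eq0 ?scaler0 // => m.
    by rewrite prod12_v0 scaler0.
  + exists M => j /vM ->; rewrite [Theta _ _ _ _ _ _]nsum_eq0 ?scaler0 // => m.
    by rewrite prod21_v0 scaler0.
Qed.
Lemma vop_one_cre b c q i k x : vop one b c q (a i (Negz k) x) =
  a i (Negz k) (vop one b c q x) - b 0 i *: vop one b c (q + k.+1%:Z) x.
Proof. by rewrite vop_one_comm // NegzE opprK addrK. Qed.

Lemma cbinom_signed (t k : nat) :
  (-1) ^+ t * cbinom (- k.+1%:Z)%:~R t = cbinom (t + k)%N%:R k :> C.
Proof.
by rewrite cbinom_sym mulrNz -pmulrn -natr1 opprD.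
Qed.

(** With [u] reduced to the vacuum, the only contractions left are those with
    the exponential of charge [bu]. *)
Lemma prod12_v i k v w p q : prod12 one (a i (Negz k) v) w p q =
  nsum (fun t : nat => cre i k t (prod12 one v w p (q - t%:Z))) +
  (nsum (fun j : nat => prod12 one v (ann bw i k j w) p (q + (k.+1%:Z + j%:Z))) +
   (- bu 0 i) *: binmul (-1) (- k.+1%:Z)%:~R (- k.+1%:Z) (prod12 one v w) p q).
Proof.
have crl := cre_lin i k; have Tf := vop_field v bv bw.
have f1 := compL_fin q w crl Tf; have f2 := compR_fin k.+1 q w (ann_lf bw i k) Tf.
rewrite {1}/prod12 vop_cons /nstep /fadd (linD (vop_lin _ _ _ _)) /compR /compL.
rewrite (lin_nsum (vop_lin _ _ _ _) f1) (lin_nsum (vop_lin _ _ _ _) f2).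
rewrite [X in _ = _ + X]addrC [RHS]addrA; congr (_ + _); last first.
  by apply: eq_nsum => j /=; rewrite addrA.
have f3 : fin (fun t : nat => cre i k t (prod12 one v w p (q - t%:Z))).
  have [P fP] := fin_lower q (Tf.2 w); exists P => t /fP h.
  by rewrite /prod12 h vop_x0 (lin0 (crl _)).
have f4 : fin (fun m : nat => ((-1) ^+ m * cbinom (- k.+1%:Z)%:~R m) *:
   prod12 one v w (p - - k.+1%:Z + m%:Z) (q - m%:Z)) by exact/biser_fin/prod12_biser.
rewrite /binmul (nsumZ _ f4) -(nsumD f3 (finZ _ f4)); apply: eq_nsum => t /=.
rewrite /cre vop_xZ vop_one_cre scalerBr; congr (_ + _).
have -> : p - - k.+1%:Z + t%:Z = p + (t + k).+1%:Z by lia.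
by rewrite cbinom_signed !scalerA mulNr scaleNr mulrC.
Qed.

Lemma prod21_v i k v w q p : prod21 one (a i (Negz k) v) w q p =
  nsum (fun t : nat => cre i k t (prod21 one v w (q - t%:Z) p)) +
  (nsum (fun j : nat => prod21 one v (ann bw i k j w) (q + (k.+1%:Z + j%:Z)) p) +
   ((-1) ^+ k * bu 0 i) *: binmul (-1) (- k.+1%:Z)%:~R (- k.+1%:Z) (prod21 one v w) q p).
Proof.
have f4 : fin (fun m : nat => ((-1) ^+ m * cbinom (- k.+1%:Z)%:~R m) *:
   prod21 one v w (q - - k.+1%:Z + m%:Z) (p - m%:Z)) by exact/biser_fin/prod21_biser.
have f3 : fin (fun j : nat => prod21 one v (ann bw i k j w) (q + (k.+1%:Z + j%:Z)) p).
  by have [P wP] := ann_small w i k; exists P => j /wP ->; apply: prod21_w0.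
rewrite {1}/prod21 vop_cons /nstep /fadd; congr (_ + _).
rewrite /compR /binmul (nsumZ _ f4) -(nsumD f3 (finZ _ f4)); apply: eq_nsum => j.
rewrite /ann smode_vop_one scalerDr (linD (vop_lin _ _ _ _)); congr (_ + _).
  by rewrite /prod21 !vop_xZ addrA.
rewrite !vop_xZ cbinom_signed !scalerA.
have -> : q - - k.+1%:Z + j%:Z = q + k.+1%:Z + j%:Z by lia.
by congr (_ *: _); rewrite cbinom_neg -natrD; ring.
Qed.

Lemma iterate_v i k v w (s r : int) : iterate one (a i (Negz k) v) w s r =
  nsum (fun t : nat => cre i k t (iterate one v w (s - t%:Z) r)) +
  (nsum (fun j : nat => iterate one v (ann bw i k j w) (s + (k.+1%:Z + j%:Z)) r) +
   (- bu 0 i) *: iterate one v w s (r + k.+1%:Z)).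
Proof.
rewrite {1}/iterate vop_one_cre (linB (vop_lin_u _ _ _ _)) vop_cons /nstep /fadd.
rewrite vop_uZ scaleNr -[LHS]addrA; congr (_ + (_ + _)).
by apply: eq_nsum => j; rewrite addrA.
Qed.

Lemma biser_addZ (G H : int -> int -> S) z : biser G -> biser H ->
  biser (fun p q => G p q + z *: H p q).
Proof.
move=> Gb Hb; have := biser_lin z Hb Gb.
by congr biser; apply: funext => p; apply: funext => q; rewrite addrC.
Qed.

Lemma Theta_add3 z0 k0 (F G H : int -> int -> S) z (e0 e1 e2 : int) : biser F -> biser G -> biser H ->
  Theta z0 k0 (fun p q => F p q + (G p q + z *: H p q)) e0 e1 e2 =
  Theta z0 k0 F e0 e1 e2 + (Theta z0 k0 G e0 e1 e2 + z *: Theta z0 k0 H e0 e1 e2) :> S.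
Proof.
move=> Fb Gb Hb; rewrite (Theta_add _ _ _ _ _ Fb (biser_addZ z Gb Hb)).
rewrite (Theta_add _ _ _ _ _ Gb (biser_op (@scaler_linear _ _ z) Hb)).
by rewrite (Theta_scale _ _ z _ _ _ Hb).
Qed.

Lemma combine3 (A B D A' B' D' A'' B'' D'' : S) z :
  A - z *: A' = A'' -> B - z *: B' = B'' -> D - z *: D' = D'' ->
  (A + (B + D)) - z *: (A' + (B' + D')) = A'' + (B'' + D'').
Proof.
by move=> <- <- <-; rewrite !scalerDr !opprD addrACA; congr (_ + _); rewrite addrACA.
Qed.

Lemma jacobi_v i k v : (forall w e0 e1 e2, jacobi_at one v w e0 e1 e2) ->
  forall w e0 e1 e2, jacobi_at one (a i (Negz k) v) w e0 e1 e2.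
Proof.
move=> J w e0 e1 e2; rewrite /jacobi_at.
have crl := cre_lin i k; have B1 := prod12_biser; have B2 := prod21_biser; have B3 := iterate_biser.
have [P wP] := ann_small w i k.
rewrite (eq_Theta _ _ _ _ _ (prod12_v i k v w)) (eq_Theta _ _ _ _ _ (prod21_v i k v w)).
rewrite (eq_Theta _ _ _ _ _ (iterate_v i k v w)).
pose G1 (j : nat) p q := prod12 one v (ann bw i k j w) p (q + (k.+1%:Z + j%:Z)).
pose G2 (j : nat) q p := prod21 one v (ann bw i k j w) (q + (k.+1%:Z + j%:Z)) p.
pose G3 (j : nat) s r := iterate one v (ann bw i k j w) (s + (k.+1%:Z + j%:Z)) r.
have G1b j : biser (G1 j) by apply: biser_shift2.
have G2b j : biser (G2 j) by apply: biser_shift1.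
have G3b j : biser (G3 j) by apply: biser_shift1.
have G10 j p q : (P <= j)%N -> G1 j p q = 0 by move=> /wP h; rewrite /G1 h prod12_w0.
have G20 j p q : (P <= j)%N -> G2 j p q = 0 by move=> /wP h; rewrite /G2 h prod21_w0.
have G30 j p q : (P <= j)%N -> G3 j p q = 0 by move=> /wP h; rewrite /G3 h iterate_w0.
rewrite (Theta_add3 _ _ _ _ _ _ (biser_opser2 crl (B1 one v w)) (biser_fsum G1b G10)
  (biser_binmul _ _ _ (B1 one v w))).
rewrite (Theta_add3 _ _ _ _ _ _ (biser_opser crl (unif_biser_shift (B2 one v w)))
  (biser_fsum G2b G20) (biser_binmul _ _ _ (B2 one v w))).
rewrite (Theta_add3 _ _ _ _ _ _ (biser_opser crl (unif_biser_shift (B3 one v w)))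
  (biser_fsum G3b G30) (biser_shift2 _ (B3 one v w))).
rewrite (Theta_opser2 _ _ _ _ _ crl (B1 one v w)) !(Theta_opser1 _ _ _ _ _ crl) //.
rewrite (Theta_fsum _ _ _ _ _ G1b G10) (Theta_fsum _ _ _ _ _ G2b G20).
rewrite (Theta_fsum _ _ _ _ _ G3b G30) !Theta_binmulZ // Theta_shift2.
apply: combine3.
- rewrite nsumB.
  + apply: eq_nsum => t; rewrite -(linZ (crl t)) -(linB (crl t)); congr (cre i k t _).
    exact: J.
  + have [Q fQ] := Theta_fin2 (-1) (dot bu bv) e0 e1 e2 (B1 one v w).
    by exists Q => t /fQ ->; apply: lin0.
  + have [Q fQ] := Theta_fin1 (-1) (dot bu bv) e0 e2 e1 (B2 one v w).
    by exists Q => t /fQ ->; apply: lin0.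
- rewrite nsumB.
  + apply: eq_nsum => j; rewrite /G1 /G2 /G3 Theta_shift2 !Theta_shift1; exact: J.
  + by exists P => j h; apply: nsum_eq0 => m; rewrite G10 // scaler0.
  + by exists P => j h; apply: nsum_eq0 => m; rewrite G20 // scaler0.
- rewrite -J scalerBr opprK; congr (_ - _); rewrite !scalerA; congr (_ *: _).
  by rewrite signzD exprS; ring.
Qed.

(** Now the creation operator stands on the right of both operators and
    contracts with both exponentials. *)
Lemma prod12_w i k w p q : prod12 one one (a i (Negz k) w) p q =
  a i (Negz k) (prod12 one one w p q) +
  ((- bv 0 i) *: prod12 one one w p (q + k.+1%:Z) +
   (- bu 0 i) *: prod12 one one w (p + k.+1%:Z) q).
Proof.
rewrite /prod12 vop_one_cre (linB (vop_lin _ _ _ _)) vop_one_cre vop_xZ !scaleNr.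
by rewrite -[LHS]addrA [X in _ + X]addrC.
Qed.

Lemma prod21_w i k w q p : prod21 one one (a i (Negz k) w) q p =
  a i (Negz k) (prod21 one one w q p) +
  ((- bv 0 i) *: prod21 one one w (q + k.+1%:Z) p +
   (- bu 0 i) *: prod21 one one w q (p + k.+1%:Z)).
Proof.
rewrite /prod21 vop_one_cre (linB (vop_lin _ _ _ _)) vop_one_cre vop_xZ !scaleNr.
by rewrite -[LHS]addrA.
Qed.

Lemma iterate_w i k w (s r : int) : iterate one one (a i (Negz k) w) s r =
  a i (Negz k) (iterate one one w s r) +
  ((- bv 0 i) *: iterate one one w (s + k.+1%:Z) r +
   (- bu 0 i) *: binmul 1 (- k.+1%:Z)%:~R (- k.+1%:Z) (iterate one one w) s r).
Proof.
rewrite {1}/iterate vop_cre NegzE opprK; congr (_ + _).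
have f4 : fin (fun m : nat => (1 ^+ m * cbinom (- k.+1%:Z)%:~R m) *:
   iterate one one w (s - - k.+1%:Z + m%:Z) (r - m%:Z)) by exact/biser_fin/iterate_biser.
pose Z (j : nat) : S := if j == 0%N then bv 0 i *: iterate one one w (s + k.+1%:Z) r else 0.
have Zf : fin Z by exists 1%N => -[|j].
have Z0 : nsum Z = bv 0 i *: iterate one one w (s + k.+1%:Z) r.
  by rewrite (@nsum_one _ _ 0) // => j j0; rewrite /Z (negbTE j0).
rewrite !scaleNr -opprD -Z0 /binmul (nsumZ _ f4) -(nsumD Zf (finZ _ f4)); congr (- _).
apply: eq_nsum => j; rewrite smode_vop_one smode_one (linD (vop_lin_u _ _ _ _)) scalerDr; congr (_ + _).
  rewrite /Z; case: eqP => [->|_].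
    by rewrite cbinom0 scale1r vop_xZ vop_uZ addr0.
  by rewrite vop_x0 vop_u0 scaler0.
by rewrite vop_uZ expr1n mul1r !scalerA mulrC opprK.
Qed.

Lemma jacobi_w i k w : (forall e0 e1 e2, jacobi_at one one w e0 e1 e2) ->
  forall e0 e1 e2, jacobi_at one one (a i (Negz k) w) e0 e1 e2.
Proof.
move=> J e0 e1 e2; rewrite /jacobi_at.
have B1 := prod12_biser; have B2 := prod21_biser; have B3 := iterate_biser.
rewrite (eq_Theta _ _ _ _ _ (prod12_w i k w)) (eq_Theta _ _ _ _ _ (prod21_w i k w)).
rewrite (eq_Theta _ _ _ _ _ (iterate_w i k w)).
have al := a_lin i (Negz k).
rewrite (Theta_add3 _ _ _ _ _ _ (biser_op al (B1 one one w))
  (biser_op (@scaler_linear _ _ _) (biser_shift2 _ (B1 one one w)))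
  (biser_shift1 _ (B1 one one w))).
rewrite (Theta_add3 _ _ _ _ _ _ (biser_op al (B2 one one w))
  (biser_op (@scaler_linear _ _ _) (biser_shift1 _ (B2 one one w)))
  (biser_shift2 _ (B2 one one w))).
rewrite (Theta_add3 _ _ _ _ _ _ (biser_op al (B3 one one w))
  (biser_op (@scaler_linear _ _ _) (biser_shift1 _ (B3 one one w)))
  (biser_binmul _ _ _ (B3 one one w))).
rewrite !(Theta_op _ _ _ _ _ al) // !Theta_scale ?Theta_binmulZ //; last 3 first.
- exact: biser_shift1.
- exact: biser_shift1.
- exact: biser_shift2.
rewrite !Theta_shift1 !Theta_shift2.
apply: combine3.
- by rewrite -(linZ al) -(linB al) J.
- by rewrite -J scalerBr !scalerA mulrC.
- by rewrite -J opprK scalerBr !scalerA mulrC.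
Qed.
(** * The Jacobi identity for the exponentials *)

(** Extended by zero to negative powers, so that indices can be computed in
    [int]. *)
Definition YmZ b (z : int) (x : S) : S := if z is Posz n then Ym b n x else 0.

Lemma YmZ_lin b z : linear (YmZ b z).
Proof.
case: z => n /=; first exact: Ym_lin.
by move=> k x y; rewrite scaler0 addr0.
Qed.

Lemma amod_Ym b d (i m : nat) : amod b i.+1 (Ym d m one) =
  if (i < m)%N then dot b d *: Ym d (m - i.+1) one else 0.
Proof.
rewrite /amod.
under eq_bigr do rewrite a_ann_Ym a_one (lin0 (Ym_lin _ _)) add0r.
case: ifP => _; last by rewrite big1 // => j _; rewrite scaler0.
by rewrite /dot scaler_suml; apply: eq_bigr => j _; rewrite scalerA.
Qed.

(** [Y_+(b,z1) Y_-(d,z2) 1 = (1 - z2/z1)^(b.d) Y_-(d,z2) 1]: by the recursion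
    of [Y_+] both sides satisfy the same differential equation. *)
Lemma Yp_Ym b d (j q : nat) : Yp b j (Ym d q one) =
  if (j <= q)%N then ((-1) ^+ j * cbinom (dot b d) j) *: Ym d (q - j) one else 0.
Proof.
elim/ltn_ind: j => [[|j] IH].
  by rewrite Yp0 cbinom0 mulr1 scale1r subn0.
apply: (@natS_inj R _ j); rewrite Yp_rec.
have -> : \sum_(i < j.+1) amod b i.+1 (Yp b (j.+1 - i.+1) (Ym d q one)) =
  \sum_(i < j.+1) (if (j < q)%N then
     (dot b d * ((-1) ^+ (j - i) * cbinom (dot b d) (j - i))) *: Ym d (q - j.+1) one else 0).
  apply: eq_bigr => i _; have ij : (i <= j)%N by rewrite -ltnS.
  rewrite subSS IH ?ltnS ?leq_subr //; case: (leqP (j - i) q) => h; last first.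
    by rewrite (lin0 (amod_lin _ _)) ifF //; lia.
  rewrite (linZ (amod_lin _ _)) amod_Ym.
  have -> : (i < q - (j - i))%N = (j < q)%N by lia.
  case: ifP => jq; last by rewrite scaler0.
  rewrite scalerA mulrC; have -> // : (q - (j - i) - i.+1 = q - j.+1)%N by lia.
case: ifP => jq; last by rewrite big1 ?oppr0 ?scaler0.
rewrite -scaler_suml -mulr_sumr.
rewrite -(rev_sum j (fun m => (-1) ^+ m * cbinom (dot b d) m)) cbinom_alt.
by rewrite -scaleNr scalerA; congr (_ *: _); rewrite [RHS]mulrCA cbinomSl exprS; ring.
Qed.

Lemma vop_Ym b c d (p : int) (q : nat) : vop one b c p (Ym d q one) =
  nsum (fun n : nat => ((-1) ^+ n * cbinom (dot b d) n) *:
      YmZ b (p + n%:Z) (YmZ d (q%:Z - n%:Z) one)).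
Proof.
rewrite vop_oneE /compL /compR.
have qE (j : nat) : Yp b j (Ym d q one) =
    ((-1) ^+ j * cbinom (dot b d) j) *: YmZ d (q%:Z - j%:Z) one.
  rewrite Yp_Ym; case: leqP => h.
    by have -> : q%:Z - j%:Z = (q - j)%N%:Z by lia.
  by case E : (q%:Z - j%:Z) => [m|m] /=; [lia|rewrite scaler0].
pose G (t j : nat) : S := Ym b t (id_field (p - t%:Z + 0%:Z + j%:Z)
   (((-1) ^+ j * cbinom (dot b d) j) *: YmZ d (q%:Z - j%:Z) one)).
have idl := id_field_field.1.
have G0 t j : (q < j)%N -> G t j = 0.
  move=> h; rewrite /G; case E : (q%:Z - j%:Z) => [m|m] /=; first by lia.
  by rewrite scaler0 (lin0 (idl _)) (lin0 (Ym_lin _ _)).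
have G1 t j : p - t%:Z + j%:Z != 0 -> G t j = 0.
  by move=> h; rewrite /G /id_field addr0 (negbTE h) mulr0n (lin0 (Ym_lin _ _)).
have Gb : boxed G.
  exists (q.+1 + (absz (p + q%:Z)%R).+1)%N => t j h.
  case: (ltnP q j) => qj; first exact: G0.
  by apply: G1; case/orP: h; lia.
transitivity (nsum (fun t => nsum (G t))).
  apply: eq_nsum => t; rewrite (lin_nsum (Ym_lin b t)).
    by apply: eq_nsum => j /=; rewrite /G qE.
  exists q.+1 => j h; rewrite Yp_Ym ifF ?(lin0 (idl _)) //; lia.
rewrite nsum_exchange //; apply: eq_nsum => j.
case E : (p + j%:Z) => [m|m].
  rewrite (@nsum_one _ _ m) => [|t ht]; last by apply: G1; lia.
  rewrite /G /id_field; have -> : p - m%:Z + 0%:Z + j%:Z = 0 by lia.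
  by rewrite eqxx mulr1n (linZ (Ym_lin _ _)).
by rewrite nsum_eq0 /= ?scaler0 // => t; apply: G1; lia.
Qed.

(** The coefficients of [Y_-(bu,z1) Y_-(bv,z2) 1], which is symmetric in the
    two factors; all three terms of the base case are scalar series times it. *)
Definition YmYm p q : S := YmZ bu p (YmZ bv q one).

Lemma YmYm_neg p q : (p < 0) || (q < 0) -> YmYm p q = 0.
Proof.
case: p => [p|p]; case: q => [q|q] //= _; rewrite /YmYm /=.
by rewrite (lin0 (Ym_lin _ _)).
Qed.

Lemma YmYm_sym p q : YmZ bv q (YmZ bu p one) = YmYm p q.
Proof.
rewrite /YmYm; case: p => p; case: q => q //=; last by rewrite (lin0 (Ym_lin _ _)).
  by rewrite YmC.
by rewrite (lin0 (Ym_lin _ _)).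
Qed.

Lemma YmYm_biser : biser YmYm.
Proof.
split; first by exists 0 => p q h; rewrite YmYm_neg // h orbT.
by move=> q; exists 0 => p h; rewrite YmYm_neg // h.
Qed.

Lemma YmYm_biser' : biser (fun q p => YmYm p q).
Proof.
split; first by exists 0 => p q h; rewrite YmYm_neg // h.
by move=> q; exists 0 => p h; rewrite YmYm_neg // h orbT.
Qed.

Lemma vop_YmZ b c d (p q : int) : vop one b c p (YmZ d q one) =
  binmul (-1) (dot b d) 0 (fun p q => YmZ b p (YmZ d q one)) p q.
Proof.
case: q => q; last first.
  rewrite [YmZ _ _ _]/= vop_x0; apply/esym/nsum_eq0 => m.
  case E : (Negz q - m%:Z) => [j|j]; first by lia.
  by rewrite [YmZ d _ _]/= (lin0 (YmZ_lin _ _)) scaler0.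
rewrite [YmZ d q one]/= vop_Ym /binmul; apply: eq_nsum => n.
by rewrite subr0.
Qed.

Lemma dotC (x y : vec) : dot x y = dot y x.
Proof. by apply: eq_bigr => i _; rewrite mulrC. Qed.

Lemma prod12_base p q : prod12 one one one p q = binmul (-1) (dot bu bv) 0 YmYm p q.
Proof.
rewrite /prod12 vop_one_one; exact: (vop_YmZ bu (bv + bw) bv p q).
Qed.

Lemma prod21_base p q : prod21 one one one q p = binmul (-1) (dot bu bv) 0 (fun q p => YmYm p q) q p.
Proof.
rewrite /prod21 vop_one_one; rewrite (dotC bu); have := vop_YmZ bv (bu + bw) bu q p.
by rewrite /YmZ => ->; apply: eq_nsum => m; rewrite -YmYm_sym.
Qed.

(** The three terms have the same total degree [d], so they are compared
    through their coefficient functions on one antidiagonal. *)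
Definition antidiag (f : nat -> C) (d : int) : S :=
  nsum (fun p : nat => f p *: YmYm p%:Z (d - p%:Z)).

Lemma antidiag_fin (f : nat -> C) (d : int) : fin (fun p : nat => f p *: YmYm p%:Z (d - p%:Z)).
Proof.
exists (absz d).+1 => p h; rewrite YmYm_neg ?scaler0 //; lia.
Qed.

Lemma antidiagD (f g : nat -> C) d : antidiag f d + antidiag g d = antidiag (fun p : nat => f p + g p) d.
Proof.
by rewrite /antidiag -(nsumD (antidiag_fin f d) (antidiag_fin g d)); apply: eq_nsum => p; rewrite scalerDl.
Qed.

Lemma antidiagZ (z : C) (f : nat -> C) d : z *: antidiag f d = antidiag (fun p : nat => z * f p) d.
Proof. by rewrite /antidiag (nsumZ _ (antidiag_fin f d)); apply: eq_nsum => p; rewrite scalerA. Qed.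

Lemma antidiag_sum (n : nat) (f : nat -> nat -> C) d :
  \sum_(j < n) antidiag (f j) d = antidiag (fun p : nat => \sum_(j < n) f j p) d.
Proof.
rewrite /antidiag -nsum_sum => [|i]; last exact: antidiag_fin.
by apply: eq_nsum => p; rewrite scaler_suml.
Qed.

Lemma eq_antidiag (f g : nat -> C) d :
  (forall p : nat, (p%:Z <= d) -> f p = g p) -> antidiag f d = antidiag g d.
Proof.
move=> fg; apply: eq_nsum => p; have [pd|pd] := lerP p%:Z d; first by rewrite fg.
by rewrite !YmYm_neg ?scaler0 //; apply/orP; right; lia.
Qed.

Lemma YmYm_rec (m : nat) q :
  m%:R *: YmYm m q = \sum_(j < m) amod bu (Negz j) (YmYm (m - j.+1)%N q).
Proof. by rewrite /YmYm [YmZ bu m]/= Ym_rec. Qed.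

Lemma nstep_one i k F n : isfield F -> nstep bw i k F n one =
  nsum (fun t : nat => cre i k t (F (n - t%:Z) one)) +
  ((-1) ^+ k * bw 0 i) *: F (n + k.+1%:Z) one.
Proof.
move=> Ff; rewrite /nstep /fadd; congr (_ + _).
rewrite /compR (@nsum_one _ _ 0) => [|j j0]; last first.
  by rewrite /ann smode_one (negbTE j0) scaler0 (lin0 (Ff.1 _)).
rewrite /ann smode_one eqxx !(linZ (Ff.1 _)) scalerA addr0; congr (_ * _ *: _).
by rewrite cbinom_neg add0r cbinom_nat binn mulr1.
Qed.

(** The iterate is [(z2+z0)^(bu.bw) Y_-(bu,z2+z0) Y_-(bv,z2) 1], expanded in
    [z0]. The recursion of [Y_-(bu,z0)] in the state gives a recursion in [r]:
    the creation parts contribute the factor [p] and the zero mode the factor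
    [bu.bw] of [cbinomSl]. *)
Lemma iterate_base (r : nat) (s : int) : iterate one one one s r =
  antidiag (fun p : nat => cbinom (dot bu bw + p%:R) r) (s + r%:Z).
Proof.
rewrite /iterate vop_one_one; elim/ltn_ind: r s => [[|r] IH] s.
  rewrite Ym0 vop_one_one /antidiag addr0; case: s => s; last first.
    by rewrite nsum_eq0 // => p; rewrite YmYm_neg ?scaler0 //; lia.
  rewrite (@nsumE _ _ s.+1) => [|p h]; last by rewrite YmYm_neg ?scaler0 //; lia.
  rewrite -Ym_add (rev_sum s (fun t => Ym bu (s - t) (Ym bv t one))).
  apply: eq_bigr => p _; rewrite cbinom0 scale1r /YmYm subKn; last by rewrite -ltnS.
  have -> : s%:Z - p%:Z = (s - p)%N%:Z by have := ltn_ord p; lia.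
  by [].
pose nu := dot bu bw; pose d : int := s + r.+1%:Z.
apply: (@natS_inj R _ r).
rewrite -vop_uZ Ym_rec (lin_sum (vop_lin_u _ _ _ _)).
pose X (m : nat) (s : int) := vop (Ym bu m one) (bu + bv) bw s one.
have XE m s' : (m <= r)%N -> X m s' = antidiag (fun p : nat => cbinom (nu + p%:R) m) (s' + m%:Z).
  by move=> mr; apply: IH; rewrite ltnS.
have step j : (j <= r)%N -> vop (amod bu (Negz j) (Ym bu (r.+1 - j.+1) one)) (bu + bv) bw s one =
   nsum (fun t : nat => cbinom (t + j)%N%:R j *: amod bu (Negz (t + j)) (X (r - j)%N (s - t%:Z))) +
   ((-1) ^+ j * nu) *: X (r - j)%N (s + j.+1%:Z).
  move=> jr; rewrite {1}/amod (lin_sum (vop_lin_u _ _ _ _)).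
  have Tf := vop_field (Ym bu (r - j) one) (bu + bv) bw.
  have f1 i : fin (fun t : nat => bu 0 i *: cre i j t (X (r - j)%N (s - t%:Z))).
    exact/finZ/(compL_fin s one (cre_lin i j) Tf).
  transitivity (\sum_(i < l) (nsum (fun t : nat => bu 0 i *: cre i j t (X (r - j)%N (s - t%:Z))) +
     (bu 0 i * ((-1) ^+ j * bw 0 i)) *: X (r - j)%N (s + j.+1%:Z))).
    apply: eq_bigr => i _; rewrite subSS vop_uZ vop_cons nstep_one //.
    by rewrite scalerDr scalerA (nsumZ _ (compL_fin s one (cre_lin i j) Tf)).
  rewrite big_split /= -nsum_sum //; congr (_ + _).
    apply: eq_nsum => t; rewrite /amod scaler_sumr; apply: eq_bigr => i _.
    by rewrite /cre !scalerA mulrC.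
  rewrite -scaler_suml; congr (_ *: _); rewrite /nu /dot mulr_sumr.
  by apply: eq_bigr => i _; ring.
under eq_bigr => j _ do rewrite step -1?ltnS //.
rewrite big_split /=.
have -> : \sum_(j < r.+1) ((-1) ^+ j * nu) *: X (r - j)%N (s + j.+1%:Z) =
   antidiag (fun p : nat => nu * cbinom (nu + p%:R - 1) r) d.
  transitivity (\sum_(j < r.+1) antidiag (fun p : nat => (-1) ^+ j * nu * cbinom (nu + p%:R) (r - j)) d).
    apply: eq_bigr => j _; have jr : (j <= r)%N by rewrite -ltnS.
    rewrite XE ?leq_subr // antidiagZ; congr antidiag; rewrite /d; lia.
  rewrite (antidiag_sum _ (fun (j p : nat) => (-1) ^+ j * nu * cbinom (nu + p%:R) (r - j))).
  apply: eq_antidiag => p _; rewrite -cbinom_Vandermonde mulr_sumr; apply: eq_bigr => j _.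
  have -> : cbinom (-1 : C) j = (-1) ^+ j.
    by rewrite -[-1 in X in cbinom X _]add0r -[0]oppr0 cbinom_neg add0r cbinom_nat binn mulr1.
  ring.
(* What the creation operators [bu(-n-1)] are applied to, summed over all of
   their origins [j] in the exponential. *)
pose W (n : nat) : S := antidiag (fun p : nat => cbinom (nu + p%:R + n%:R) r) (d - n.+1%:Z).
have W0 (n : nat) : ~~ (n%:Z < d) -> W n = 0.
  by move=> h; apply: nsum_eq0 => p; rewrite YmYm_neg ?scaler0 //; lia.
have Wf : fin W by exists (absz d).+1 => n h; apply: W0; lia.
have -> : \sum_(j < r.+1) nsum (fun t : nat => cbinom (t + j)%N%:R j *:
     amod bu (Negz (t + j)) (X (r - j)%N (s - t%:Z))) =
   nsum (fun n : nat => amod bu (Negz n) (W n)).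
  pose A (j n : nat) : S := cbinom n%:R j *: amod bu (Negz n)
     (antidiag (fun p : nat => cbinom (nu + p%:R) (r - j)) (d - n.+1%:Z)).
  have A0 (j n : nat) : ~~ (n%:Z < d) -> A j n = 0.
    move=> h; rewrite /A [antidiag _ _]nsum_eq0 ?(lin0 (amod_lin _ _)) ?scaler0 // => p.
    by rewrite YmYm_neg ?scaler0 //; lia.
  have Af j : fin (A j) by exists (absz d).+1 => n h; apply: A0; lia.
  transitivity (\sum_(j < r.+1) nsum (A j)).
    apply: eq_bigr => j _; have jr : (j <= r)%N by rewrite -ltnS.
    rewrite (@nsum_shift _ (A j) j) //; last first.
      by move=> n nj; rewrite /A cbinom_nat0 // scale0r.
    apply: eq_nsum => t; rewrite /A XE ?leq_subr // [(t + j)%N]addnC.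
    by have -> : s - t%:Z + (r - j)%N%:Z = d - (j + t).+1%:Z by rewrite /d; lia.
  rewrite -nsum_sum //; apply: eq_nsum => n; rewrite /A /W.
  under eq_bigr do rewrite -(linZ (amod_lin _ _)) antidiagZ.
  rewrite -(lin_sum (amod_lin bu (Negz n))).
  rewrite (antidiag_sum _ (fun (j p : nat) => cbinom n%:R j * cbinom (nu + p%:R) (r - j))).
  congr (amod _ _ _).
  apply: eq_antidiag => p _; rewrite -cbinom_Vandermonde.
  by apply: eq_bigr => j _; rewrite mulrC.
have -> : nsum (fun n : nat => amod bu (Negz n) (W n)) =
   antidiag (fun p : nat => p%:R * cbinom (nu + p%:R - 1) r) d.
  (* The recursion of [Y_-(bu)] turns these creation operators into the factor
       [p]. *)
  pose G (p n : nat) : S := cbinom (nu + p%:R + n%:R) r *: amod bu (Negz n) (YmYm p%:Z (d - n.+1%:Z - p%:Z)).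
  have Gb : boxed G.
    apply: (@boxed_triangle _ _ _ (absz d).+1) => p n h.
    by rewrite /G YmYm_neg ?(lin0 (amod_lin _ _)) ?scaler0 //; lia.
  transitivity (nsum (fun n : nat => nsum (G^~ n))).
    apply: eq_nsum => n; rewrite /W /antidiag (lin_nsum (amod_lin _ _)); last exact: antidiag_fin.
    by apply: eq_nsum => p /=; rewrite (linZ (amod_lin _ _)).
  rewrite -nsum_exchange // nsum_diagonal // /antidiag [RHS](@nsum_shift _ _ 1); last 2 first.
  - by move=> [|m] // _; rewrite mul0r scale0r.
  - exact: antidiag_fin.
  apply: eq_nsum => n; rewrite add1n mulrC -scalerA YmYm_rec scaler_sumr.
  apply: eq_bigr => t _; have tn : (t <= n)%N by rewrite -ltnS.
  rewrite /G subSS; have -> : d - t.+1%:Z - (n - t)%N%:Z = d - n.+1%:Z by lia.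
  congr (cbinom _ _ *: _); rewrite -addrA -natrD subnK // -natr1; ring.
rewrite antidiagD antidiagZ; apply: eq_antidiag => p _.
by rewrite cbinomSl -mulrDl addrC.
Qed.

Lemma iterate_base_neg (n : nat) (s : int) : iterate one one one s (Negz n) = 0.
Proof. by rewrite /iterate vop_one_one vop_u0. Qed.

(** A kernel runs along an antidiagonal through positions [h m]; the
    coefficient function [cf] is read off at the position [p] instead of at
    [m]. *)
Lemma antidiag_reindex (c cf : nat -> C) (h : nat -> int) (K : nat) (d : int) :
  injective h -> (forall m, (m <= absz (h m) + K)%N) ->
  (forall m p : nat, h m = p -> cf p = c m) ->
  (forall p : nat, (forall m, h m <> p) -> cf p = 0) ->
  nsum (fun m => c m *: YmYm (h m) (d - h m)) = antidiag cf d.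
Proof.
move=> hI hK hc hn.
pose G (m p : nat) : S := if h m == p then c m *: YmYm p (d - p%:Z) else 0.
have Gb : boxed G.
  exists (absz d + K).+1 => m p hh; rewrite /G; case: eqP => // e.
  have := hK m; rewrite e absz_nat => km.
  by rewrite YmYm_neg ?scaler0 //; apply/orP; right; case/orP: hh; lia.
transitivity (nsum (fun m => nsum (G m))).
  apply: eq_nsum => m; case E : (h m) => [p|p]; last first.
    rewrite YmYm_neg ?scaler0 //; apply/esym/nsum_eq0 => p'.
    by rewrite /G E.
  rewrite (@nsum_one _ _ p) => [|p' hp]; first by rewrite /G E eqxx.
  by rewrite /G E ifF //; apply/negbTE; move: hp; apply: contra => /eqP[->].
rewrite nsum_exchange //; apply: eq_nsum => p.
have [[m e]|ne] := pselect (exists m, h m = p).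
  rewrite (@nsum_one _ _ m) => [|m' hm]; first by rewrite /G e eqxx (hc _ _ e).
  rewrite /G ifF //; apply/negbTE; move: hm; apply: contra => /eqP e'.
  by apply/eqP/hI; rewrite e e'.
rewrite nsum_eq0 ?hn ?scale0r // => m; first by move=> e; apply: ne; exists m.
by rewrite /G ifF //; apply/negbTE/eqP => e; apply: ne; exists m.
Qed.

(** The classical identity of delta functions for [(z1 - z2)^(-1-e0)]. If [e0
    < 0] the power is a polynomial and its two expansions cancel. If [e0 >= 0]
    the two expansions have disjoint supports, and on each of them the
    symmetry of binomial coefficients gives the right-hand side. *)
Lemma delta_coef (e0 e1 : int) (p : nat) :
  (if p%:Z - (e1 + 1 + e0) is Posz m then (-1) ^+ m * cbinom (-1 - e0%:~R) m else 0) -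
  (-1) ^ (1 + e0) *
    (if e1 - p%:Z is Posz m then (-1) ^+ m * cbinom (-1 - e0%:~R) m else 0) =
  (if e0 is Posz r then cbinom (p%:R - 1 - e1%:~R) r else 0) :> C.
Proof.
have sq m : (-1) ^+ m * (-1) ^+ m = 1 :> C by rewrite -exprMn mulrNN mulr1 expr1n.
case: e0 => r.
  have cE m : (-1) ^+ m * cbinom (-1 - (Posz r)%:~R : C) m = cbinom (r + m)%N%:R m.
    by rewrite addrC -[(Posz r)%:~R]pmulrn cbinom_neg mulrA sq mul1r -natrD.
  case E : (p%:Z - _) => [m|m]; case E' : (e1 - p%:Z) => [m'|m'].
  - by lia.
  - have -> : p%:R - 1 - e1%:~R = (m + r)%N%:R :> C.
      have -> : e1 = p%:Z - 1 - (m + r)%N%:Z by lia.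
      by rewrite !rmorphB /= -!pmulrn; ring.
    by rewrite cE mulr0 subr0 addnC !cbinom_nat -bin_sub ?leq_addr // addKn.
  - have -> : p%:R - 1 - e1%:~R = - m'%:R - 1 :> C.
      have -> : e1 = p%:Z + m'%:Z by lia.
      by rewrite rmorphD /= -!pmulrn; ring.
    rewrite cE sub0r exprSz cbinom_neg -natrD !cbinom_nat mulN1r mulNr opprK.
    by rewrite -[in RHS]bin_sub ?leq_addl // addnK addnC.
  - have -> : p%:R - 1 - e1%:~R = m'%:R :> C.
      have -> : e1 = p%:Z - 1 - m'%:Z by lia.
      by rewrite !rmorphB /= -!pmulrn; ring.
    by rewrite mulr0 subr0 cbinom_nat0 //; lia.
have rE : -1 - (Negz r)%:~R = r%:R :> C.
  by rewrite NegzE mulrNz -pmulrn -natr1; ring.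
have -> : 1 + Negz r = - r%:Z by lia.
rewrite -exprnN invr_sign.
have cE m : (-1) ^+ m * cbinom (-1 - (Negz r)%:~R : C) m = (-1) ^+ m * 'C(r, m)%:R.
  by rewrite rE cbinom_nat.
case E : (p%:Z - _) => [m|m]; case E' : (e1 - p%:Z) => [m'|m']; rewrite ?cE.
- have e : r = (m + m')%N by lia.
  rewrite mulrA e exprD -[_ * _ * (-1) ^+ m']mulrA sq mulr1.
  by rewrite -[X in _ - _ * X%:R]bin_sub ?leq_addl // addnK subrr.
- by rewrite bin_small ?mulr0 ?subr0 //; lia.
- by rewrite bin_small ?mulr0 ?subr0 //; lia.
- by lia.
Qed.

(** Both products carry the factor [(z1 - z2)^(bu.bv)], which cancels the
    non-integral part of the kernel; the factor [(z2 + z0)^(bu.bw)] of the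
    iterate cancels that of the third kernel. What is left is [delta_coef]. *)
Lemma jacobi_base e0 e1 e2 : jacobi_at one one one e0 e1 e2.
Proof.
rewrite /jacobi_at; pose d : int := e1 + e2 + 1 + e0.
rewrite (eq_Theta _ _ _ _ _ prod12_base) (eq_Theta _ _ _ _ _ (fun q p => prod21_base p q)).
rewrite (Theta_binmul _ _ _ _ _ _ _ YmYm_biser) (Theta_binmul _ _ _ _ _ _ _ YmYm_biser').
rewrite addr0 subrr subr0.
have -> : Theta (-1) 0 YmYm e0 e1 e2 =
  antidiag (fun p : nat => if p%:Z - (e1 + 1 + e0) is Posz m then (-1) ^+ m * cbinom (-1 - e0%:~R) m else 0) d.
  rewrite -(@antidiag_reindex (fun m => (-1) ^+ m * cbinom (-1 - e0%:~R) m) _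
     (fun m : nat => e1 + 1 + e0 + m%:Z) (absz (e1 + 1 + e0))).
  - apply: eq_nsum => m; rewrite subr0.
    by have -> : d - (e1 + 1 + e0 + m%:Z) = e2 - m%:Z by rewrite /d; lia.
  - by move=> m m' h; lia.
  - by move=> m; lia.
  - by move=> m p e; have -> : p%:Z - (e1 + 1 + e0) = m by lia.
  - move=> p np; case E : (p%:Z - _) => [m|//].
    by case: (np m); lia.
have -> : Theta (-1) 0 (fun q p => YmYm p q) e0 e2 e1 =
  antidiag (fun p : nat => if e1 - p%:Z is Posz m then (-1) ^+ m * cbinom (-1 - e0%:~R) m else 0) d.
  rewrite -(@antidiag_reindex (fun m => (-1) ^+ m * cbinom (-1 - e0%:~R) m) _
     (fun m : nat => e1 - m%:Z) (absz e1)).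
  - apply: eq_nsum => m; rewrite subr0.
    by have -> : d - (e1 - m%:Z) = e2 + 1 + e0 + m%:Z by rewrite /d; lia.
  - by move=> m m' h; lia.
  - by move=> m; lia.
  - by move=> m p e; have -> : e1 - p%:Z = m by lia.
  - move=> p np; case E : (e1 - p%:Z) => [m|//].
    by case: (np m); lia.
rewrite -scaleNr antidiagZ antidiagD.
have -> : Theta 1 (dot bu bw) (iterate one one one) e1 e2 e0 =
  antidiag (fun p : nat => if e0 is Posz r then cbinom (p%:R - 1 - e1%:~R) r else 0) d.
  case: {+}e0 @d => [r|r] d; last first.
    rewrite /antidiag [RHS]nsum_eq0 => [|p]; last by rewrite scale0r.
    apply: nsum_eq0 => m; have -> : Negz r - m%:Z = Negz (r + m) by lia.
    by rewrite iterate_base_neg scaler0.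
  rewrite /Theta (@nsumE _ _ r.+1) => [|m rm]; last first.
    case E : (Posz r - m%:Z) => [j|j]; first by lia.
    by rewrite iterate_base_neg scaler0.
  transitivity (\sum_(m < r.+1) antidiag (fun p : nat =>
     cbinom (-1 - e1%:~R - dot bu bw) m * cbinom (dot bu bw + p%:R) (r - m)) d).
    apply: eq_bigr => m _; have mr : (m <= r)%N by rewrite -ltnS.
    have -> : Posz r - m%:Z = (r - m)%N%:Z by lia.
    rewrite iterate_base antidiagZ expr1n mul1r; congr antidiag; rewrite /d; lia.
  rewrite (antidiag_sum _ (fun m p : nat =>
     cbinom (-1 - e1%:~R - dot bu bw) m * cbinom (dot bu bw + p%:R) (r - m))).
  apply: eq_antidiag => p _.
  have -> : p%:R - 1 - e1%:~R = (dot bu bw + p%:R) + (-1 - e1%:~R - dot bu bw) :> C by ring.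
  by rewrite -cbinom_Vandermonde; apply: eq_bigr => m _; rewrite mulrC.
by apply: eq_antidiag => p _; rewrite mulNr delta_coef.
Qed.

(** * The Jacobi identity for all states *)

Lemma jacobi_lin k (u v w u1 v1 w1 u2 v2 w2 : S) e0 e1 e2 :
  (forall p q, prod12 u v w p q = k *: prod12 u1 v1 w1 p q + prod12 u2 v2 w2 p q) ->
  (forall p q, prod21 u v w p q = k *: prod21 u1 v1 w1 p q + prod21 u2 v2 w2 p q) ->
  (forall p q, iterate u v w p q = k *: iterate u1 v1 w1 p q + iterate u2 v2 w2 p q) ->
  jacobi_at u1 v1 w1 e0 e1 e2 -> jacobi_at u2 v2 w2 e0 e1 e2 ->
  jacobi_at u v w e0 e1 e2.
Proof.
have B1 := prod12_biser; have B2 := prod21_biser; have B3 := iterate_biser.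
rewrite /jacobi_at => E1 E2 E3 J J'.
rewrite (eq_Theta _ _ _ _ _ E1) (eq_Theta _ _ _ _ _ E2) (eq_Theta _ _ _ _ _ E3).
rewrite !Theta_lin // -J -J' !scalerDr opprD addrACA; congr (_ + _).
by rewrite scalerN !scalerA mulrC.
Qed.

Lemma jacobi_lin_w k u v w w' e0 e1 e2 :
  jacobi_at u v w e0 e1 e2 -> jacobi_at u v w' e0 e1 e2 ->
  jacobi_at u v (k *: w + w') e0 e1 e2.
Proof.
apply: (jacobi_lin (k := k)) => p q; first by rewrite /prod12 (vop_lin v) (vop_lin u).
  by rewrite /prod21 (vop_lin u) (vop_lin v).
by rewrite /iterate vop_lin.
Qed.

Lemma jacobi_lin_v k u v v' w e0 e1 e2 :
  jacobi_at u v w e0 e1 e2 -> jacobi_at u v' w e0 e1 e2 ->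
  jacobi_at u (k *: v + v') w e0 e1 e2.
Proof.
apply: (jacobi_lin (k := k)) => p q; rewrite /prod12 /prod21 /iterate.
- by rewrite (vop_lin_u bv bw q w) (vop_lin u).
- by rewrite (vop_lin_u bv).
- by rewrite (vop_lin u) (vop_lin_u (bu + bv)).
Qed.

Lemma jacobi_lin_u k u u' v w e0 e1 e2 :
  jacobi_at u v w e0 e1 e2 -> jacobi_at u' v w e0 e1 e2 ->
  jacobi_at (k *: u + u') v w e0 e1 e2.
Proof.
apply: (jacobi_lin (k := k)) => p q; rewrite /prod12 /prod21 /iterate.
- by rewrite (vop_lin_u bu).
- by rewrite (vop_lin_u bu bw q w) (vop_lin v).
- by rewrite (vop_lin_u bu bv q v) (vop_lin_u (bu + bv)).
Qed.

(** Creation operators are removed from [u] first, since the recursion for [u]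
    changes [v] and [w]; then from [v], whose recursion changes [w]; then from
    [w]. *)
Theorem jacobi u v w e0 e1 e2 : jacobi_at u v w e0 e1 e2.
Proof.
elim/fock_ind: u v w e0 e1 e2 => [|k x y IHx IHy|i k u IH] v w e0 e1 e2.
- elim/fock_ind: v w e0 e1 e2 => [|k x y IHx IHy|i k v IH] w e0 e1 e2.
  + elim/fock_ind: w e0 e1 e2 => [|k x y IHx IHy|i k w IH] e0 e1 e2.
    * exact: jacobi_base.
    * exact: jacobi_lin_w.
    * exact: jacobi_w.
  + exact: jacobi_lin_v.
  + exact: jacobi_v.
- exact: jacobi_lin_u.
- exact: jacobi_u.
Qed.
End Jacobi.

End Vertex.

End Heisenberg.

(** * The kernels of the Jacobi identity as formal series *)

Lemma fsum_one (V : nmodType) (J : choiceType) (F : J -> V) (j0 : J) :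
  (forall j, j != j0 -> F j = 0) -> \sum_(j \in [set: J]%classic) F j = F j0.
Proof.
move=> F0; rewrite (fsbigTE [fset j0]%fset) ?big_seq_fset1 // => j.
by rewrite inE => /F0.
Qed.

Section Kernel.
Variable R : realType.
Local Notation C := R[i].
Local Notation expo := 'rV[C]_3.
Variables x y w : 'I_3.
Hypothesis xy : x != y.
Hypothesis xw : x != w.
Hypothesis yw : y != w.
Hypothesis cover : forall i, [|| i == x, i == y | i == w].
Implicit Types (d e : expo) (s k : C) (m : nat) (n : int).

(** Coordinates adapted to the roles of the three variables in a kernel; the
    hypothesis [cover] says that there are no other variables. *)
Definition pt (p q r : C) : expo :=
  p *: delta_mx 0 x + q *: delta_mx 0 y + r *: delta_mx 0 w.

Lemma ptx p q r : pt p q r 0 x = p.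
Proof.
by rewrite !mxE !eqxx (negbTE xy) (negbTE xw) !mulr0 mulr1 !addr0.
Qed.

Lemma pty p q r : pt p q r 0 y = q.
Proof.
by rewrite !mxE !eqxx eq_sym (negbTE xy) (negbTE yw) !mulr0 mulr1 addr0 add0r.
Qed.

Lemma ptw p q r : pt p q r 0 w = r.
Proof.
rewrite !mxE !eqxx [w == x]eq_sym [w == y]eq_sym.
by rewrite (negbTE xw) (negbTE yw) !mulr0 mulr1 !add0r.
Qed.

Lemma ptP d e : d 0 x = e 0 x -> d 0 y = e 0 y -> d 0 w = e 0 w -> d = e.
Proof.
move=> hx hy hw; apply/rowP => i.
by have /or3P[] := cover i => /eqP ->.
Qed.

Lemma ptE e : e = pt (e 0 x) (e 0 y) (e 0 w).
Proof. by apply: ptP; rewrite ?ptx ?pty ?ptw. Qed.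

Lemma mul3_mono (V : lmodType C) (i : 'I_3) k (S : expo -> V) e :
  mul3 (mono3 i k) S e = S (e - k *: delta_mx 0 i).
Proof.
rewrite /mul3 (@fsum_one _ _ _ (k *: delta_mx 0 i)) => [|d hd].
  by rewrite /mono3 eqxx scale1r.
by rewrite /mono3 (negbTE hd) scale0r.
Qed.

Lemma smul3_monor (i : 'I_3) k (A : expo -> C) e (z : C) :
  smul3 A (fun d => z * mono3 i k d) e = z * A (e - k *: delta_mx 0 i).
Proof.
rewrite /smul3 /mul3 (@fsum_one _ _ _ (e - k *: delta_mx 0 i)) => [|d hd].
  by rewrite /mono3 opprB addrCA subrr addr0 eqxx mulr1 /GRing.scale /= mulrC.
rewrite /mono3; case: eqP => [h|_]; last by rewrite mulr0 scaler0.
by case/eqP: hd; rewrite -h opprB addrCA subrr addr0.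
Qed.

Lemma smul3_mono (i : 'I_3) k (A : expo -> C) e :
  smul3 A (mono3 i k) e = A (e - k *: delta_mx 0 i).
Proof.
rewrite -[RHS]mul1r -smul3_monor; congr (smul3 _ _ _).
by apply: funext => d; rewrite mul1r.
Qed.

Lemma mono_mono (k k' : C) e :
  smul3 (mono3 x k) (mono3 y k') e = (e == pt k k' 0)%:R.
Proof.
rewrite smul3_mono /mono3 /pt scale0r addr0; congr (_%:R); congr nat_of_bool.
by rewrite subr_eq.
Qed.

Lemma subpow_in k m e : e = pt (k - m%:R) m%:R 0 ->
  subpow x y k e = cbinom k m * (-1) ^+ m.
Proof.
move=> eE; rewrite /subpow -[LHS]/(nsum _) (@nsum_one _ _ m) => [|m' hm].
  by rewrite mono_mono eE eqxx mulr1.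
rewrite mono_mono; case: eqP => [h|_]; last by rewrite mulr0.
have := congr1 (fun d : expo => d 0 y) h; rewrite eE !pty => /eqP.
by rewrite eqr_nat eq_sym (negbTE hm).
Qed.

Lemma subpow_out k e : (forall m, e <> pt (k - m%:R) m%:R 0) -> subpow x y k e = 0.
Proof.
move=> ne; rewrite /subpow -[LHS]/(nsum _) nsum_eq0 // => m.
by rewrite mono_mono; case: eqP => [/ne//|_]; rewrite mulr0.
Qed.

Lemma pt_shiftw p q r k : pt p q r - k *: delta_mx 0 w = pt p q (r - k).
Proof. by rewrite /pt scalerBl addrA. Qed.

Lemma pt_sub p q r p' q' r' : pt p q r - pt p' q' r' = pt (p - p') (q - q') (r - r').
Proof.
apply: ptP; rewrite mxE ?ptx ?pty ?ptw mxE ?ptx ?pty ?ptw //.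
Qed.

Lemma pt_inj p q r p' q' r' : pt p q r = pt p' q' r' -> [/\ p = p', q = q' & r = r'].
Proof.
move=> h; split.
- by have := congr1 (fun d : expo => d 0 x) h; rewrite !ptx.
- by have := congr1 (fun d : expo => d 0 y) h; rewrite !pty.
- by have := congr1 (fun d : expo => d 0 w) h; rewrite !ptw.
Qed.

Lemma subE (e d : expo) i : (e - d) 0 i = e 0 i - d 0 i.
Proof. by rewrite mxE [(- d) 0 i]mxE. Qed.

Lemma intr_injC : injective (intr : int -> C).
Proof. exact: intr_inj. Qed.

Lemma delta3_in (s : C) n m p q r : p = n%:~R - m%:R -> q = m%:R -> r = - n%:~R ->
  delta3 x y w s (pt p q r) = s ^ (- n) * (cbinom n%:~R m * (-1) ^+ m).
Proof.
move=> -> -> ->; rewrite /delta3 (@fsum_one _ _ _ n) => [|n' hn].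
  by rewrite smul3_monor pt_shiftw opprK addNr (subpow_in erefl).
rewrite smul3_monor pt_shiftw subpow_out ?mulr0 // => m' /pt_inj[_ _].
move/eqP; rewrite opprK addrC subr_eq0 => /eqP/intr_injC h.
by rewrite h eqxx in hn.
Qed.

Lemma delta3_out (s : C) e : (forall n m, e <> pt (n%:~R - m%:R) m%:R (- n%:~R)) ->
  delta3 x y w s e = 0.
Proof.
move=> ne; rewrite /delta3 fsbig1 // => n _; rewrite smul3_monor subpow_out ?mulr0 //.
move=> m h; apply: (ne n m); move/eqP: h; rewrite subr_eq => /eqP ->.
by rewrite /pt scale0r addr0.
Qed.

(** The kernel is a product of two binomial series in [z_x - z_y]; by
    Vandermonde's identity they recombine into [(z_x - z_y)^(k+n)]. *)
Lemma kernel_in (s k : C) n m :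
  jacobi_kernel x y w s k (pt (k + n%:~R - m%:R) m%:R (- 1 - k - n%:~R)) =
  s ^ (- n) * (cbinom (k + n%:~R) m * (-1) ^+ m).
Proof.
rewrite /jacobi_kernel /smul3 mul3_mono pt_shiftw -/(smul3 _ _ _).
have -> : - 1 - k - n%:~R - -1 = - k - n%:~R :> C by ring.
set e := pt _ _ _.
have hI : injective (fun j : nat => pt (k - j%:R) j%:R (- k)).
  by move=> j j' /pt_inj[_ /eqP h _]; apply/eqP; rewrite eqr_nat in h.
have rp j : ratpow x y w k (pt (k - j%:R) j%:R (- k)) = cbinom k j * (-1) ^+ j.
  by rewrite /ratpow smul3_mono pt_shiftw opprK addNr (subpow_in erefl).
rewrite /smul3 /mul3 (fsum_image hI) => [|d nd]; last first.
  rewrite [ratpow _ _ _ _ _]smul3_mono subpow_out ?scale0r // => j h; apply: (nd j).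
  move/eqP: h; rewrite subr_eq => /eqP ->.
  by rewrite /pt scale0r addr0.
rewrite (@nsumE _ _ m.+1) => [|j jm]; last first.
  rewrite /= delta3_out ?scaler0 // => n' m'; rewrite /e pt_sub => /pt_inj[_ h _].
  have : m%:R = (m' + j)%N%:R :> C by rewrite natrD -h subrK.
  by move/eqP; rewrite eqr_nat; lia.
rewrite [k + _]addrC -cbinom_Vandermonde mulr_suml mulr_sumr; apply: eq_bigr => j _.
have jm : (j <= m)%N by rewrite -ltnS.
rewrite /= rp /e pt_sub (@delta3_in s n (m - j)%N); first last.
- ring.
- by rewrite natrB.
- by rewrite natrB //; ring.
have -> : (-1) ^+ m = (-1) ^+ (m - j) * (-1) ^+ j :> C by rewrite -exprD subnK.
by rewrite /GRing.scale /=; ring.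
Qed.

Lemma kernel_out (s k : C) e :
  (forall n m, e <> pt (k + n%:~R - m%:R) m%:R (- 1 - k - n%:~R)) ->
  jacobi_kernel x y w s k e = 0.
Proof.
move=> ne; rewrite /jacobi_kernel /smul3 mul3_mono -/(smul3 _ _ _).
rewrite /smul3 /mul3 fsbig1 // => d _.
have [[j dE]|nd] := pselect (exists j : nat, d = pt (k - j%:R) j%:R (- k)); last first.
  rewrite [ratpow _ _ _ _ _]smul3_mono subpow_out ?scale0r // => j h; apply: nd; exists j.
  move/eqP: h; rewrite subr_eq => /eqP ->.
  by rewrite /pt scale0r addr0.
rewrite delta3_out ?scaler0 // => n m; rewrite (ptE e) pt_shiftw dE pt_sub.
move=> /pt_inj[hx hy hw]; apply: (ne n (m + j)%N); rewrite (ptE e); congr pt.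
- by rewrite natrD; move/eqP: hx; rewrite subr_eq => /eqP ->; ring.
- by rewrite natrD; move/eqP: hy; rewrite subr_eq => /eqP ->; ring.
- have -> : e 0 w = (e 0 w - -1 - - k) - 1 - k by ring.
  by rewrite hw; ring.
Qed.

Lemma kernel_or_support (s k : C) d : jacobi_kernel x y w s k d = 0 \/
  exists n m, d = pt (k + n%:~R - m%:R) m%:R (- 1 - k - n%:~R).
Proof.
have [h|nd] := pselect (exists n m, d = pt (k + n%:~R - m%:R) m%:R (- 1 - k - n%:~R)).
  by right.
by left; apply: kernel_out => n m dE; apply: nd; exists n, m.
Qed.

(** The operators do not involve [z_w], so the exponent of [z_w] fixes the
    index [n] of the delta series, and only the sum over [m] remains. *)
Lemma kernel_mulw (V : lmodType C) (s k : C) (F : C -> C -> V) e n :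
  e 0 w = -1 - k - n%:~R ->
  mul3 (jacobi_kernel x y w s k)
    (fun d => F (d 0 x) (d 0 y) *+ (d 0 w == 0)) e =
  nsum (fun m : nat => (s ^ (- n) * (cbinom (k + n%:~R) m * (-1) ^+ m)) *:
        F (e 0 x - (k + n%:~R - m%:R)) (e 0 y - m%:R)).
Proof.
move=> ew; pose h (m : nat) := pt (k + n%:~R - m%:R) m%:R (- 1 - k - n%:~R).
have hI : injective h.
  by move=> j j' /pt_inj[_ /eqP g _]; apply/eqP; rewrite eqr_nat in g.
rewrite /mul3 (fsum_image hI) => [|d nd].
  apply: eq_nsum => m; rewrite /= kernel_in !subE /h ptx pty ptw ew.
  by rewrite subrr eqxx.
have [->|[n' [m dE]]] := kernel_or_support s k d; first by rewrite scale0r.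
case: eqP => [hw|_]; last by rewrite mulr0n scaler0.
have nn : n = n'.
  apply: intr_injC; move: hw; rewrite subE ew dE ptw => /eqP.
  rewrite subr_eq0 => /eqP hw.
  have -> : n%:~R = -1 - k - (-1 - k - n%:~R) :> C by ring.
  by rewrite hw; ring.
by case: (nd m); rewrite /h dE nn.
Qed.

Lemma kernel_mulw0 (V : lmodType C) (s k : C) (F : C -> C -> V) e :
  (forall n, e 0 w <> -1 - k - n%:~R) ->
  mul3 (jacobi_kernel x y w s k)
    (fun d => F (d 0 x) (d 0 y) *+ (d 0 w == 0)) e = 0.
Proof.
move=> ew; rewrite /mul3 fsbig1 // => d _.
have [->|[n' [m dE]]] := kernel_or_support s k d; first by rewrite scale0r.
case: eqP => [hw|_]; last by rewrite mulr0n scaler0.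
case: (ew n'); move: hw; rewrite subE dE ptw => /eqP.
by rewrite subr_eq0 => /eqP.
Qed.

(** Here the operators do not involve [z_x], whose exponent fixes [n - m]; the
    index of the delta series moves along with [m]. *)
Lemma kernel_mulx (V : lmodType C) (k : C) (F : C -> C -> V) e n :
  e 0 x = k + n%:~R ->
  mul3 (jacobi_kernel x y w 1 k)
    (fun d => F (d 0 y) (d 0 w) *+ (d 0 x == 0)) e =
  nsum (fun m : nat => (cbinom (k + n%:~R + m%:R) m * (-1) ^+ m) *:
        F (e 0 y - m%:R) (e 0 w + 1 + k + n%:~R + m%:R)).
Proof.
move=> ex; pose h (m : nat) := pt (k + (n + m%:Z)%:~R - m%:R) m%:R (- 1 - k - (n + m%:Z)%:~R).
have hI : injective h.
  by move=> j j' /pt_inj[_ /eqP g _]; apply/eqP; rewrite eqr_nat in g.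
have nm m : (n + m%:Z)%:~R = n%:~R + m%:R :> C by rewrite rmorphD /= -pmulrn.
rewrite /mul3 (fsum_image hI) => [|d nd].
  apply: eq_nsum => m; rewrite /= kernel_in exp1rz mul1r !subE /h ptx pty ptw ex nm.
  have -> : k + n%:~R - (k + (n%:~R + m%:R) - m%:R) = 0 :> C by ring.
  rewrite eqxx mulr1n addrA.
  by have -> : e 0 w - (-1 - k - (n%:~R + m%:R)) = e 0 w + 1 + k + n%:~R + m%:R by ring.
have [->|[n' [m dE]]] := kernel_or_support 1 k d; first by rewrite scale0r.
case: eqP => [hw|_]; last by rewrite mulr0n scaler0.
have nn : n' = n + m%:Z.
  apply: intr_injC; rewrite nm; move: hw; rewrite subE ex dE ptx => /eqP.
  rewrite subr_eq0 => /eqP hw.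
  have -> : n'%:~R = (k + n'%:~R - m%:R) - k + m%:R :> C by ring.
  by rewrite -hw; ring.
by case: (nd m); rewrite /h dE nn.
Qed.

Lemma kernel_mulx0 (V : lmodType C) (k : C) (F : C -> C -> V) e :
  (forall n, e 0 x <> k + n%:~R) ->
  mul3 (jacobi_kernel x y w 1 k)
    (fun d => F (d 0 y) (d 0 w) *+ (d 0 x == 0)) e = 0.
Proof.
move=> ex; rewrite /mul3 fsbig1 // => d _.
have [->|[n' [m dE]]] := kernel_or_support 1 k d; first by rewrite scale0r.
case: eqP => [hw|_]; last by rewrite mulr0n scaler0.
case: (ex (n' - m%:Z)); move: hw; rewrite subE dE ptx => /eqP.
rewrite subr_eq0 => /eqP ->; rewrite rmorphB /= -pmulrn; ring.
Qed.

End Kernel.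

(** * Phases *)

Section Phase.
Variable R : realType.
Local Notation C := R[i].

Lemma cexpD (z z' : C) : cexp (z + z') = cexp z * cexp z'.
Proof.
case: z => a b; case: z' => c d; rewrite /cexp /=.
rewrite expRD cosD sinD; apply/eqP; rewrite eq_complex /=.
by apply/andP; split; apply/eqP; ring.
Qed.

Lemma phaseD (N : int) (k k' : C) : phase N (k + k') = phase N k * phase N k'.
Proof. by rewrite /phase mulrDr cexpD. Qed.

Lemma cexp0 : cexp (0 : C) = 1.
Proof.
rewrite /cexp /= expR0 cos0 sin0; apply/eqP.
by rewrite eq_complex /= !mulr0 !mul0r !mulr1 subr0 addr0 !eqxx.
Qed.

Lemma phase0 (N : int) : phase N (0 : C) = 1.
Proof. by rewrite /phase mulr0 cexp0. Qed.

Lemma cexp_pi : cexp (0 +i* pi : C)%C = -1.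
Proof.
rewrite /cexp /= expR0 cospi sinpi; apply/eqP.
by rewrite eq_complex /= !mulr0 !mul0r !mul1r ?subr0 ?addr0 ?oppr0 !eqxx.
Qed.

Lemma cexp_pi_int (n : int) : cexp ((0 +i* pi)%C * n%:~R : C) = (-1) ^ n.
Proof.
have nat_case (m : nat) : cexp ((0 +i* pi)%C * m%:R : C) = (-1) ^+ m.
  elim: m => [|m IH]; first by rewrite mulr0 cexp0.
  by rewrite -natr1 mulrDr mulr1 cexpD IH cexp_pi exprSr.
case: n => n; first by rewrite -pmulrn nat_case.
rewrite NegzE mulrNz -pmulrn mulrN -exprnN invr_sign.
have h : cexp (- ((0 +i* pi)%C * n.+1%:R) : C) * cexp ((0 +i* pi)%C * n.+1%:R) = 1.
  by rewrite -cexpD addNr cexp0.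
rewrite nat_case in h.
have u : ((-1) ^+ n.+1 : C) \is a GRing.unit by rewrite unitrX ?unitrN1.
by apply: (mulIr u); rewrite h -exprMn mulrNN mulr1 expr1n.
Qed.

(** [N] being odd, the branch chosen for the powers of -1 agrees with the sign
    at integers. *)
Lemma phase_int (N n : int) : odd `|N| -> phase N (n%:~R : C) = (-1) ^ n.
Proof.
move=> oN; rewrite /phase.
have -> : (0 +i* (pi * N%:~R))%C * n%:~R = (0 +i* pi)%C * (N * n)%:~R :> C.
  rewrite rmorphM /= mulrA; congr (_ * _); apply/eqP.
  have -> : (N%:~R : C) = (N%:~R : R)%:C%C by rewrite rmorph_int.
  by rewrite eq_complex /= !mulr0 !mul0r ?subr0 ?addr0 ?add0r !eqxx.
rewrite cexp_pi_int; apply/eqP.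
have -> : (-1) ^ (N * n) = ((-1) ^ N) ^ n :> C by rewrite exprz_exp.
have -> // : (-1) ^ N = -1 :> C.
case: N oN => m om; first by rewrite -exprnP -signr_odd om.
by rewrite NegzE -exprnN invr_sign -signr_odd om.
Qed.

End Phase.

(** * The Fock space and its modes *)

Section FreeModule.
Variables (R : realType) (K : choiceType) (V : lmodType R[i]).
Implicit Types (x y : {malg R[i][K]}) (f : K -> V).

(** Linear extensions of different vectors can be compared only over a common
    finite set of basis elements. *)
Lemma extend_wide f x (d : {fset K}) : (msupp x `<=` d)%fset ->
  extend f x = \sum_(k <- d) x@_k *: f k.
Proof.
move=> xd; rewrite unlock; apply: big_fset_incl => // k _ /mcoeff_outdom ->.
by rewrite scale0r.
Qed.

Lemma extend_linear f : linear (extend f).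
Proof.
move=> c x y; pose d := (msupp x `|` msupp y)%fset.
have dx : (msupp x `<=` d)%fset by apply: fsubsetUl.
have dy : (msupp y `<=` d)%fset by apply: fsubsetUr.
have dxy : (msupp (c *: x + y) `<=` d)%fset.
  apply: fsubset_trans (msuppD_le _ _) _; rewrite fsubUset dy andbT.
  exact: fsubset_trans (msuppZ_le _ _) dx.
rewrite (extend_wide f dx) (extend_wide f dy) (extend_wide f dxy).
rewrite scaler_sumr -big_split /=; apply: eq_bigr => k _.
by rewrite mcoeffD mcoeffZ scalerDl scalerA.
Qed.

Lemma extend_ket f k : extend f (ket R k) = f k.
Proof.
have h : (msupp (ket R k) `<=` [fset k])%fset by rewrite unlock msuppU_le.
by rewrite (extend_wide f h) big_seq_fset1 unlock mcoeffUU scale1r.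
Qed.

Lemma ket_ind (P : {malg R[i][K]} -> Prop) : P 0 -> (forall k, P (ket R k)) ->
  (forall c x y, P x -> P y -> P (c *: x + y)) -> forall x, P x.
Proof.
move=> P0 Pk Pl x; rewrite (monalgE x); elim: (enum_fset _) => [|k r IH].
  by rewrite big_nil.
rewrite big_cons.
have -> : << x@_k *g k >> = x@_k *: ket R k.
  by rewrite unlock; apply/malgP => k'; rewrite mcoeffZ !mcoeffU mulr_natr.
exact: Pl.
Qed.

Lemma linear_eq (g h : {malg R[i][K]} -> V) : linear g -> linear h ->
  (forall k, g (ket R k) = h (ket R k)) -> forall x, g x = h x.
Proof.
move=> gl hl gh; apply: ket_ind => // [|c x y IHx IHy]; first by rewrite !lin0.
by rewrite gl hl IHx IHy.
Qed.

End FreeModule.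

Section Fock.
Variables (R : realType) (l : nat).
Local Notation C := R[i].
Local Notation vec := 'rV[C]_l.
Local Notation fb := (fockb l).
Local Notation fock := (fock R l).
Local Notation bigM := (bigM R l).
Implicit Types (m : fb) (i j : 'I_l) (c : vec) (x u : fock).

Definition fock_one : fock := ket R (mset0 : fb).

(** [heis] on a single Fock space; the zero modes are left to [smode]. *)
Definition fock_mode i (n : int) : fock -> fock :=
  extend (fun m : fb => match n with
    | Posz 0 => 0
    | Posz k.+1 => (k.+1 * m (i, k))%N%:R *: ket R (m `\ (i, k))%mset
    | Negz k => ket R ((i, k) +` m)%mset
    end).

Lemma fock_mode_lin i n : linear (fock_mode i n).
Proof. exact: extend_linear. Qed.

Lemma fock_mode_zero i x : fock_mode i 0 x = 0.
Proof.
move: x; apply: linear_eq; first exact: fock_mode_lin.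
  by move=> k x y; rewrite scaler0 addr0.
by move=> m; rewrite /fock_mode extend_ket.
Qed.

Lemma fock_mode_ann i k m :
  fock_mode i k.+1 (ket R m) = (k.+1 * m (i, k))%N%:R *: ket R (m `\ (i, k))%mset.
Proof. by rewrite /fock_mode extend_ket. Qed.

Lemma fock_mode_cre i k m : fock_mode i (Negz k) (ket R m) = ket R ((i, k) +` m)%mset.
Proof. by rewrite /fock_mode extend_ket. Qed.

Lemma fock_mode_one i (n : nat) : fock_mode i n fock_one = 0.
Proof.
case: n => [|n]; first exact: fock_mode_zero.
by rewrite fock_mode_ann mset0E muln0 scale0r.
Qed.

Lemma fock_mode_ann_cre i j k k' m : fock_mode i k.+1 (fock_mode j (Negz k') (ket R m)) =
  fock_mode j (Negz k') (fock_mode i k.+1 (ket R m)) +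
  (if (i == j) && (k == k') then k.+1%:R *: ket R m else 0).
Proof.
rewrite fock_mode_cre !fock_mode_ann (linZ (fock_mode_lin _ _)) fock_mode_cre mset1DE xpair_eqE.
case: andP => [[/eqP -> /eqP ->]|ne]; rewrite ?addr0; last first.
  rewrite /= add0n; congr (_ *: ket R _); apply/msetP => p.
  rewrite msetB1E !mset1DE msetB1E.
  case: (p =P (j, k')) => [->|_]; last by rewrite !add0n.
  case: eqP => [[ij kk]|_]; last by rewrite !subn0.
  by case: ne; rewrite ij kk.
rewrite msetD1K add1n mulnS addnC natrD scalerDl.
case: (posnP (m (j, k'))) => [->|m0]; first by rewrite muln0 !scale0r.
by rewrite msetB1K // in_mset.
Qed.

Lemma fock_modeC i j (n n' : int) x : fock_mode i n (fock_mode j n' x) =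
  fock_mode j n' (fock_mode i n x) +
  (if (i == j) && (n + n' == 0) then n%:~R *: x else 0).
Proof.
have ll i1 i2 n1 n2 : linear (fun x => fock_mode i1 n1 (fock_mode i2 n2 x)).
  exact: (comp_linear (fock_mode_lin _ _) (fock_mode_lin _ _)).
have cl (z : C) (b : bool) : linear (fun x : fock => if b then z *: x else 0).
  by case: b; [exact: scaler_linear|move=> k y y'; rewrite scaler0 addr0].
move: x; apply: linear_eq; [exact: ll|by apply: add_linear|move=> m].
case: n => [[|k]|k]; last first.
- case: n' => [[|k']|k'].
  + by rewrite !fock_mode_zero (lin0 (fock_mode_lin _ _)) add0r andbF.
  + rewrite fock_mode_ann_cre eq_sym.
    have -> : (Negz k + k'.+1%:Z == 0) = (k' == k) by apply/idP/idP; lia.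
    case: andP => [[_ /eqP ->]|_]; last by rewrite !addr0.
    by rewrite NegzE mulrNz -pmulrn scaleNr addrK.
  + have -> : (Negz k + Negz k' == 0) = false by lia.
    rewrite andbF addr0 !fock_mode_cre; congr (ket R _); exact: msetDCA.
- case: n' => [[|k']|k'].
  + by rewrite !fock_mode_zero (lin0 (fock_mode_lin _ _)) add0r andbF.
  + have -> : (k.+1%:Z + k'.+1%:Z == 0) = false by lia.
    rewrite andbF addr0 !fock_mode_ann !(linZ (fock_mode_lin _ _)) !fock_mode_ann !scalerA -!natrM.
    have [e|ne] := eqVneq (i, k) (j, k').
      by case: e => -> ->.
    have -> : (m `\ (j, k') `\ (i, k) = m `\ (i, k) `\ (j, k'))%mset.
      by apply/msetP => p; rewrite !msetB1E subnAC.
    have ne' : ((j, k') == (i, k)) = false by rewrite eq_sym (negbTE ne).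
    by rewrite !msetB1E (negbTE ne) ne' !subn0 [X in X%:R]mulnC.
  + rewrite fock_mode_ann_cre; congr (_ + _).
    by have -> : (k.+1%:Z + Negz k' == 0) = (k == k') by apply/idP/idP; lia.
- by rewrite !fock_mode_zero (lin0 (fock_mode_lin _ _)) scale0r if_same addr0.
Qed.

Lemma ket_mono (s : seq ('I_l * nat)) : ket R (seq_mset s) = mono fock_one fock_mode s.
Proof.
elim: s => [|[i k] s IH] /=.
  by rewrite /fock_one; congr (ket R _); apply/msetP => p; rewrite mset_seqE mset0E.
rewrite -IH fock_mode_cre; congr (ket R _); apply/msetP => p.
by rewrite mset1DE !mset_seqE /= eq_sym.
Qed.

Lemma mono_span_fock (P : fock -> Prop) : (forall s, P (mono fock_one fock_mode s)) ->
  (forall k x y, P x -> P y -> P (k *: x + y)) -> forall x, P x.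
Proof.
move=> Ps Pl; apply: ket_ind => // [|m].
  by have := Pl (-1) _ _ (Ps [::]) (Ps [::]); rewrite scaleN1r addNr.
by rewrite -[m]seq_mset_id ket_mono.
Qed.

(** The basis vector is a multiset, whose factors are taken in the order of
    [enum_mset]; by [Nlist_perm] any other order gives the same field, and
    this is [fock_field_mono]. *)
Definition fock_field u c (n : int) x : fock :=
  extend (fun m : fb => Nlist fock_mode (enum_mset m) c n x) u.

Lemma fock_field_lin c n x : linear (fun u => fock_field u c n x).
Proof. exact: extend_linear. Qed.

Lemma fock_field_ket m c n x : fock_field (ket R m) c n x = Nlist fock_mode (enum_mset m) c n x.
Proof. by rewrite /fock_field extend_ket. Qed.

Lemma fock_field_mono s c n x : fock_field (mono fock_one fock_mode s) c n x = Nlist fock_mode s c n x.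
Proof.
rewrite -ket_mono fock_field_ket.
by rewrite (Nlist_perm fock_mode_lin fock_mode_zero fock_modeC fock_mode_one mono_span_fock c
  (perm_eq_seq_mset s)).
Qed.

Lemma tens_lin c : linear (fun x : fock => tens x c).
Proof. exact: extend_linear. Qed.

Lemma tens_ket m c : tens (ket R m) c = ket R (m, c).
Proof. by rewrite /tens extend_ket. Qed.

Lemma tens0 c : tens (0 : fock) c = 0.
Proof. exact: (lin0 (tens_lin c)). Qed.

Lemma heis_tens i n x c : heis i n (tens x c) = tens (smode fock_mode c i n x) c.
Proof.
move: x; apply: linear_eq.
- exact: (comp_linear (extend_linear _) (tens_lin c)).
- apply: (comp_linear (tens_lin c)); apply: smode_lin; exact: fock_mode_lin.
move=> m; rewrite tens_ket /heis extend_ket /smode (linD (tens_lin c)).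
case: n => [[|k]|k] /=.
- by rewrite fock_mode_zero tens0 add0r (linZ (tens_lin c)) tens_ket.
- by rewrite fock_mode_ann tens0 addr0 (linZ (tens_lin c)) tens_ket.
- by rewrite fock_mode_cre tens0 addr0 tens_ket.
Qed.

Lemma amode_tens (b : vec) n x c : n != 0 ->
  amode b n (tens x c) = tens (amod fock_mode b n x) c.
Proof.
move=> n0; rewrite /amode /amod (lin_sum (tens_lin c)); apply: eq_bigr => i _.
by rewrite heis_tens smodeS // (linZ (tens_lin c)).
Qed.

Lemma expq_tens (b c : vec) x : expq b (tens x c) = tens x (b + c).
Proof.
move: x; apply: linear_eq; [|exact: tens_lin|].
  exact: (comp_linear (extend_linear _) (tens_lin c)).
by move=> m; rewrite !tens_ket /expq extend_ket.
Qed.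

End Fock.

(** * Operator series between charge sectors *)

Section Acts.
Variables (R : realType) (l : nat) (S : lmodType R[i]).
Local Notation C := R[i].
Local Notation vec := 'rV[C]_l.
Local Notation bigM := (bigM R l).
Variable ten : S -> vec -> bigM.
Hypothesis ten_lin : forall c, linear (fun x => ten x c).
Implicit Types (F G : opser R l) (T : int -> S -> S) (c : vec) (d k : C) (x : S).

(** On the copy of [S] with label [c], the series [F] has exponents in [d + Z]
    and modes [T], and it lands in the copy with label [c']. *)
Definition acts F (c c' : vec) d T : Prop :=
  (forall n x, F (d + n%:~R) (ten x c) = ten (T n x) c') /\
  (forall k x, (forall n : int, k <> d + n%:~R) -> F k (ten x c) = 0).

(** Series in nonnegative powers, and in the powers [z^(-d-j)], as fields;
    they connect [acts] with [compL] and [compR]. *)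
Definition creation (p : nat -> S -> S) : int -> S -> S :=
  fun n x => if n is Posz m then p m x else 0.

Definition annihilation (d : nat) (q : nat -> S -> S) : int -> S -> S :=
  fun n x => if - n - d%:Z is Posz m then q m x else 0.

Lemma ten0 c : ten 0 c = 0.
Proof. exact: (lin0 (ten_lin c)). Qed.

Lemma ten_nsum (f : nat -> S) (c : vec) : fin f -> ten (nsum f) c = nsum (fun m => ten (f m) c).
Proof. exact: (lin_nsum (ten_lin c)). Qed.

Lemma coset_sub (d1 d2 k t : C) (n' : int) :
  (forall n : int, k <> d1 + d2 + n%:~R) -> t = d1 + n'%:~R ->
  forall n : int, k - t <> d2 + n%:~R.
Proof.
move=> kn -> n h; apply: (kn (n' + n)); rewrite rmorphD /=.
by rewrite -[k](subrK (d1 + n'%:~R)) h; ring.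
Qed.

Lemma acts_at F (c c' : vec) d T n k x : acts F c c' d T -> k = d + n%:~R ->
  F k (ten x c) = ten (T n x) c'.
Proof. by move=> [FT _] ->. Qed.

Lemma acts_zero F (c c' : vec) d T k : acts F c c' d T -> (forall n, T n 0 = 0) ->
  F k 0 = 0.
Proof.
move=> [FT F0] T0; rewrite -[X in F k X](ten0 c).
have [[n ->]|nk] := pselect (exists n : int, k = d + n%:~R).
  by rewrite FT T0 ten0.
by apply: F0 => n kn; apply: nk; exists n.
Qed.

Lemma acts_ten F (c c' : vec) d T k x : acts F c c' d T ->
  exists y, F k (ten x c) = ten y c'.
Proof.
move=> [FT F0]; have [[n ->]|nk] := pselect (exists n : int, k = d + n%:~R).
  by exists (T n x).
by exists 0; rewrite ten0; apply: F0 => n kn; apply: nk; exists n.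
Qed.

Lemma acts_comp_out F G (c c' c'' : vec) d1 d2 T1 T2 k x :
  acts F c' c'' d1 T1 -> (forall n, T1 n 0 = 0) -> acts G c c' d2 T2 ->
  (forall n : int, k <> d1 + d2 + n%:~R) -> opcomp F G k (ten x c) = 0.
Proof.
move=> Fa T0 Ga kn; rewrite /opcomp fsbig1 // => t _.
have [[n tE]|nt] := pselect (exists n : int, t = d1 + n%:~R).
  by rewrite (Ga.2 _ _ (coset_sub kn tE)) (acts_zero _ Fa T0).
have [y ->] := acts_ten (k - t) x Ga.
by rewrite Fa.2 // => n tn; apply: nt; exists n.
Qed.

(** The formal product sums over all complex exponents; those that contribute
    lie on one progression, indexed by the powers of the creation series. *)
Lemma acts_compL F G (c c' c'' : vec) d1 d2 p T :
  acts F c' c'' d1 (creation p) -> acts G c c' d2 T ->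
  (forall t, linear (p t)) -> isfield T ->
  acts (opcomp F G) c c'' (d1 + d2) (compL p T).
Proof.
move=> Fa Ga pl Tf.
have cr0 n : creation p n 0 = 0 by case: n => n //=; apply: lin0.
split=> [n x|k x kn]; last exact: (acts_comp_out x Fa cr0 Ga kn).
have hI : injective (fun m : nat => d1 + m%:R : C).
  by move=> m m' /addrI /eqP; rewrite eqr_nat => /eqP.
rewrite /opcomp (fsum_image hI) => [|t tn].
  rewrite /compL (ten_nsum c'' (compL_fin n x pl Tf)); apply: eq_nsum => m /=.
  rewrite (acts_at (n := n - m%:Z) x Ga); last by rewrite rmorphB /= -pmulrn; ring.
  by rewrite (acts_at (n := m) _ Fa).
have [[n' tE]|nt] := pselect (exists n' : int, t = d1 + n'%:~R).
  rewrite (acts_at (n := n - n') x Ga); last by rewrite tE rmorphB /=; ring.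
  rewrite (acts_at _ Fa tE); case: n' tE => [m tE|m tE]; first by case: (tn m).
  by rewrite /creation ten0.
have [y ->] := acts_ten (d1 + d2 + n%:~R - t) x Ga.
by rewrite Fa.2 // => n' tn'; apply: nt; exists n'.
Qed.

Lemma acts_compR F G (c c' c'' : vec) d1 d2 (d : nat) q T :
  acts F c' c'' d1 T -> acts G c c' d2 (annihilation d q) ->
  locally_finite q -> isfield T ->
  acts (opcomp F G) c c'' (d1 + d2) (compR d q T).
Proof.
move=> Fa Ga ql Tf; have T0 n : T n 0 = 0 by apply: lin0; apply: Tf.1.
split=> [n x|k x kn]; last exact: (acts_comp_out x Fa T0 Ga kn).
have hI : injective (fun m : nat => d1 + (n + d%:Z + m%:Z)%:~R : C).
  by move=> m m' /addrI /intr_injC; lia.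
rewrite /opcomp (fsum_image hI) => [|t tn].
  rewrite /compR (ten_nsum c'' (compR_fin d n x ql Tf)); apply: eq_nsum => m /=.
  rewrite (acts_at (n := - d%:Z - m%:Z) x Ga); last first.
    by rewrite !rmorphD !rmorphN /=; ring.
  rewrite /annihilation; have -> : - (- d%:Z - m%:Z) - d%:Z = m by lia.
  by rewrite (acts_at (n := n + d%:Z + m%:Z) _ Fa).
have [[n' tE]|nt] := pselect (exists n' : int, t = d1 + n'%:~R).
  rewrite (acts_at (n := n - n') x Ga); last by rewrite tE rmorphB /=; ring.
  rewrite /annihilation; case E : (- (n - n') - d%:Z) => [m|m].
    case: (tn m); rewrite tE; congr (_ + _%:~R); lia.
  by rewrite ten0 (acts_zero _ Fa T0).
have [y ->] := acts_ten (d1 + d2 + n%:~R - t) x Ga.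
by rewrite Fa.2 // => n' tn'; apply: nt; exists n'.
Qed.

Lemma opcomp_constl (h : bigM -> bigM) G k v :
  opcomp (opconst h) G k v = h (G k v).
Proof.
rewrite /opcomp (@fsum_one _ _ _ 0) => [|t t0]; rewrite /opconst.
  by rewrite subr0 eqxx.
by rewrite (negbTE t0).
Qed.

Lemma opcomp_constr F (h : bigM -> bigM) k v : (forall t, F t 0 = 0) ->
  opcomp F (opconst h) k v = F k (h v).
Proof.
move=> F0; rewrite /opcomp (@fsum_one _ _ _ k) => [|t tk]; rewrite /opconst.
  by rewrite subrr eqxx.
by rewrite subr_eq0 eq_sym (negbTE tk) F0.
Qed.

Lemma acts_constl (h : bigM -> bigM) (g : S -> S) G (c c' c'' : vec) d T :
  (forall x, h (ten x c') = ten (g x) c'') -> linear g -> acts G c c' d T ->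
  acts (opcomp (opconst h) G) c c'' d (fun n x => g (T n x)).
Proof.
move=> hg gl [GT G0]; split=> [n x|k x kn]; rewrite opcomp_constl.
  by rewrite GT hg.
by rewrite G0 // -[X in h X](ten0 c') hg (lin0 gl) ten0.
Qed.

Lemma acts_constr F (h : bigM -> bigM) (c c' c'' : vec) d T :
  (forall x, h (ten x c) = ten x c') -> (forall n, T n 0 = 0) -> acts F c' c'' d T ->
  acts (opcomp F (opconst h)) c c'' d T.
Proof.
move=> hg T0 Fa; have F0 t := acts_zero t Fa T0.
split=> [n x|k x kn]; rewrite opcomp_constr // hg; first exact: Fa.1.
exact: Fa.2.
Qed.

Lemma acts_add F G (c c' : vec) d T1 T2 : acts F c c' d T1 -> acts G c c' d T2 ->
  acts (opadd F G) c c' d (fadd T1 T2).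
Proof.
move=> [F1 F0] [G1 G0]; split=> [n x|k x kn]; rewrite /opadd.
  by rewrite F1 G1 /fadd (linD (ten_lin c')).
by rewrite F0 // G0 // addr0.
Qed.

Lemma acts_neg (N : int) F (c c' : vec) d T : acts F c c' d T ->
  acts (opneg N F) c c' d (fun n x => phase N (d + n%:~R) *: T n x).
Proof.
move=> [F1 F0]; split=> [n x|k x kn]; rewrite /opneg.
  by rewrite F1 (linZ (ten_lin c')).
by rewrite F0 // scaler0.
Qed.

Lemma acts_ext F (c c' : vec) d T1 T2 : (forall n x, T1 n x = T2 n x) ->
  acts F c c' d T1 -> acts F c c' d T2.
Proof. by move=> T12 [F1 F0]; split=> // n x; rewrite F1 T12. Qed.

Lemma acts_exponent F (c c' : vec) d d' T : d = d' ->
  acts F c c' d T -> acts F c c' d' T.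
Proof. by move=> ->. Qed.

Lemma opsum_in (J : choiceType) (A : set J) (d : J -> C) (h : J -> bigM -> bigM) j v :
  injective d -> A j -> opsum A d h (d j) v = h j v.
Proof.
move=> dI Aj; rewrite /opsum -(fsbig_widen [set j]%classic).
- by rewrite fsbig_set1 eqxx.
- by move=> i ->.
- move=> i [_ ij] /=; case: eqP => [/dI h1|_ //].
  by case: ij; rewrite h1.
Qed.

Lemma opsum_out (J : choiceType) (A : set J) (d : J -> C) (h : J -> bigM -> bigM) k v :
  (forall j, A j -> k <> d j) -> opsum A d h k v = 0.
Proof.
move=> kn; rewrite /opsum fsbig1 // => j /kn /eqP/negbTE -> //.
Qed.

(** [sg] is 1 for creation and -1 for annihilation. The iterated products of
    the definition reach only the exponents [sg * q], where they are
    [exp_term]. *)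
Lemma opexp_in (sg : int) F (f : nat -> S -> S) (c : vec) (q : nat) x :
  sg != 0 -> (forall j, linear (f j)) ->
  (forall j x, F (sg * j.+1%:Z)%:~R (ten x c) = ten (f j x) c) ->
  (forall k x, (forall j : nat, k <> (sg * j.+1%:Z)%:~R) -> F k (ten x c) = 0) ->
  opexp F (sg * q%:Z)%:~R (ten x c) = ten (exp_coef f q x) c /\
  (forall k, (forall j : nat, k <> (sg * j%:Z)%:~R) -> opexp F k (ten x c) = 0).
Proof.
move=> s0 fl Fin Fout.
have F0 k : F k 0 = 0.
  rewrite -[X in F k X](ten0 c); have [[j ->]|nk] := pselect (exists j : nat, k = (sg * j.+1%:Z)%:~R).
    by rewrite Fin (lin0 (fl j)) ten0.
  by rewrite Fout // => j kj; apply: nk; exists j.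
have sI : injective (fun j : nat => (sg * j.+1%:Z)%:~R : C).
  by move=> j j' /intr_injC /(mulfI s0); lia.
have it r : (forall q : nat, iter r (opcomp F) (opconst id) (sg * q%:Z)%:~R (ten x c) =
      ten (exp_term f r q x) c) /\
   (forall k, (forall j : nat, k <> (sg * j%:Z)%:~R) ->
      iter r (opcomp F) (opconst id) k (ten x c) = 0).
  elim: r => [|r [IH1 IH0]].
    split=> [q'|k kn] /=; rewrite /opconst.
      rewrite intr_eq0 mulf_eq0 (negbTE s0) /=.
      by case: q' => [|q'] //=; rewrite !mulr0n ten0.
    by case: eqP => // k0; case: (kn 0%N); rewrite mulr0.
  have comp k : opcomp F (iter r (opcomp F) (opconst id)) k (ten x c) =
     nsum (fun j : nat => F (sg * j.+1%:Z)%:~R (iter r (opcomp F) (opconst id) (k - (sg * j.+1%:Z)%:~R) (ten x c))).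
    rewrite /opcomp (fsum_image sI) // => t tn.
    have [[j tE]|nt] := pselect (exists j : nat, k - t = (sg * j%:Z)%:~R).
      rewrite [iter _ _ _ _ _](_ : _ = ten (exp_term f r j x) c); last by rewrite tE IH1.
      by rewrite Fout.
    by rewrite [iter _ _ _ _ _]IH0 ?F0 // => j tj; apply: nt; exists j.
  split=> [q'|k kn]; rewrite [iter _.+1 _ _ _ _]comp.
    have st j : (j < q')%N -> F (sg * j.+1%:Z)%:~R (iter r (opcomp F) (opconst id)
        ((sg * q'%:Z)%:~R - (sg * j.+1%:Z)%:~R) (ten x c)) = ten (f j (exp_term f r (q' - j.+1) x)) c.
      move=> jq; have -> : (sg * q'%:Z)%:~R - (sg * j.+1%:Z)%:~R = (sg * (q' - j.+1)%N%:Z)%:~R :> C.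
        by rewrite -rmorphB /= -mulrBr; congr (_ * _)%:~R; lia.
      by rewrite IH1 Fin.
    rewrite (@nsumE _ _ q') => [|j jq]; last first.
      rewrite [iter _ _ _ _ _]IH0 ?F0 // => i; rewrite -rmorphB /= -mulrBr => /intr_injC /(mulfI s0); lia.
    rewrite /= (lin_sum (ten_lin c)); apply: eq_bigr => j _; exact: st.
  apply: nsum_eq0 => j; rewrite [iter _ _ _ _ _]IH0 ?F0 // => i h.
  apply: (kn (i + j.+1)%N).
  rewrite -[k](subrK (sg * j.+1%:Z)%:~R) h -rmorphD /= -mulrDr.
  by congr (_ * _)%:~R; lia.
split=> [|k kn]; rewrite /opexp.
  rewrite -/(nsum _) (@nsumE _ _ q.+1) => [|r qr]; last first.
    by rewrite (it r).1 exp_term_gt // ten0 scaler0.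
  rewrite /exp_coef (lin_sum (ten_lin c)); apply: eq_bigr => r _.
  by rewrite (it r).1 (linZ (ten_lin c)).
by rewrite -/(nsum _) nsum_eq0 // => r; rewrite (it r).2 // scaler0.
Qed.

End Acts.

(** * The vertex operators in terms of modes *)

Section Series.
Variables (R : realType) (S : lmodType R[i]).

(** The series 1, viewed as a creation or an annihilation series, so that the
    factors [z^(a(0))] compose by the general rules. *)
Definition unit_modes (m : nat) (x : S) : S := x *+ (m == 0%N).

Lemma unit_modes_lin m : linear (unit_modes m).
Proof. by move=> k x y; rewrite /unit_modes mulrnDl scalerMnr. Qed.

Lemma unit_modes_lf : locally_finite unit_modes.
Proof. by split=> [m|x]; [exact: unit_modes_lin|exists 1%N => -[|m]]. Qed.

Lemma id_creation n (x : S) : id_field n x = creation unit_modes n x.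
Proof. by case: n => [m|m]. Qed.

Lemma id_annihilation n (x : S) : id_field n x = annihilation 0 unit_modes n x.
Proof.
rewrite /id_field /annihilation subr0.
case E : (- n) => [m|m]; last by have -> : (n == 0) = false by lia.
rewrite /unit_modes; have -> // : (n == 0) = (m == 0%N).
by apply/idP/idP; lia.
Qed.

Lemma compL_unit (T : int -> S -> S) n x : isfield T -> compL unit_modes T n x = T n x.
Proof.
move=> Tf; rewrite /compL (@nsum_one _ _ 0) => [|m m0]; first by rewrite subr0.
by rewrite /unit_modes (negbTE m0) mulr0n.
Qed.

Lemma compR_unit (T : int -> S -> S) n x : isfield T -> compR 0 unit_modes T n x = T n x.
Proof.
move=> Tf; rewrite /compR (@nsum_one _ _ 0) => [|m m0]; first by rewrite !addr0.
by rewrite /unit_modes (negbTE m0) mulr0n (lin0 (Tf.1 _)).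
Qed.

Lemma annihilation_field d (q : nat -> S -> S) : locally_finite q ->
  isfield (annihilation d q).
Proof.
move=> [ql qf]; split=> [n|x].
  rewrite /annihilation; case: (- n - d%:Z) => m; first exact: ql.
  by move=> k x y; rewrite scaler0 addr0.
have [J qJ] := qf x; exists (- d%:Z - J%:Z) => n nJ; rewrite /annihilation.
by case E : (- n - d%:Z) => [m|//]; apply: qJ; lia.
Qed.

(** The substitution of [-z] multiplies [z^(d-m)] by the phase of [d] times
    [(-1)^m]. *)
Lemma phase_annihilation (N : int) (d : R[i]) (q : nat -> S -> S) n x : odd `|N|%N ->
  phase N (d + n%:~R) *: annihilation 0 q n x =
  annihilation 0 (fun m x => phase N d *: ((-1) ^+ m *: q m x)) n x.
Proof.
move=> oN; rewrite /annihilation subr0; case E : (- n) => [m|m]; last by rewrite scaler0.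
have -> : n = - m%:Z by lia.
by rewrite phaseD (phase_int _ _ oN) -exprnN invr_sign scalerA.
Qed.

Lemma eq_annihilation d (q q' : nat -> S -> S) n x : (forall m, q m x = q' m x) ->
  annihilation d q n x = annihilation d q' n x.
Proof. by move=> qq; rewrite /annihilation; case: (- n - d%:Z). Qed.

Lemma annihilation0 d (q : nat -> S -> S) n : (forall m, linear (q m)) ->
  annihilation d q n 0 = 0.
Proof. by move=> ql; rewrite /annihilation; case: (- n - d%:Z) => m //; apply: lin0. Qed.

Lemma compLR_scale (z z' : R[i]) (p q : nat -> S -> S) (T : int -> S -> S) n x :
  (forall t, linear (p t)) -> locally_finite q -> isfield T ->
  compL p (compR 0 (fun m y => z *: q m y) (fun n y => z' *: T n y)) n x =
  (z * z') *: compL p (compR 0 q T) n x.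
Proof.
move=> pl qf Tf; have cL := compL_fin n x pl (compR_field 0 qf Tf).
rewrite [RHS](nsumZ _ cL); apply: eq_nsum => t.
rewrite -(linZ (pl t)); congr (p t _).
rewrite [RHS](nsumZ _ (compR_fin 0 (n - t%:Z) x qf Tf)); apply: eq_nsum => j.
by rewrite (linZ (Tf.1 _)) scalerA mulrC.
Qed.

End Series.

Section Bridge.
Variables (R : realType) (l : nat).
Local Notation C := R[i].
Local Notation vec := 'rV[C]_l.
Local Notation fock := (fock R l).
Local Notation bigM := (bigM R l).
Local Notation ten := (@tens R l).
Local Notation tl := (@tens_lin R l).
Local Notation hmode := (@fock_mode R l).
Local Notation fvop := (vop hmode (@fock_field R l)).
Implicit Types (a b c : vec) (x u : fock) (i : 'I_l).

Lemma fvop_field u b c : isfield (fvop u b c).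
Proof.
exact: (vop_field (@fock_mode_lin R l) (@fock_modeC R l) (@fock_mode_one R l) (@mono_span_fock R l)
  (@fock_field_lin R l) (@fock_field_mono R l)).
Qed.

Lemma fvop_lin_u b c n x : linear (fun u => fvop u b c n x).
Proof.
exact: (vop_lin_u (@fock_mode_lin R l) (@fock_modeC R l) (@fock_mode_one R l) (@mono_span_fock R l)
  (@fock_field_lin R l) (@fock_field_mono R l)).
Qed.

Lemma fvop_shift u b c d n x :
  nsum (fun j : nat => (-1) ^+ j *: fvop (Yp hmode d j u) b c (n + j%:Z) x) = fvop u b (c + d) n x.
Proof.
exact: (vop_shift (@fock_mode_lin R l) (@fock_mode_zero R l) (@fock_modeC R l) (@fock_mode_one R l)
  (@mono_span_fock R l) (@fock_field_lin R l) (@fock_field_mono R l)).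
Qed.

Lemma fvop_add u b d c :
  compL (Ym hmode d) (compR 0 (Yp hmode d) (fvop u b c)) = fvop u (d + b) c.
Proof.
exact: (vop_add (@fock_mode_lin R l) (@fock_modeC R l) (@fock_mode_one R l)
  (@mono_span_fock R l) (@fock_field_lin R l) (@fock_field_mono R l)).
Qed.

Lemma fYm_lin b q : linear (Ym hmode b q).
Proof. exact: (Ym_lin (@fock_mode_lin R l)). Qed.

Lemma fYp_lf b : locally_finite (Yp hmode b).
Proof.
exact: (Yp_lf (@fock_mode_lin R l) (@fock_modeC R l) (@fock_mode_one R l) (@mono_span_fock R l)).
Qed.

Lemma fann_lf c i k : locally_finite (ann hmode c i k).
Proof.
exact: (ann_lf (@fock_mode_lin R l) (@fock_modeC R l) (@fock_mode_one R l) (@mono_span_fock R l)).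
Qed.

Lemma fNlist_field s c : isfield (Nlist hmode s c).
Proof.
exact: (Nlist_field (@fock_mode_lin R l) (@fock_modeC R l) (@fock_mode_one R l) (@mono_span_fock R l)).
Qed.

Lemma fock_field_isfield u c : isfield (fock_field u c).
Proof.
exact: (N_field (@fock_mode_lin R l) (@fock_modeC R l) (@fock_mode_one R l) (@mono_span_fock R l)
  (@fock_field_lin R l) (@fock_field_mono R l)).
Qed.

Lemma natr_inj : injective (fun n : nat => n%:R : C).
Proof. by move=> m n /eqP; rewrite eqr_nat => /eqP. Qed.

Lemma Yplus_acts a c : acts ten (Yplus a) c c 0 (annihilation 0 (Yp hmode a)).
Proof.
have E q x := @opexp_in R l fock ten tl (-1) _ (logYp hmode a) c q x isT (logYp_lin (@fock_mode_lin R l) a).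
pose F := opsum [set n : nat | (0 < n)%N]%classic (fun n => - n%:R : C)
    (fun n v => - (n%:R^-1 *: amode a n%:Z v)).
have Fin j x : F (-1 * j.+1%:Z)%:~R (ten x c) = ten (logYp hmode a j x) c.
  have -> : (-1 * j.+1%:Z)%:~R = - j.+1%:R :> C by rewrite mulN1r mulrNz -pmulrn.
  rewrite /F opsum_in //; last by move=> m n /oppr_inj /natr_inj.
  by rewrite amode_tens // /logYp (linN (tl c)) (linZ (tl c)).
have Fout k x : (forall j : nat, k <> (-1 * j.+1%:Z)%:~R) -> F k (ten x c) = 0.
  move=> kn; apply: opsum_out => -[//|j] _ h; apply: (kn j).
  by rewrite h mulN1r mulrNz -pmulrn.
split=> [n x|k x kn].
  rewrite add0r /annihilation subr0; case E' : (- n) => [m|m].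
    have -> : n = -1 * m%:Z by lia.
    exact: (E _ _ _ Fin Fout).1.
  rewrite tens0; apply: ((E F 0%N x Fin Fout).2 n%:~R) => j /intr_inj; lia.
apply: ((E F 0%N x Fin Fout).2 k) => j kj; apply: (kn (-1 * j%:Z)).
by rewrite add0r.
Qed.

Lemma Yminus_acts a c : acts ten (Yminus a) c c 0 (creation (Ym hmode a)).
Proof.
have E q x := @opexp_in R l fock ten tl 1 _ (logYm hmode a) c q x isT (logYm_lin (@fock_mode_lin R l) a).
pose F := opsum [set n : nat | (0 < n)%N]%classic (fun n => n%:R : C)
    (fun n v => n%:R^-1 *: amode a (- n%:Z) v).
have Fin j x : F (1 * j.+1%:Z)%:~R (ten x c) = ten (logYm hmode a j x) c.
  have -> : (1 * j.+1%:Z)%:~R = j.+1%:R :> C by rewrite mul1r -pmulrn.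
  rewrite /F opsum_in //; last exact: natr_inj.
  by rewrite amode_tens // /logYm NegzE (linZ (tl c)).
have Fout k x : (forall j : nat, k <> (1 * j.+1%:Z)%:~R) -> F k (ten x c) = 0.
  move=> kn; apply: opsum_out => -[//|j] _ h; apply: (kn j).
  by rewrite h mul1r -pmulrn.
split=> [n x|k x kn].
  rewrite add0r /creation; case: n => m.
    have -> : Posz m = 1 * m%:Z by rewrite mul1r.
    exact: (E _ _ _ Fin Fout).1.
  rewrite tens0; apply: ((E F 0%N x Fin Fout).2 (Negz m)%:~R) => j /intr_inj; lia.
apply: ((E F 0%N x Fin Fout).2 k) => j kj; apply: (kn (1 * j%:Z)).
by rewrite add0r.
Qed.

Lemma zpow_tens a c k x : zpow a k (ten x c) = ten x c *+ (k == dot a c).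
Proof.
move: x; apply: linear_eq.
- exact: (comp_linear (extend_linear _) (tl c)).
- move=> z x y /=; rewrite (tl c) mulrnDl scalerMnr //.
by move=> m; rewrite tens_ket /zpow extend_ket.
Qed.

Lemma zpow_acts a c : acts ten (zpow a) c c (dot a c) (@id_field R fock).
Proof.
split=> [n x|k x kn]; rewrite zpow_tens.
  rewrite -[X in _ == X]addr0 (inj_eq (addrI _)) intr_eq0 /id_field.
  by case: (n == 0); rewrite ?mulr1n // !mulr0n tens0.
by case: eqP => // ka; case: (kn 0); rewrite addr0.
Qed.

Lemma dcurrent_neg_acts i k c :
  acts ten (dcurrent [set n : int | n < 0]%classic i k) c c 0 (creation (cre hmode i k)).
Proof.
pose d (n : int) : C := - n%:~R - 1 - k%:R.
have dI : injective d by move=> m n /addIr /addIr /oppr_inj /intr_inj.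
split=> [n x|k' x kn]; last first.
  apply: opsum_out => n _ h; apply: (kn (- n - 1 - k%:Z)).
  by rewrite h !rmorphB rmorphN /= add0r -pmulrn.
rewrite add0r /creation; case: n => t.
  have -> : (Posz t)%:~R = d (Negz (t + k)).
    by rewrite /d NegzE mulrNz opprK -!pmulrn -natr1 natrD; ring.
  have e : - (Negz (t + k))%:~R - 1 = (t + k)%N%:R :> C.
    by rewrite NegzE mulrNz opprK -pmulrn -natr1 addrK.
  by rewrite /dcurrent opsum_in // heis_tens smodeS // /cre (linZ (tl c)) e.
rewrite tens0; have [tk|tk] := ltnP t k; last first.
  apply: opsum_out => n /= n0 h.
  have e : (Negz t)%:~R = (- n - 1 - k%:Z)%:~R :> C.
    by rewrite h !rmorphB rmorphN /= -pmulrn.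
  by move/intr_inj: e; lia.
have -> : (Negz t)%:~R = d (t%:Z - k%:Z).
  by rewrite /d NegzE mulrNz rmorphB /= -!pmulrn -natr1; ring.
rewrite /dcurrent opsum_in //=; last by lia.
have -> : - (t%:Z - k%:Z)%:~R - 1 = (k - t.+1)%N%:R :> C.
  by rewrite natrB // rmorphB /= -!pmulrn -natr1; ring.
rewrite cbinom_nat0 ?scale0r //; lia.
Qed.

Lemma dcurrent_nneg_acts i k c :
  acts ten (dcurrent [set n : int | 0 <= n]%classic i k) c c 0
    (annihilation k.+1 (ann hmode c i k)).
Proof.
pose d (n : int) : C := - n%:~R - 1 - k%:R.
have dI : injective d by move=> m n /addIr /addIr /oppr_inj /intr_inj.
split=> [n x|k' x kn]; last first.
  apply: opsum_out => n _ h; apply: (kn (- n - 1 - k%:Z)).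
  by rewrite h !rmorphB rmorphN /= add0r -pmulrn.
rewrite add0r /annihilation; case E : (- n - k.+1%:Z) => [j|j].
  have -> : n%:~R = d (Posz j).
    have -> : n = - j%:Z - k.+1%:Z by lia.
    by rewrite /d rmorphB rmorphN /= -!pmulrn -natr1; ring.
  rewrite /dcurrent opsum_in // heis_tens /ann (linZ (tl c)) -pmulrn //.
rewrite tens0; apply: opsum_out => m /= m0 h.
have e : n%:~R = (- m - 1 - k%:Z)%:~R :> C.
  by rewrite h !rmorphB rmorphN /= -pmulrn.
by move/intr_inj: e; lia.
Qed.

Lemma normal_product_acts s c : acts ten (@normal_product R l s) c c 0 (Nlist hmode s c).
Proof.
elim: s => [|[i k] s IH] /=.
  split=> [n x|k x kn]; rewrite /opconst.
    rewrite add0r intr_eq0 /id_field.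
    by case: (n == 0); rewrite ?mulr1n // !mulr0n tens0.
  by case: eqP => // k0; case: (kn 0); rewrite addr0.
have A := acts_compL tl (dcurrent_neg_acts i k c) IH (cre_lin (@fock_mode_lin R l) i k) (fNlist_field s c).
have B := acts_compR tl IH (dcurrent_nneg_acts i k c) (fann_lf c i k) (fNlist_field s c).
by rewrite !addr0 in A B; exact: (acts_add tl A B).
Qed.

Lemma Yfock_acts m c : acts ten (Yfock (ket R m)) c c 0 (fock_field (ket R m) c).
Proof.
have [A B] := normal_product_acts (enum_mset m) c.
split=> [n x|k x kn]; rewrite /Yfock extend_ket.
  by rewrite A fock_field_ket.
exact: B.
Qed.

Variables (eps : vec -> vec -> C).

Lemma cocyc_tens a c x : cocyc eps a (ten x c) = eps a c *: ten x c.
Proof.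
move: x; apply: linear_eq.
- exact: (comp_linear (extend_linear _) (tl c)).
- exact: (comp_linear (@scaler_linear _ _ _) (tl c)).
by move=> m; rewrite tens_ket /cocyc extend_ket.
Qed.

Lemma eop_tens a c x : eop eps a (ten x c) = ten (eps a c *: x) (a + c).
Proof. by rewrite /eop cocyc_tens -(linZ (tl c)) expq_tens. Qed.

Lemma calY_ket m a c : acts ten (calY eps (ket R (m, a))) c (a + c) (dot a c)
  (fun n x => eps a c *: fvop (ket R m) a c n x).
Proof.
have qf := fYp_lf a; have pl := fYm_lin a; have qaf := annihilation_field 0 qf.
have Z : acts ten (zpow a) c c (dot a c) (annihilation 0 (@unit_modes R fock)).
  by apply: acts_ext (zpow_acts a c) => n x; exact: id_annihilation.
have A1 := acts_compR tl (Yplus_acts a c) Z (@unit_modes_lf R fock) qaf.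
have A2 : acts ten (opcomp (Yplus a) (zpow a)) c c (dot a c) (annihilation 0 (Yp hmode a)).
  apply: (acts_exponent (add0r _)); apply: acts_ext A1 => n x; exact: compR_unit.
have A3 := acts_compR tl (Yfock_acts m c) A2 qf (fock_field_isfield (ket R m) c).
have Rf := compR_field 0 qf (fock_field_isfield (ket R m) c).
have A4 := acts_compL tl (Yminus_acts a c) A3 pl Rf.
have A5 := acts_constl tl (eop_tens a c) (@scaler_linear _ _ _) A4.
have A6 := acts_exponent (_ : 0 + (0 + dot a c) = dot a c) A5.
have {}A6 := A6 (etrans (add0r _) (add0r _)).
split=> [n x|k x kn]; rewrite /calY extend_ket /=; first exact: A6.1.
exact: A6.2.
Qed.

Lemma calY_tens u a c : acts ten (calY eps (ten u a)) c (a + c) (dot a c)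
  (fun n x => eps a c *: fvop u a c n x).
Proof.
have cl (v : bigM) k : linear (fun u => calY eps (ten u a) k v).
  exact: (comp_linear (extend_linear _) (tl a)).
split=> [n x|k x kn]; move: u; apply: linear_eq => //.
- apply: (comp_linear (tl _)); apply: scale_linear; exact: fvop_lin_u.
- by move=> m; rewrite tens_ket; exact: (calY_ket m a c).1.
- by move=> z y y'; rewrite scaler0 addr0.
- by move=> m; rewrite tens_ket; apply: (calY_ket m a c).2.
Qed.

Variables (N : int) (oN : odd `|N|%N).

Lemma Delta_acts a c : acts ten (Delta N a) c c (dot a c)
  (annihilation 0 (fun m x => (-1) ^+ m *: Yp hmode a m x)).
Proof.
have qf := fYp_lf a.
have sf : locally_finite (fun m x => (-1) ^+ m *: Yp hmode a m x).
  split=> [m|x]; first exact: (scale_linear _ (qf.1 m)).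
  by have [J qJ] := qf.2 x; exists J => m /qJ ->; rewrite scaler0.
have A1 : acts ten (opneg N (Yplus a)) c c 0 (annihilation 0 (fun m x => (-1) ^+ m *: Yp hmode a m x)).
  apply: acts_ext (acts_neg tl N (Yplus_acts a c)) => n x.
  rewrite (phase_annihilation _ _ _ _ oN).
  by apply: eq_annihilation => m; rewrite phase0 scale1r.
have Z : acts ten (zpow a) c c (dot a c) (creation (@unit_modes R fock)).
  by apply: acts_ext (zpow_acts a c) => n x; exact: id_creation.
have af := annihilation_field 0 sf.
have A2 := acts_compL tl Z A1 (@unit_modes_lin R fock) af.
apply: (acts_exponent (addr0 _)); apply: acts_ext A2 => n x; exact: compL_unit.
Qed.

Lemma negDelta_acts a c : acts ten (opneg N (Delta N a)) c c (dot a c)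
  (annihilation 0 (fun m x => phase N (dot a c) *: Yp hmode a m x)).
Proof.
apply: acts_ext (acts_neg tl N (Delta_acts a c)) => n x.
have qf := fYp_lf a.
rewrite (phase_annihilation _ _ _ _ oN).
apply: eq_annihilation => m.
by rewrite (scalerA ((-1) ^+ m)) -exprMn mulrNN mulr1 expr1n scale1r.
Qed.

(** [psi_a] takes the state from charge [mu + a] to the lattice charge [mu],
    and [Delta(b,z)] applied to it moves the zero modes from [c] to [c + b],
    by [fvop_shift]. *)
Lemma calYser_acts u mu a b c :
  acts ten (calYser eps (fun t => opcomp (opconst (psi a)) (Delta N b) t (ten u (mu + a))))
    c (mu + c) (dot b (mu + a) + dot mu c)
    (fun n x => eps mu c *: fvop u mu (c + b) n x).
Proof.
have qf := fYp_lf b.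
pose U t := opcomp (opconst (psi a)) (Delta N b) t (ten u (mu + a)).
have psit x : psi a (ten x (mu + a)) = ten x mu.
  by rewrite /psi expq_tens addrCA addNr addr0.
have [D1 D0] := acts_constl tl psit (fun k x y => erefl : (k *: x + y : fock) = _) (Delta_acts b (mu + a)).
have Uj (j : nat) : U (dot b (mu + a) + (- j%:Z)%:~R) = ten ((-1) ^+ j *: Yp hmode b j u) mu.
  by rewrite /U D1 /annihilation opprK subr0.
have Uneg (j : nat) : U (dot b (mu + a) + (j.+1%:Z)%:~R) = 0.
  by rewrite /U D1 /annihilation subr0 tens0.
have calY0 k v : calY eps 0 k v = 0 by rewrite /calY (lin0 (extend_linear _)).
have hI : injective (fun j : nat => dot b (mu + a) + (- j%:Z)%:~R : C).
  by move=> m m' /addrI /intr_inj; lia.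
have S k v : calYser eps U k v = nsum (fun j : nat =>
    calY eps (ten ((-1) ^+ j *: Yp hmode b j u) mu) (k - (dot b (mu + a) + (- j%:Z)%:~R)) v).
  rewrite /calYser (fsum_image hI) => [|t tn].
    by apply: eq_nsum => j; rewrite /= Uj.
  have [[n tE]|nt] := pselect (exists n : int, t = dot b (mu + a) + n%:~R); last first.
    by rewrite [U t](D0) ?calY0 // => n tE; apply: nt; exists n.
  case: n tE => [[|n]|n] tE.
  - by case: (tn 0%N).
  - by rewrite tE Uneg calY0.
  - by case: (tn n.+1).
have CY v := calY_tens v mu c.
split=> [n x|k x kn]; rewrite S.
  rewrite -fvop_shift.
  have ff : fin (fun j : nat => (-1) ^+ j *: fvop (Yp hmode b j u) mu c (n + j%:Z) x).
    have [J qJ] := qf.2 u; exists J => m /qJ ->.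
    by rewrite (lin0 (fvop_lin_u _ _ _ _)) scaler0.
  rewrite (nsumZ _ ff) (lin_nsum (tl _)); last exact: finZ.
  apply: eq_nsum => j; rewrite /= (acts_at (n := n + j%:Z) x (CY _)); last first.
    by rewrite rmorphN rmorphD /= -!pmulrn; ring.
  by rewrite (linZ (fvop_lin_u _ _ _ _)).
apply: nsum_eq0 => j; apply: (CY _).2 => n h; apply: (kn (n - j%:Z)).
rewrite -[k](subrK (dot b (mu + a) + (- j%:Z)%:~R)) h rmorphB rmorphN /= -!pmulrn; ring.
Qed.

Lemma dotDl (a b c : vec) : dot (a + b) c = dot a c + dot b c.
Proof. by rewrite /dot -big_split /=; apply: eq_bigr => i _; rewrite !mxE mulrDl. Qed.

Lemma dotDr (a b c : vec) : dot a (b + c) = dot a b + dot a c.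
Proof. by rewrite /dot -big_split /=; apply: eq_bigr => i _; rewrite !mxE mulrDr. Qed.

(** The operator of charge [mu] on zero modes [nu + b] given by [calYser_acts]
    is completed to the full charge [mu + a] by the outer factors [Y_-(a,z)]
    and [Y_+(a,z)], with [fvop_add]. The powers of z add up to [(mu + a).(nu +
    b)], and the constants are the cocycle and the phase of [(-z)^(a(0))]. *)
Lemma Yab_acts u mu nu a b :
  acts ten (Yab eps N a b (ten u (mu + a))) (nu + b) ((mu + nu) + (a + b))
    (dot (mu + a) (nu + b))
    (fun n x => (phase N (dot a nu) * eps mu nu) *: fvop u (mu + a) (nu + b) n x).
Proof.
have qf := fYp_lf a; have pl := fYm_lin a.
pose q' m x := phase N (dot a nu) *: Yp hmode a m x.
have q'f : locally_finite q'.
  split=> [m|x]; first exact: (scale_linear _ (qf.1 m)).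
  by have [J qJ] := qf.2 x; exists J => m /qJ h; rewrite /q' h scaler0.
have psit x : psi b (ten x (nu + b)) = ten x nu.
  by rewrite /psi expq_tens addrCA addNr addr0.
have an0 n : annihilation 0 q' n 0 = 0 by apply: annihilation0; exact: q'f.1.
have A1 := acts_constr tl psit an0 (negDelta_acts a nu).
have TT := fvop_field u mu (nu + b).
have Tf : isfield (fun n x => eps mu nu *: fvop u mu (nu + b) n x).
  split=> [n|x]; first exact: (scale_linear _ (TT.1 n)).
  by have [M TM] := TT.2 x; exists M => n /TM ->; rewrite scaler0.
have A2 := acts_compR tl (calYser_acts u mu a b nu) A1 q'f Tf.
have A3 := acts_compL tl (Yminus_acts a (mu + nu)) A2 pl (compR_field 0 q'f Tf).
have psit' x : psi (- a - b) (ten x (mu + nu)) = ten x ((mu + nu) + (a + b)).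
  by rewrite /psi expq_tens opprD !opprK addrC.
have A4 := acts_constl tl psit' (fun k x y => erefl : (k *: x + y : fock) = _) A3.
apply: acts_exponent (acts_ext _ A4).
  rewrite !dotDl !dotDr (dotC b mu) (dotC b a); ring.
move=> n x; rewrite (addrC mu a) -fvop_add.
exact: (compLR_scale _ _ n x pl qf TT).
Qed.

End Bridge.

(** * The three terms of the identity *)

Section Terms.
Variables (R : realType) (S V : lmodType R[i]).
Local Notation C := R[i].
Variable g : S -> V.
Hypothesis gl : linear g.
Implicit Types (F : C -> C -> V) (G : int -> int -> S) (e : 'rV[C]_3).

(** The series of the identity have exponents in such cosets, one for each
    variable. *)
Definition coset (d k : C) : Prop := exists n : int, k = d + n%:~R.

Lemma coset_shift (d k : C) (n : int) : coset d (k + n%:~R) -> coset d k.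
Proof.
move=> [m h]; exists (m - n); rewrite rmorphB /= -[k](addrK (n%:~R)) h; ring.
Qed.

(** The kernel of a product is expanded in the variables of its two operators.
    The integer [z] is the part of its exponent that comes from products of
    lattice vectors; it shifts the delta series, which costs the sign [s ^ z]. *)
Lemma product_term (x y w : 'I_3) (s lam d1 d2 kap : C) (z : int) F G e :
  x != y -> x != w -> y != w -> (forall i, [|| i == x, i == y | i == w]) ->
  biser G ->
  (forall p q : int, F (lam + d1 + p%:~R) (d2 + q%:~R) = kap *: g (G p q)) ->
  (forall p q : C, ~ coset (lam + d1) p \/ ~ coset d2 q -> F p q = 0) ->
  let K := mul3 (jacobi_kernel x y w s (- lam + z%:~R))
     (fun d => F (d 0 x) (d 0 y) *+ (d 0 w == 0)) e in
  (forall e0 e1 e2 : int, e 0 w = lam + e0%:~R -> e 0 x = d1 + e1%:~R ->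
     e 0 y = d2 + e2%:~R ->
     K = (s ^ (1 + z + e0) * kap) *: g (Theta (-1) lam G e0 e1 e2)) /\
  (~ coset lam (e 0 w) \/ ~ coset d1 (e 0 x) \/ ~ coset d2 (e 0 y) -> K = 0).
Proof.
move=> xy xw yw cov Gb Fin Fout K.
have KE (e0 : int) : e 0 w = lam + e0%:~R -> K = nsum (fun m : nat =>
    (s ^ (1 + z + e0) * ((-1) ^+ m * cbinom (-1 - e0%:~R - lam) m)) *:
      F (e 0 x + (lam + (1 + e0 + m%:Z)%:~R)) (e 0 y + (- m%:Z)%:~R)).
  (* The index of the delta series: [- 1 - k - n] is the exponent [lam + e0]. *)
  move=> ew; rewrite /K (@kernel_mulw _ x y w xy xw yw cov _ s _ _ _ (- (1 + z + e0))); last first.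
    by rewrite ew !rmorphN !rmorphD /=; ring.
  apply: eq_nsum => m; rewrite opprK [in RHS](mulrC ((-1) ^+ m)).
  have -> : - lam + z%:~R + (- (1 + z + e0))%:~R = -1 - e0%:~R - lam :> C.
    by rewrite !rmorphN !rmorphD /=; ring.
  have -> : e 0 x - (-1 - e0%:~R - lam - m%:R) = e 0 x + (lam + (1 + e0 + m%:Z)%:~R).
    by rewrite !rmorphD /= -pmulrn; ring.
  by rewrite rmorphN /= -pmulrn.
split=> [e0 e1 e2 ew ex ey|out].
  rewrite (KE _ ew) /Theta (lin_nsum gl (biser_fin _ _ _ Gb)).
  rewrite (nsumZ _ (lin_fin gl (biser_fin _ _ _ Gb))); apply: eq_nsum => m /=.
  have -> : e 0 x + (lam + (1 + e0 + m%:Z)%:~R) = lam + d1 + (e1 + 1 + e0 + m%:Z)%:~R.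
    by rewrite ex !rmorphD /=; ring.
  have -> : e 0 y + (- m%:Z)%:~R = d2 + (e2 - m%:Z)%:~R.
    by rewrite ey rmorphB rmorphN /=; ring.
  by rewrite Fin (linZ gl) !scalerA; congr (_ *: _); ring.
have [[e0 ew]|nw] := pselect (coset lam (e 0 w)); last first.
  rewrite /K kernel_mulw0 // => n ew; apply: nw; exists (- 1 - z - n).
  by rewrite ew !rmorphB rmorphN /=; ring.
rewrite (KE _ ew); apply: nsum_eq0 => m; rewrite Fout ?scaler0 //.
case: out => [nw|[nx|ny]]; first by case: nw; exists e0.
  left=> -[n h]; apply: nx; exists (n - (1 + e0 + m%:Z)).
  rewrite rmorphB /= -[e 0 x](addrK (lam + (1 + e0 + m%:Z)%:~R)) h; ring.
by right=> /coset_shift.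
Qed.

(** In the third kernel the operators involve the second and the third
    variable, and the first one selects the coefficient. *)
Lemma iterate_term (x y w : 'I_3) (lam nu xi kap : C) (z : int) F G e :
  x != y -> x != w -> y != w -> (forall i, [|| i == x, i == y | i == w]) ->
  biser G ->
  (forall s r : int, F (lam + r%:~R) (nu + xi + s%:~R) = kap *: g (G s r)) ->
  (forall p q : C, ~ coset lam p \/ ~ coset (nu + xi) q -> F p q = 0) ->
  let K := mul3 (jacobi_kernel x y w 1 (nu - z%:~R))
     (fun d => F (d 0 y) (d 0 w) *+ (d 0 x == 0)) e in
  (forall e0 e1 e2 : int, e 0 y = lam + e0%:~R -> e 0 x = nu + e1%:~R ->
     e 0 w = xi + e2%:~R ->
     K = kap *: g (Theta 1 nu G e1 e2 e0)) /\
  (~ coset lam (e 0 y) \/ ~ coset nu (e 0 x) \/ ~ coset xi (e 0 w) -> K = 0).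
Proof.
move=> xy xw yw cov Gb Fin Fout K.
have KE (e1 : int) : e 0 x = nu + e1%:~R -> K = nsum (fun m : nat =>
    (1 ^+ m * cbinom (-1 - e1%:~R - nu) m) *:
      F (e 0 y + (- m%:Z)%:~R) (e 0 w + (nu + (1 + e1 + m%:Z)%:~R))).
  (* The exponent [nu + e1] is [k + n] with [k = nu - z]. *)
  move=> ex; rewrite /K (@kernel_mulx _ x y w xy xw yw cov _ _ _ _ (e1 + z)); last first.
    by rewrite ex rmorphD /=; ring.
  apply: eq_nsum => m; rewrite expr1n mul1r.
  have -> : nu - z%:~R + (e1 + z)%:~R = nu + e1%:~R :> C by rewrite rmorphD /=; ring.
  have -> : e 0 w + 1 + (nu - z%:~R) + (e1 + z)%:~R + m%:R =
      e 0 w + (nu + (1 + e1 + m%:Z)%:~R).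
    by rewrite !rmorphD /= -pmulrn; ring.
  have -> : -1 - e1%:~R - nu = - (nu + e1%:~R) - 1 :> C by ring.
  by rewrite cbinom_neg mulrC rmorphN /= -pmulrn.
split=> [e0 e1 e2 ey ex ew|out].
  rewrite (KE _ ex) /Theta (lin_nsum gl (biser_fin _ _ _ Gb)).
  rewrite (nsumZ _ (lin_fin gl (biser_fin _ _ _ Gb))); apply: eq_nsum => m /=.
  have -> : e 0 w + (nu + (1 + e1 + m%:Z)%:~R) = nu + xi + (e2 + 1 + e1 + m%:Z)%:~R.
    by rewrite ew !rmorphD /=; ring.
  have -> : e 0 y + (- m%:Z)%:~R = lam + (e0 - m%:Z)%:~R.
    by rewrite ey rmorphB rmorphN /=; ring.
  by rewrite Fin (linZ gl) !scalerA mulrC.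
have [[e1 ex]|nx] := pselect (coset nu (e 0 x)); last first.
  rewrite /K kernel_mulx0 // => n ex; apply: nx; exists (n - z).
  by rewrite ex rmorphB /=; ring.
rewrite (KE _ ex); apply: nsum_eq0 => m; rewrite Fout ?scaler0 //.
case: out => [ny|[nx|nw]]; first by left=> /coset_shift.
  by case: nx; exists e1.
right=> -[n h]; apply: nw; exists (n - (1 + e1 + m%:Z)).
rewrite rmorphB /= -[e 0 w](addrK (nu + (1 + e1 + m%:Z)%:~R)) h; ring.
Qed.

(** If an exponent lies outside the coset of its variable then all three terms
    vanish; otherwise they are the three terms of the identity for the modes
    [G1], [G2], [G3]. The factor [(-1) ^ n12] is the sign of [product_term]
    for the second product. *)
Lemma jacobi_of_modes (lam nu xi kap kap2 c : C) (n12 n13 : int)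
    (F1 F2 F3 : C -> C -> V) (G1 G2 G3 : int -> int -> S) :
  biser G1 -> biser G2 -> biser G3 ->
  (forall p q : int, F1 (lam + nu + p%:~R) (xi + q%:~R) = kap *: g (G1 p q)) ->
  (forall p q : int, F2 (lam + xi + p%:~R) (nu + q%:~R) = kap2 *: g (G2 p q)) ->
  (forall s r : int, F3 (lam + r%:~R) (nu + xi + s%:~R) = kap *: g (G3 s r)) ->
  (forall p q, ~ coset (lam + nu) p \/ ~ coset xi q -> F1 p q = 0) ->
  (forall p q, ~ coset (lam + xi) p \/ ~ coset nu q -> F2 p q = 0) ->
  (forall p q, ~ coset lam p \/ ~ coset (nu + xi) q -> F3 p q = 0) ->
  c * (-1) ^ n12 * kap2 = kap ->
  (forall e0 e1 e2 : int,
     Theta (-1) lam G1 e0 e1 e2 - (-1) ^ (1 + e0) *: Theta (-1) lam G2 e0 e2 e1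
     = Theta 1 nu G3 e1 e2 e0) ->
  forall e,
    mul3 (jacobi_kernel z1 z2 z0 1 (- lam + n12%:~R))
      (fun d => F1 (d 0 z1) (d 0 z2) *+ (d 0 z0 == 0)) e
    - c *: mul3 (jacobi_kernel z2 z1 z0 (-1) (- lam + n12%:~R))
      (fun d => F2 (d 0 z2) (d 0 z1) *+ (d 0 z0 == 0)) e
    = mul3 (jacobi_kernel z1 z0 z2 1 (nu - n13%:~R))
      (fun d => F3 (d 0 z0) (d 0 z2) *+ (d 0 z1 == 0)) e.
Proof.
move=> b1 b2 b3 in1 in2 in3 out1 out2 out3 hc jac e.
have cov1 : forall i : 'I_3, [|| i == z1, i == z2 | i == z0].
  by case=> [[|[|[|]]]].
have cov2 : forall i : 'I_3, [|| i == z2, i == z1 | i == z0].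
  by case=> [[|[|[|]]]].
have cov3 : forall i : 'I_3, [|| i == z1, i == z0 | i == z2].
  by case=> [[|[|[|]]]].
have comb (K1 K2 K3 x1 x2 x3 : V) : K1 = x1 -> K2 = x2 -> K3 = x3 ->
  x1 - c *: x2 = x3 -> K1 - c *: K2 = K3 by move=> -> -> ->.
have zero : 0 - c *: 0 = 0 :> V by rewrite scaler0 subr0.
have [t1 o1] := product_term (x := z1) (y := z2) (w := z0) 1 n12 e isT isT isT cov1 b1 in1 out1.
have [t2 o2] := product_term (x := z2) (y := z1) (w := z0) (-1) n12 e isT isT isT cov2 b2 in2 out2.
have [t3 o3] := iterate_term (x := z1) (y := z0) (w := z2) n13 e isT isT isT cov3 b3 in3 out3.
have [[e0 h0]|h0] := pselect (coset lam (e 0 z0)); last first.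
  exact: comb (o1 (or_introl h0)) (o2 (or_introl h0)) (o3 (or_introl h0)) zero.
have [[e1 h1]|h1] := pselect (coset nu (e 0 z1)); last first.
  exact: comb (o1 (or_intror (or_introl h1))) (o2 (or_intror (or_intror h1))) (o3 (or_intror (or_introl h1))) zero.
have [[e2 h2]|h2] := pselect (coset xi (e 0 z2)); last first.
  exact: comb (o1 (or_intror (or_intror h2))) (o2 (or_intror (or_introl h2))) (o3 (or_intror (or_intror h2))) zero.
apply: comb (t1 _ _ _ h0 h1 h2) (t2 _ _ _ h0 h2 h1) (t3 _ _ _ h0 h1 h2) _.
rewrite -jac (linB gl) (linZ gl) scalerBr exp1rz mul1r !scalerA; congr (_ - _ *: _).
have -> : 1 + n12 + e0 = n12 + (1 + e0) by ring.
rewrite -hc expfzDr ?oppr_eq0 ?oner_eq0 //; ring.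
Qed.

End Terms.

(** * Cocycle and phase constants *)

Section Constants.
Variables (R : realType) (l : nat).
Local Notation C := R[i].
Local Notation vec := 'rV[C]_l.

Lemma dot_toC (x y : 'rV[R]_l) : dot (toC x) (toC y) = (dot x y)%:C%C.
Proof.
by rewrite /dot rmorph_sum; apply: eq_bigr => i _; rewrite !mxE rmorphM.
Qed.

Lemma sgnpow_int (z : int) : sgnpow (z%:~R : R) = (-1) ^ z.
Proof. by rewrite /sgnpow intrKfloor. Qed.

Lemma ket_scale_inj (K : choiceType) (k : K) (z z' : C) :
  z *: ket R k = z' *: ket R k -> z = z'.
Proof.
move/(congr1 (fun v => v@_k)); rewrite !mcoeffZ ket.unlock mcoeffUU !mulr1 //.
Qed.

(** The associativity of [e^a e^b e^c], tested on one basis vector. *)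
Lemma eps_cocycle (eps : vec -> vec -> C) :
  (forall a b v, eop eps a (eop eps b v) = eps a b *: eop eps (a + b) v) ->
  forall a b c, eps b c * eps a (b + c) = eps a b * eps (a + b) c.
Proof.
move=> H a b c; have := H a b (tens (fock_one R l) c).
have ezl z (x : fock R l) d : tens (z *: x) d = z *: tens x d.
  exact: (linZ (@tens_lin R l _)).
have ee x d y : eop eps x (eop eps y (tens (fock_one R l) d)) =
    (eps y d * eps x (y + d)) *: tens (fock_one R l) (x + (y + d)).
  by rewrite (eop_tens eps y) (eop_tens eps x) ezl ezl scalerA mulrC.
rewrite ee (eop_tens eps (a + b)) ezl -addrA scalerA tens_ket.
exact: ket_scale_inj.
Qed.

End Constants.

(** * The operators Y_a in terms of modes *)

Section Sectors.
Variables (R : realType) (l : nat).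
Local Notation C := R[i].
Local Notation vec := 'rV[C]_l.
Local Notation fock := (fock R l).
Local Notation bigM := (bigM R l).
Local Notation ten := (@tens R l).
Local Notation tl := (@tens_lin R l).
Local Notation fvop := (vop (@fock_mode R l) (@fock_field R l)).
Variables (eps : vec -> vec -> C) (N : int) (oN : odd `|N|%N).
Implicit Types (a b mu : vec) (u v w : fock).

Definition Yab_const a mu nu : C := phase N (dot a nu) * eps mu nu.

(** [Yab_acts] in terms of the full charges [bu] and [bv] only; the sector
    labels of the following lemmas agree with these up to the order of
    summation. *)
Lemma Yab_charge u mu nu a b (bu bv : vec) : bu = mu + a -> bv = nu + b ->
  acts ten (Yab eps N a b (ten u bu)) bv (bu + bv) (dot bu bv)
    (fun n x => Yab_const a mu nu *: fvop u bu bv n x).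
Proof. by move=> -> ->; rewrite addrACA; exact: Yab_acts. Qed.

Lemma Yab_modes0 u (k : C) (bu bv : vec) n : k *: fvop u bu bv n 0 = 0.
Proof. by rewrite (lin0 ((fvop_field u bu bv).1 n)) scaler0. Qed.

Lemma acts_out (F : opser R l) (c c' : vec) d T' k x : acts ten F c c' d T' ->
  ~ coset d k -> F k (ten x c) = 0.
Proof. by move=> [_ F0] dk; apply: F0 => n h; apply: dk; exists n. Qed.

Variables (mu1 mu2 mu3 a1 a2 a3 : vec).
Local Notation b1 := (mu1 + a1).
Local Notation b2 := (mu2 + a2).
Local Notation b3 := (mu3 + a3).
Variables (u v w : fock).

Lemma Yproduct_modes : 
  let F p q := Yab eps N a1 (a2 + a3) (ten u b1) p (Yab eps N a2 a3 (ten v b2) q (ten w b3)) in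
  (forall p q : int, F (dot b1 (b2 + b3) + p%:~R) (dot b2 b3 + q%:~R) =
    (Yab_const a1 mu1 (mu2 + mu3) * Yab_const a2 mu2 mu3) *:
       ten (fvop u b1 (b2 + b3) p (fvop v b2 b3 q w)) (b1 + (b2 + b3))) /\
  (forall p q : C, ~ coset (dot b1 (b2 + b3)) p \/ ~ coset (dot b2 b3) q -> F p q = 0).
Proof.
move=> F.
have A : acts ten (Yab eps N a2 a3 (ten v b2)) b3 (b2 + b3) (dot b2 b3)
    (fun n x => Yab_const a2 mu2 mu3 *: fvop v b2 b3 n x) by exact: Yab_charge.
have B : acts ten (Yab eps N a1 (a2 + a3) (ten u b1)) (b2 + b3) (b1 + (b2 + b3))
    (dot b1 (b2 + b3)) (fun n x => Yab_const a1 mu1 (mu2 + mu3) *: fvop u b1 (b2 + b3) n x).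
  by apply: Yab_charge => //; rewrite addrACA.
split=> [p q|p q [po|qo]]; rewrite /F.
- rewrite A.1 B.1 (linZ ((fvop_field u b1 (b2 + b3)).1 p)) (linZ (tl _)) (linZ (tl _)).
  by rewrite scalerA.
- have [y ->] := acts_ten tl q w A; exact: (acts_out _ B).
- rewrite (acts_out w A) //; apply: (acts_zero tl p B) => n; exact: Yab_modes0.
Qed.

Lemma Yiterate_modes :
  let F p q := Yab eps N (a1 + a2) a3 (Yab eps N a1 a2 (ten u b1) p (ten v b2)) q (ten w b3) in
  (forall r s : int, F (dot b1 b2 + r%:~R) (dot (b1 + b2) b3 + s%:~R) =
    (Yab_const (a1 + a2) (mu1 + mu2) mu3 * Yab_const a1 mu1 mu2) *:
       ten (fvop (fvop u b1 b2 r v) (b1 + b2) b3 s w) (b1 + b2 + b3)) /\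
  (forall p q : C, ~ coset (dot b1 b2) p \/ ~ coset (dot (b1 + b2) b3) q -> F p q = 0).
Proof.
move=> F.
have A : acts ten (Yab eps N a1 a2 (ten u b1)) b2 (b1 + b2) (dot b1 b2)
    (fun n x => Yab_const a1 mu1 mu2 *: fvop u b1 b2 n x) by exact: Yab_charge.
have B y : acts ten (Yab eps N (a1 + a2) a3 (ten y (b1 + b2))) b3 (b1 + b2 + b3)
    (dot (b1 + b2) b3) (fun n x => Yab_const (a1 + a2) (mu1 + mu2) mu3 *: fvop y (b1 + b2) b3 n x).
  by apply: Yab_charge => //; rewrite addrACA.
split=> [p q|p q [po|qo]]; rewrite /F.
- rewrite A.1 (B _).1 (linZ (fvop_lin_u (b1 + b2) b3 q w)) (linZ (tl _)) (linZ (tl _)).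
  by rewrite scalerA.
- rewrite (acts_out v A) // -[X in Yab _ _ _ _ X](@tens0 R l (b1 + b2)).
  have [[n ->]|qo] := pselect (coset (dot (b1 + b2) b3) q); last exact: (acts_out _ (B _)).
  by rewrite (B _).1 (lin0 (fvop_lin_u (b1 + b2) b3 n w)) scaler0 tens0.
- have [y ->] := acts_ten tl p v A; exact: (acts_out _ (B _)).
Qed.

End Sectors.

(** * The generalized Jacobi identity *)

Section FockJacobi.
Variables (R : realType) (l : nat).
Local Notation hmode := (@fock_mode R l).
Local Notation hfield := (@fock_field R l).
Variables (bu bv bw : 'rV[R[i]]_l) (u v w : fock R l).

Lemma fprod12_biser : biser (prod12 hmode hfield bu bv bw u v w).
Proof.
exact: (prod12_biser (@fock_mode_lin R l) (@fock_modeC R l) (@fock_mode_one R l)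
  (@mono_span_fock R l) (@fock_field_lin R l) (@fock_field_mono R l)).
Qed.

Lemma fprod21_biser : biser (prod21 hmode hfield bu bv bw u v w).
Proof.
exact: (prod21_biser (@fock_mode_lin R l) (@fock_modeC R l) (@fock_mode_one R l)
  (@mono_span_fock R l) (@fock_field_lin R l) (@fock_field_mono R l)).
Qed.

Lemma fiterate_biser : biser (iterate hmode hfield bu bv bw u v w).
Proof.
exact: (iterate_biser (@fock_mode_lin R l) (@fock_modeC R l) (@fock_mode_one R l)
  (@mono_span_fock R l) (@fock_field_lin R l) (@fock_field_mono R l)).
Qed.

Lemma fock_jacobi (e0 e1 e2 : int) :
  Theta (-1) (dot bu bv) (prod12 hmode hfield bu bv bw u v w) e0 e1 e2
  - (-1) ^ (1 + e0) *: Theta (-1) (dot bu bv) (prod21 hmode hfield bu bv bw u v w) e0 e2 e1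
  = Theta 1 (dot bu bw) (iterate hmode hfield bu bv bw u v w) e1 e2 e0.
Proof.
exact: (jacobi (@fock_mode_lin R l) (@fock_mode_zero R l) (@fock_modeC R l) (@fock_mode_one R l)
  (@mono_span_fock R l) (@fock_field_lin R l) (@fock_field_mono R l)).
Qed.

End FockJacobi.

Section Main.
Variables (R : realType) (l : nat).
Local Notation C := R[i].
Local Notation vec := 'rV[C]_l.
Local Notation fvop := (vop (@fock_mode R l) (@fock_field R l)).
Variables (L : set 'rV[R]_l) (eps : vec -> vec -> C) (N : int).
Hypotheses (heps : cocycle_structure eps L).

(** The cocycle identity for [eps], together with the additivity of the phases
    on both sides. *)
Lemma Yab_const_assoc a1 a2 mu1 mu2 mu3 :
  Yab_const eps N (a1 + a2) (mu1 + mu2) mu3 * Yab_const eps N a1 mu1 mu2 =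
  Yab_const eps N a1 mu1 (mu2 + mu3) * Yab_const eps N a2 mu2 mu3.
Proof.
have [_ _ ee _ _] := heps.
have := eps_cocycle ee mu1 mu2 mu3; rewrite /Yab_const dotDl dotDr !phaseD => h.
transitivity (phase N (dot a1 mu3) * phase N (dot a2 mu3) * phase N (dot a1 mu2) *
  (eps mu1 mu2 * eps (mu1 + mu2) mu3)); first by ring.
by rewrite -h; ring.
Qed.

Lemma eps_swap mu1 mu2 (n q : int) : L mu1 -> L mu2 ->
  dot mu1 mu2 = n%:~R -> dot mu1 mu1 * dot mu2 mu2 = q%:~R ->
  eps (toC mu1) (toC mu2) = (-1) ^ (n + q) * eps (toC mu2) (toC mu1).
Proof.
have [e0 _ _ _ hC] := heps; move=> h1 h2 hn hq.
have := hC _ _ h1 h2; rewrite hn hq -rmorphD /= sgnpow_int => <-.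
by rewrite divfK.
Qed.

(** After [Yab_const_assoc] only [eps mu1 mu2] against [eps mu2 mu1] is left,
    whose quotient is the sign [C(mu1, mu2)]; the phases in front account for
    exchanging [a1] and [a2]. *)
Lemma Yab_const_swap (mu1 mu2 : 'rV[R]_l) (mu3 a1 a2 : vec) (n q : int) : L mu1 -> L mu2 ->
  dot mu1 mu2 = n%:~R -> dot mu1 mu1 * dot mu2 mu2 = q%:~R ->
  phase N (dot a1 (toC mu2) - dot a2 (toC mu1)) * sgnpow (dot mu1 mu1 * dot mu2 mu2)
    * (-1) ^ n * (Yab_const eps N a2 (toC mu2) (toC mu1 + mu3) * Yab_const eps N a1 (toC mu1) mu3) =
  Yab_const eps N a1 (toC mu1) (toC mu2 + mu3) * Yab_const eps N a2 (toC mu2) mu3.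
Proof.
move=> h1 h2 hn hq; have es := eps_swap h1 h2 hn hq.
rewrite -(Yab_const_assoc a2 a1 (toC mu2) (toC mu1) mu3).
rewrite -(Yab_const_assoc a1 a2 (toC mu1) (toC mu2) mu3) hq sgnpow_int.
rewrite (addrC (toC mu2)) (addrC a2) /Yab_const es.
rewrite expfzDr ?oppr_eq0 ?oner_eq0 // !dotDl !phaseD.
have ph : phase N (- dot a2 (toC mu1)) * phase N (dot a2 (toC mu1)) = 1.
  by rewrite -phaseD addNr phase0.
rewrite -[RHS]mulr1 -ph; ring.
Qed.

(** The lattice product is an integer, so the exponent of the statement
    differs from the product of the full charges by an integer. *)
Lemma dot_lattice (mu nu : 'rV[R]_l) (n : int) (a b : vec) : dot mu nu = n%:~R ->
  dot (toC mu + a) (toC nu + b) =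
  dot a b + dot (toC mu) b + dot (toC nu) a + n%:~R.
Proof.
move=> h; rewrite !dotDl !dotDr dot_toC h (dotC a (toC nu)).
have -> : ((n%:~R : R)%:C)%C = n%:~R :> C by exact: rmorph_int.
ring.
Qed.

End Main.

Theorem proposition5p3 (R : realType) (l : nat)
  (L : set 'rV[R]_l) (hL : integral_lattice L)
  (eps : 'rV[R[i]]_l -> 'rV[R[i]]_l -> R[i]) (heps : cocycle_structure eps L)
  (N : int) (hN : odd `|N|%N)
  (mu1 mu2 mu3 : 'rV[R]_l) (hmu1 : L mu1) (hmu2 : L mu2) (hmu3 : L mu3)
  (a1 a2 a3 : 'rV[R[i]]_l) (u v w : fock R l) :
  let eta12 : R[i] := - dot a1 a2 - dot (toC mu1) a2 - dot (toC mu2) a1 in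
  let eta13 : R[i] := - dot a1 a3 - dot (toC mu1) a3 - dot (toC mu3) a1 in
  let C12 : R[i] := phase N (dot a1 (toC mu2) - dot a2 (toC mu1))
             * sgnpow (dot mu1 mu1 * dot mu2 mu2) in
  let U := tens u (toC mu1 + a1) in
  let V := tens v (toC mu2 + a2) in
  let W := tens w (toC mu3 + a3) in
  forall e : 'rV[R[i]]_3,
    mul3 (jacobi_kernel z1 z2 z0 1 eta12)
         (Yproduct eps N z1 z2 a1 a2 a3 U V W) e
    - C12 *: mul3 (jacobi_kernel z2 z1 z0 (-1) eta12)
                  (Yproduct eps N z2 z1 a2 a1 a3 V U W) e
    = mul3 (jacobi_kernel z1 z0 z2 1 (- eta13))
           (Yiterate eps N a1 a2 a3 U V W) e.
Proof.
move=> eta12 eta13 C12 U V W.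
have [_ dotL] := hL.
have /intrP[n12 h12] := dotL _ _ hmu1 hmu2.
have /intrP[n13 h13] := dotL _ _ hmu1 hmu3.
have /intrP[q1 hq1] := dotL _ _ hmu1 hmu1.
have /intrP[q2 hq2] := dotL _ _ hmu2 hmu2.
pose b1 := toC mu1 + a1; pose b2 := toC mu2 + a2; pose b3 := toC mu3 + a3.
have e12 : eta12 = - dot b1 b2 + n12%:~R by rewrite /eta12 (dot_lattice _ _ h12); ring.
have e13 : - eta13 = dot b1 b3 - n13%:~R by rewrite /eta13 (dot_lattice _ _ h13); ring.
have [in1 out1] := Yproduct_modes eps hN (toC mu1) (toC mu2) (toC mu3) a1 a2 a3 u v w.
have [in2 out2] := Yproduct_modes eps hN (toC mu2) (toC mu1) (toC mu3) a2 a1 a3 v u w.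
have [in3 out3] := Yiterate_modes eps hN (toC mu1) (toC mu2) (toC mu3) a1 a2 a3 u v w.
have hq : dot mu1 mu1 * dot mu2 mu2 = (q1 * q2)%:~R by rewrite hq1 hq2 rmorphM.
have swap := Yab_const_swap N heps (toC mu3) a1 a2 hmu1 hmu2 h12 hq.
(* The three terms land in the same sector, with the same exponents, only up to
   the order of the charges. *)
have s2 : b2 + (b1 + b3) = b1 + (b2 + b3) by exact: addrCA.
have s3 : b1 + b2 + b3 = b1 + (b2 + b3) by exact/esym/addrA.
have d1 : dot b1 (b2 + b3) = dot b1 b2 + dot b1 b3 by rewrite dotDr.
have d2 : dot b2 (b1 + b3) = dot b1 b2 + dot b2 b3 by rewrite dotDr (dotC b2 b1).
have d3 : dot (b1 + b2) b3 = dot b1 b3 + dot b2 b3 by rewrite dotDl.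
rewrite d1 in in1 out1; rewrite d2 s2 in in2 out2; rewrite d3 s3 (Yab_const_assoc N heps) in in3 out3.
rewrite e12 e13.
have J := @jacobi_of_modes _ _ _ (fun x => tens x (b1 + (b2 + b3))) (tens_lin (b1 + (b2 + b3)))
  (dot b1 b2) (dot b1 b3) (dot b2 b3)
  (Yab_const eps N a1 (toC mu1) (toC mu2 + toC mu3) * Yab_const eps N a2 (toC mu2) (toC mu3))
  (Yab_const eps N a2 (toC mu2) (toC mu1 + toC mu3) * Yab_const eps N a1 (toC mu1) (toC mu3))
  C12 n12 n13
  (fun p q => Yab eps N a1 (a2 + a3) U p (Yab eps N a2 a3 V q W))
  (fun p q => Yab eps N a2 (a1 + a3) V p (Yab eps N a1 a3 U q W))
  (fun p q => Yab eps N (a1 + a2) a3 (Yab eps N a1 a2 U p V) q W)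
  _ _ _
  (fprod12_biser b1 b2 b3 u v w) (fprod21_biser b1 b2 b3 u v w) (fiterate_biser b1 b2 b3 u v w).
have {}J := J in1.
have {}J := J in2.
have {}J := J (fun s r => in3 r s) out1.
have {}J := J out2 out3.
have {}J := J swap.
have {}J := J (@fock_jacobi _ _ b1 b2 b3 u v w).
exact: J.
Qed.
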